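(* Let $1<p<\infty$. Every non-reflexive closed subspace $Y$ of $V_p^0$ contains an isomorphic copy of $c_0$ or an isomorphic copy of $\ell_p$.
   Context: For $f:[0,1]\to\mathbb{R}$ and a partition $\mathcal{P}=\{0=t_0<\dots<t_n=1\}$ of $[0,1]$ put $\alpha_p(f,\mathcal{P})=\left(\sum_{i=0}^{n-1}|f(t_{i+1})-f(t_i)|^p\right)^{1/p}$ and $\delta(\mathcal{P})=\max_i(t_{i+1}-t_i)$. Let $\|f\|_{V_p}=\sup_{\mathcal{P}}\alpha_p(f,\mathcal{P})$, $V_p=\{f:[0,1]\to\mathbb{R}: f(0)=0,\ \|f\|_{V_p}<\infty\}$ and $V_p^0=\{f\in V_p:\lim_{\varepsilon\to0}\sup\{\alpha_p(f,\mathcal{P}):\delta(\mathcal{P})\le\varepsilon\}=0\}$, Banach spaces with norm $\|\cdot\|_{V_p}$. *)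

(* Defs.v *)
From HB Require Import structures.
From mathcomp Require Import all_boot all_order all_algebra.
From mathcomp Require Import all_classical all_reals all_analysis.
Import Order.TTheory GRing.Theory Num.Theory.
Import numFieldNormedType.Exports.

Set Implicit Arguments.
Unset Strict Implicit.
Unset Printing Implicit Defensive.

Local Open Scope classical_set_scope.
Local Open Scope ring_scope.

(* A linear subspace Y of E (not necessarily closed), as a normed space with
   the restricted norm. *)
Section Lsubspace.
Variables (R : realType) (E : normedModType R) (Y : submodClosed E).

Record lsubspace := Lsubspace { lsubspace_val : E; _ : lsubspace_val \in Y }.

HB.instance Definition _ := [isSub for lsubspace_val].
HB.instance Definition _ := [Choice of lsubspace by <:].
HB.instance Definition _ := [SubChoice_isSubLmodule of lsubspace by <:].

Lemma lsubspace_normD (x y : lsubspace) :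
  `|val (x + y)| <= `|val x| + `|val y|.
Proof. by rewrite raddfD ler_normD. Qed.

Lemma lsubspace_normZ (a : R) (x : lsubspace) :
  `|val (a *: x)| = `|a| * `|val x|.
Proof. by rewrite linearZ/= normrZ. Qed.

Lemma lsubspace_norm0 (x : lsubspace) : `|val x| = 0 -> x = 0.
Proof. by move=> /normr0_eq0 x0; apply/val_inj; rewrite x0 raddf0. Qed.

HB.instance Definition _ := Lmodule_isNormed.Build R lsubspace
  lsubspace_normD lsubspace_normZ lsubspace_norm0.

End Lsubspace.

(* The topological dual of E with the operator norm. *)
Section Cdual.
Variables (R : realType) (E : normedModType R).

Definition dual_pred : {pred (E -> R^o)} :=
  fun f => `[< linear f /\ continuous f >].

Lemma dual_submod : submod_closed dual_pred.
Proof.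
split.
  apply/asboolP; split; last by move=> x; exact: cvg_cst.
  by move=> a x y; rewrite /= scaler0 addr0.
move=> a f g /asboolP[lf cf] /asboolP[lg cg]; apply/asboolP; split.
  move=> b x y.
  rewrite !fctE lf lg.
  by rewrite !scalerDr addrACA !scalerA (mulrC a).
by move=> x; apply: cvgD; [apply: cvgZr; exact: cf|exact: cg].
Qed.

HB.instance Definition _ := GRing.isSubmodClosed.Build R (E -> R^o) dual_pred
  dual_submod.

Record cdual := Cdual { dual_fun :> E -> R^o; _ : dual_fun \in dual_pred }.

HB.instance Definition _ := [isSub for dual_fun].
HB.instance Definition _ := [Choice of cdual by <:].
HB.instance Definition _ := [SubChoice_isSubLmodule of cdual by <:].

Definition dual_norm (f : cdual) : R := sup [set `|f x| | x in [set x | `|x| <= 1]].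

Lemma dualP (f : cdual) : linear f /\ continuous f.
Proof. by case: f => f /= /asboolP. Qed.

HB.instance Definition _ (f : cdual) := GRing.isLinear.Build R E R^o _ f (dualP f).1.

Lemma dual_has_sup (f : cdual) : has_sup [set `|f x| | x in [set x | `|x| <= 1]].
Proof.
split; first by exists `|f 0|, 0 => //=; rewrite normr0 ler01.
have /linear_boundedP : bounded_near (f : {linear E -> R^o}) (nbhs (0 : E)).
  exact: (continuous_linear_bounded _ ((dualP f).2 0)).
case=> y [_ /(_ (`|y| + 1)%R)]; rewrite (le_lt_trans (ler_norm y)) ?ltrDl// => fr.
exists (`|y| + 1) => _ [x /= x1 <-].
by apply: (le_trans (fr isT x)); rewrite ler_piMr.
Qed.

Lemma dual_norm_ub (f : cdual) x : `|x| <= 1 -> `|f x| <= dual_norm f.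
Proof. by move=> x1; apply: sup_upper_bound; [exact: dual_has_sup|exists x]. Qed.

Lemma dual_norm_le (f : cdual) c :
  (forall x, `|x| <= 1 -> `|f x| <= c) -> dual_norm f <= c.
Proof.
move=> H; apply: ge_sup; first by case: (dual_has_sup f).
by move=> _ [x /= x1 <-]; exact: H.
Qed.

Lemma dual_normD (f g : cdual) : dual_norm (f + g) <= dual_norm f + dual_norm g.
Proof.
apply: dual_norm_le => x x1; rewrite (le_trans (ler_normD _ _))//.
by rewrite lerD// dual_norm_ub.
Qed.

Lemma dual_normZ (a : R) (f : cdual) : dual_norm (a *: f) = `|a| * dual_norm f.
Proof.
have le b (g : cdual) : dual_norm (b *: g) <= `|b| * dual_norm g.
  apply: dual_norm_le => x x1.
  by rewrite /= normrM ler_wpM2l// dual_norm_ub.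
apply/eqP; rewrite eq_le le/=; have [->|a0] := eqVneq a 0.
  rewrite normr0 mul0r; apply: (le_trans (normr_ge0 ((0 *: f : cdual) 0))).
  by rewrite dual_norm_ub// normr0.
rewrite -ler_pdivlMl ?normr_gt0// -normfV.
by apply: le_trans (le _ _); rewrite scalerA mulVf// scale1r.
Qed.

Lemma dual_norm_eq0 (f : cdual) : dual_norm f = 0 -> f = 0.
Proof.
move=> f0; apply/val_inj/funext => x /=.
have [->|x0] := eqVneq x 0; first exact: linear0.
have nx : `|(`|x|^-1 *: x)| <= 1.
  by rewrite normrZ normfV normr_id mulVf// normr_eq0.
have := dual_norm_ub f nx; rewrite f0 normr_le0 linearZ/= mulf_eq0 invr_eq0.
by rewrite normr_eq0 (negPf x0)/= => /eqP.
Qed.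

HB.instance Definition _ := Lmodule_isNormed.Build R cdual
  dual_normD dual_normZ dual_norm_eq0.

End Cdual.

(* Surjectivity of the canonical map E -> E**, x |-> (phi |-> phi x). *)
Definition reflexive_space (R : realType) (E : normedModType R) : Prop :=
  forall Phi : cdual (cdual E), exists x : E, forall phi : cdual E, Phi phi = phi x.

Definition isomorphic (R : realType) (E F : normedModType R) : Prop :=
  exists (T : {linear E -> F}) (S : {linear F -> E}),
    [/\ cancel T S, cancel S T, continuous T & continuous S].

(* Some linear subspace Z of E is linearly homeomorphic to F. *)
Definition contains_copy (R : realType) (E F : normedModType R) : Prop :=
  exists Z : submodClosed E, isomorphic F (lsubspace Z).

(* An [0, +oo]-valued seminorm is a real-valued one where it is finite. *)
Section ExtNorm.
Local Open Scope ereal_scope.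
Variables (R : realType) (V : lmodType R) (N : V -> \bar R).
Hypothesis N_ge0 : forall x, 0 <= N x.
Hypothesis ND : forall x y, N (x + y)%R <= N x + N y.
Hypothesis NZ : forall (a : R) x, N (a *: x)%R <= `|a|%:E * N x.

Lemma extnorm0 : N 0%R = 0.
Proof.
apply/eqP; rewrite eq_le N_ge0 andbT.
by have := NZ 0 0; rewrite scale0r normr0 mul0e.
Qed.

Lemma extnorm_fin x : N x < +oo -> N x \is a fin_num.
Proof. by rewrite ge0_fin_numE. Qed.

Lemma extnormD_lty x y : N x < +oo -> N y < +oo -> N (x + y)%R < +oo.
Proof. by move=> x1 y1; rewrite (le_lt_trans (ND _ _))// lte_add_pinfty. Qed.

Lemma extnormZ_lty (a : R) x : N x < +oo -> N (a *: x)%R < +oo.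
Proof. by move=> x1; rewrite (le_lt_trans (NZ _ _))// lte_mul_pinfty. Qed.

Lemma fine_extnormD x y : N x < +oo -> N y < +oo ->
  (fine (N (x + y)) <= fine (N x) + fine (N y))%R.
Proof.
move=> x1 y1; rewrite -lee_fin EFinD !fineK ?extnorm_fin//.
exact: extnormD_lty.
Qed.

Lemma fine_extnormZ (a : R) x : N x < +oo ->
  fine (N (a *: x)%R) = (`|a| * fine (N x))%R.
Proof.
have le b y : N y < +oo -> (fine (N (b *: y)%R) <= `|b| * fine (N y))%R.
  move=> y1; rewrite -lee_fin EFinM !fineK ?extnorm_fin//.
  exact: extnormZ_lty.
move=> x1; apply/eqP; rewrite eq_le le//=; have [->|a0] := eqVneq a 0%R.
  by rewrite normr0 mul0r fine_ge0.
rewrite -ler_pdivlMl ?normr_gt0// -normfV.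
apply: le_trans (le _ _ _); last exact: extnormZ_lty.
by rewrite scalerA mulVf// scale1r.
Qed.

End ExtNorm.

Section lp.
Variables (R : realType) (p : R).

Definition lp_enorm (x : nat -> R^o) : \bar R :=
  ((\sum_(0 <= k <oo) (`|x k| `^ p)%:E) `^ p^-1)%E.

Lemma lp_enorm_ge0 x : (0 <= lp_enorm x)%E.
Proof. exact: poweR_ge0. Qed.

Hypothesis p1 : 1 < p.
Let p0 : 0 < p := lt_trans ltr01 p1.

Lemma lp_enormE x : lp_enorm x = 'N[counting]_p%:E[EFin \o x]%E.
Proof.
rewrite Lnorm_counting//; congr (_ `^ _)%E.
Qed.

Lemma lp_enormD x y : (lp_enorm (x + y)%R <= lp_enorm x + lp_enorm y)%E.
Proof. by rewrite !lp_enormE; apply: minkowski_EFin => //; exact: ltW. Qed.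

Lemma lp_enormZ a x : (lp_enorm (a *: x)%R <= `|a|%:E * lp_enorm x)%E.
Proof.
rewrite /lp_enorm.
under eq_eseriesr do rewrite /= normrM powRM// EFinM.
rewrite nneseriesZl; last by move=> ? _; rewrite lee_fin powR_ge0.
rewrite poweRM ?lee_fin ?powR_ge0//; last first.
  by apply: nneseries_ge0 => ? _ _; rewrite lee_fin powR_ge0.
by rewrite poweR_EFin -powRrM mulfV ?gt_eqF// powRr1.
Qed.

Lemma lp_enorm_ge x k : (`|x k|%:E <= lp_enorm x)%E.
Proof.
have xk0 i : (0 <= (`|x i| `^ p)%:E)%E by rewrite lee_fin powR_ge0.
rewrite -[`|x k|](_ : (`|x k| `^ p) `^ p^-1 = _); last first.
  by rewrite -powRrM mulfV ?gt_eqF// powRr1.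
rewrite -poweR_EFin; apply: gt0_ler_poweR.
- by rewrite invr_ge0 ltW.
- by rewrite in_itv/= xk0 leey.
- by rewrite in_itv/= nneseries_ge0// leey.
- apply: le_trans (nneseries_lim_ge k.+1 _) => //.
  by rewrite big_nat_recr//= leeDr// sume_ge0.
Qed.

Lemma minkowski_fin n (a b : nat -> R) :
  (\sum_(i < n) `|a i + b i| `^ p) `^ p^-1 <=
  (\sum_(i < n) `|a i| `^ p) `^ p^-1 + (\sum_(i < n) `|b i| `^ p) `^ p^-1.
Proof.
pose cut (u : nat -> R) : nat -> R^o := fun i => if (i < n)%N then u i else 0.
have cutE u : lp_enorm (cut u) = ((\sum_(i < n) `|u i| `^ p) `^ p^-1)%:E.
  rewrite /lp_enorm (nneseries_split 0 n); last first.
    by move=> k _; rewrite lee_fin powR_ge0.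
  rewrite [X in (_ + X)%E]eseries0 ?adde0; last first.
    by move=> k nk _; rewrite /cut ltnNge nk/= normr0 powR0// gt_eqF.
  rewrite -poweR_EFin add0n big_mkord -sumEFin; congr (_ `^ _)%E.
  by apply: eq_bigr => i _; rewrite /cut ltn_ord.
have -> : (\sum_(i < n) `|a i + b i| `^ p) `^ p^-1 =
    fine (lp_enorm (cut a + cut b)).
  rewrite -[LHS]/(fine ((\sum_(i < n) `|(fun k => a k + b k) i| `^ p) `^ p^-1)%:E).
  rewrite -cutE; congr (fine (lp_enorm _)); apply/funext => i.
  by rewrite /cut fctE; case: ifPn => // _; rewrite addr0.
have fin u : (lp_enorm (cut u) < +oo)%E by rewrite cutE ltry.
apply: le_trans (fine_extnormD lp_enorm_ge0 lp_enormD (fin a) (fin b)) _.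
by rewrite !cutE.
Qed.

(* The proof of 1 < p is an argument of the predicates and types below because
   their linear structure depends on it. *)
Definition lp_pred & 1 < p : {pred (nat -> R^o)} :=
  fun x => `[< (lp_enorm x < +oo)%E >].

Lemma lp_submod : submod_closed (lp_pred p1).
Proof.
split; first by apply/asboolP; rewrite (extnorm0 lp_enorm_ge0 lp_enormZ).
move=> a x y /asboolP x1 /asboolP y1; apply/asboolP.
have ax1 := extnormZ_lty lp_enormZ a x1.
exact: (extnormD_lty lp_enormD ax1 y1).
Qed.

HB.instance Definition _ :=
  GRing.isSubmodClosed.Build R (nat -> R^o) (lp_pred p1) lp_submod.

Record lp := Lp { lp_seq :> nat -> R^o; _ : lp_seq \in lp_pred p1 }.

HB.instance Definition _ := [isSub for lp_seq].
HB.instance Definition _ := [Choice of lp by <:].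
HB.instance Definition _ := [SubChoice_isSubLmodule of lp by <:].

Definition lp_norm (x : lp) : R := fine (lp_enorm x).

Lemma lpP (x : lp) : (lp_enorm x < +oo)%E.
Proof. by case: x => x /= /asboolP. Qed.

Lemma lp_normD (x y : lp) : lp_norm (x + y) <= lp_norm x + lp_norm y.
Proof. exact: (fine_extnormD lp_enorm_ge0 lp_enormD (lpP x) (lpP y)). Qed.

Lemma lp_normZ (a : R) (x : lp) : lp_norm (a *: x) = `|a| * lp_norm x.
Proof. exact: (fine_extnormZ lp_enorm_ge0 lp_enormZ a (lpP x)). Qed.

Lemma lp_norm_eq0 (x : lp) : lp_norm x = 0 -> x = 0.
Proof.
move=> x0; apply/val_inj/funext => k /=; apply/normr0_eq0/eqP.
rewrite eq_le normr_ge0 andbT -lee_fin -[X in (_ <= X%:E)%E]x0.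
rewrite fineK ?(extnorm_fin lp_enorm_ge0) ?lp_enorm_ge//; exact: lpP.
Qed.

HB.instance Definition _ := Lmodule_isNormed.Build R lp
  lp_normD lp_normZ lp_norm_eq0.

End lp.

Section c0.
Variable R : realType.

Definition c0_enorm (x : nat -> R^o) : \bar R :=
  ereal_sup (range (fun k => `|x k|%:E)).

Lemma c0_enorm_ge x k : (`|x k|%:E <= c0_enorm x)%E.
Proof. by apply: ereal_sup_ubound; exists k. Qed.

Lemma c0_enorm_ge0 x : (0 <= c0_enorm x)%E.
Proof. by apply: le_trans (c0_enorm_ge x 0); rewrite lee_fin. Qed.

Lemma c0_enormD x y : (c0_enorm (x + y)%R <= c0_enorm x + c0_enorm y)%E.
Proof.
apply: ge_ereal_sup => _ [k _ <-].
apply: le_trans (leeD (c0_enorm_ge x k) (c0_enorm_ge y k)).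
by rewrite -EFinD lee_fin ler_normD.
Qed.

Lemma c0_enormZ a x : (c0_enorm (a *: x)%R <= `|a|%:E * c0_enorm x)%E.
Proof.
apply: ge_ereal_sup => _ [k _ <-]; rewrite normrM EFinM.
by rewrite lee_wpmul2l ?lee_fin// c0_enorm_ge.
Qed.

Definition c0_pred : {pred (nat -> R^o)} := fun x => `[< x @ \oo --> (0 : R^o) >].

Lemma c0_submod : submod_closed c0_pred.
Proof.
split; first by apply/asboolP; exact: cvg_cst.
move=> a x y /asboolP x0 /asboolP y0; apply/asboolP.
rewrite -[X in _ --> X]addr0 -[X in _ --> X + _](scaler0 _ a).
by apply: cvgD => //; exact: cvgZl_tmp.
Qed.

HB.instance Definition _ :=
  GRing.isSubmodClosed.Build R (nat -> R^o) c0_pred c0_submod.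

Record c0 := C0 { c0_seq :> nat -> R^o; _ : c0_seq \in c0_pred }.

HB.instance Definition _ := [isSub for c0_seq].
HB.instance Definition _ := [Choice of c0 by <:].
HB.instance Definition _ := [SubChoice_isSubLmodule of c0 by <:].

Definition c0_norm (x : c0) : R := fine (c0_enorm x).

Lemma c0P (x : c0) : (c0_enorm x < +oo)%E.
Proof.
case: x => x /= /asboolP x0.
have /cvg_seq_bounded[M [_ /(_ (`|M| + 1))]] : cvgn x by apply/cvg_ex; exists 0.
rewrite (le_lt_trans (ler_norm M)) ?ltrDl// => xM.
apply: (@le_lt_trans _ _ (`|M| + 1)%:E); last exact: ltry.
by apply: ge_ereal_sup => _ [k _ <-]; rewrite lee_fin; exact: xM.
Qed.

Lemma c0_normD (x y : c0) : c0_norm (x + y) <= c0_norm x + c0_norm y.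
Proof. exact: (fine_extnormD c0_enorm_ge0 c0_enormD (c0P x) (c0P y)). Qed.

Lemma c0_normZ (a : R) (x : c0) : c0_norm (a *: x) = `|a| * c0_norm x.
Proof. exact: (fine_extnormZ c0_enorm_ge0 c0_enormZ a (c0P x)). Qed.

Lemma c0_norm_eq0 (x : c0) : c0_norm x = 0 -> x = 0.
Proof.
move=> x0; apply/val_inj/funext => k /=; apply/normr0_eq0/eqP.
rewrite eq_le normr_ge0 andbT -lee_fin -[X in (_ <= X%:E)%E]x0.
rewrite fineK ?(extnorm_fin c0_enorm_ge0) ?c0_enorm_ge//; exact: c0P.
Qed.

HB.instance Definition _ := Lmodule_isNormed.Build R c0
  c0_normD c0_normZ c0_norm_eq0.

End c0.

Section Vp.
Variables (R : realType) (p : R).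
Implicit Types (f g : {i01 R} -> R^o) (s : seq {i01 R}).

(* The partition 0 = t_0 < t_1 < ... < t_n = 1 is encoded by [:: t_1; ...; t_n]. *)
Definition partition01 s := path <%R 0%:i01 s /\ last 0%:i01 s = 1%:i01.

Definition node s (i : nat) : {i01 R} := nth 0%:i01 (0%:i01 :: s) i.

Definition mesh s : R :=
  \big[Num.max/0]_(i < size s) ((node s i.+1)%:num - (node s i)%:num).

Definition alpha_p f s : R :=
  (\sum_(i < size s) `|f (node s i.+1) - f (node s i)| `^ p) `^ p^-1.

Definition Vp_enorm f : \bar R :=
  ereal_sup [set (alpha_p f s)%:E | s in partition01].

Definition Vp_modulus f (e : R) : \bar R :=
  ereal_sup [set (alpha_p f s)%:E | s in [set s | partition01 s /\ mesh s <= e]].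

Hypothesis p1 : 1 < p.

Lemma alpha_pD f g s : alpha_p (f + g) s <= alpha_p f s + alpha_p g s.
Proof.
have -> : alpha_p (f + g) s = (\sum_(i < size s)
    `|f (node s i.+1) - f (node s i) + (g (node s i.+1) - g (node s i))|
      `^ p) `^ p^-1.
  by congr (_ `^ _); apply: eq_bigr => i _; rewrite fctE opprD addrACA.
exact: (minkowski_fin p1 (size s) (fun i => f (node s i.+1) - f (node s i))
  (fun i => g (node s i.+1) - g (node s i))).
Qed.

Lemma alpha_pZ a f s : alpha_p (a *: f) s = `|a| * alpha_p f s.
Proof.
rewrite /alpha_p.
under eq_bigr do rewrite fctE -scalerBr normrM powRM//.
rewrite -mulr_sumr powRM ?powR_ge0 ?sumr_ge0//.
by rewrite -powRrM mulfV ?gt_eqF ?(lt_trans ltr01)// powRr1.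
Qed.

Lemma supalpha_pD (S : set (seq {i01 R})) f g :
  (ereal_sup [set (alpha_p (f + g) s)%:E | s in S] <=
   ereal_sup [set (alpha_p f s)%:E | s in S] +
   ereal_sup [set (alpha_p g s)%:E | s in S])%E.
Proof.
apply: ge_ereal_sup => _ [s Ss <-].
apply: (@le_trans _ _ ((alpha_p f s)%:E + (alpha_p g s)%:E)%E).
  by rewrite -EFinD lee_fin alpha_pD.
by apply: leeD; apply: ereal_sup_ubound; exists s.
Qed.

Lemma supalpha_pZ (S : set (seq {i01 R})) (a : R) f :
  (ereal_sup [set (alpha_p (a *: f) s)%:E | s in S] <=
   `|a|%:E * ereal_sup [set (alpha_p f s)%:E | s in S])%E.
Proof.
apply: ge_ereal_sup => _ [s Ss <-]; rewrite alpha_pZ EFinM.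
by rewrite lee_wpmul2l ?lee_fin//; apply: ereal_sup_ubound; exists s.
Qed.

Lemma partition01_1 : partition01 [:: 1%:i01].
Proof. by split => //=; rewrite andbT -[_ < _]/(0 < 1 :> R) ltr01. Qed.

Lemma Vp_enorm_ge f s : partition01 s -> ((alpha_p f s)%:E <= Vp_enorm f)%E.
Proof. by move=> ps; apply: ereal_sup_ubound; exists s. Qed.

Lemma Vp_enorm_ge0 f : (0 <= Vp_enorm f)%E.
Proof.
by apply: le_trans (Vp_enorm_ge f partition01_1); rewrite lee_fin powR_ge0.
Qed.

Lemma Vp_enormD f g : (Vp_enorm (f + g)%R <= Vp_enorm f + Vp_enorm g)%E.
Proof. exact: supalpha_pD. Qed.

Lemma Vp_enormZ (a : R) f : (Vp_enorm (a *: f)%R <= `|a|%:E * Vp_enorm f)%E.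
Proof. exact: supalpha_pZ. Qed.

Lemma Vp_enorm_pt f t : f 0%:i01 = 0 -> (`|f t|%:E <= Vp_enorm f)%E.
Proof.
move=> f0; have p0 : 0 < p := lt_trans ltr01 p1.
have key s : partition01 (t :: s) -> (`|f t|%:E <= Vp_enorm f)%E.
  move=> /(Vp_enorm_ge f); apply: le_trans.
  rewrite lee_fin /alpha_p big_ord_recl/= f0 subr0.
  rewrite -[leLHS](_ : (`|f t| `^ p) `^ p^-1 = _); last first.
    by rewrite -powRrM mulfV ?gt_eqF// powRr1.
  have S0 : 0 <= \sum_(i < size s)
      `|f (node (t :: s) i.+2) - f (node (t :: s) i.+1)| `^ p.
    by apply: sumr_ge0 => i _; exact: powR_ge0.
  apply: ge0_ler_powR.
  - by rewrite invr_ge0 ltW.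
  - exact: powR_ge0.
  - by rewrite nnegrE addr_ge0// powR_ge0.
  - by rewrite lerDl.
have [t0|t0] := leP t%:num 0.
  have -> : t = 0%:i01 by apply/val_inj/eqP; rewrite eq_le t0/=.
  by rewrite f0 normr0 Vp_enorm_ge0.
have [t1|t1] := leP 1 t%:num.
  apply: (key [::]); split; first by rewrite /= andbT.
  by apply/val_inj/eqP; rewrite eq_le t1/= andbT.
by apply: (key [:: 1%:i01]); split => //=; rewrite andbT; apply/andP; split.
Qed.

Definition Vp_pred & 1 < p : {pred ({i01 R} -> R^o)} :=
  fun f => `[< f 0%:i01 = 0 /\ (Vp_enorm f < +oo)%E >].

Lemma Vp_submod : submod_closed (Vp_pred p1).
Proof.
split; first by apply/asboolP; rewrite (extnorm0 Vp_enorm_ge0 Vp_enormZ).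
move=> a f g /asboolP[f0 f1] /asboolP[g0 g1]; apply/asboolP; split.
  by rewrite !fctE f0 g0 scaler0 addr0.
have af1 := extnormZ_lty Vp_enormZ a f1.
exact: (extnormD_lty Vp_enormD af1 g1).
Qed.

HB.instance Definition _ :=
  GRing.isSubmodClosed.Build R ({i01 R} -> R^o) (Vp_pred p1) Vp_submod.

Record Vp := MkVp { Vp_fun :> {i01 R} -> R^o; _ : Vp_fun \in Vp_pred p1 }.

HB.instance Definition _ := [isSub for Vp_fun].
HB.instance Definition _ := [Choice of Vp by <:].
HB.instance Definition _ := [SubChoice_isSubLmodule of Vp by <:].

Definition Vp_norm (f : Vp) : R := fine (Vp_enorm f).

Lemma VpP (f : Vp) : f 0%:i01 = 0 /\ (Vp_enorm f < +oo)%E.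
Proof. by case: f => f /= /asboolP. Qed.

Lemma Vp_normD (f g : Vp) : Vp_norm (f + g) <= Vp_norm f + Vp_norm g.
Proof. exact: (fine_extnormD Vp_enorm_ge0 Vp_enormD (VpP f).2 (VpP g).2). Qed.

Lemma Vp_normZ (a : R) (f : Vp) : Vp_norm (a *: f) = `|a| * Vp_norm f.
Proof. exact: (fine_extnormZ Vp_enorm_ge0 Vp_enormZ a (VpP f).2). Qed.

Lemma Vp_norm_eq0 (f : Vp) : Vp_norm f = 0 -> f = 0.
Proof.
move=> x0; have [f0 f1] := VpP f; apply/val_inj/funext => t /=.
apply/normr0_eq0/eqP; rewrite eq_le normr_ge0 andbT -lee_fin.
rewrite -[X in (_ <= X%:E)%E]x0.
by rewrite fineK ?(extnorm_fin Vp_enorm_ge0) ?Vp_enorm_pt.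
Qed.

HB.instance Definition _ := Lmodule_isNormed.Build R Vp
  Vp_normD Vp_normZ Vp_norm_eq0.

(* The supremum over an empty set of partitions is -oo, so the limit at 0 is
   taken over e > 0, where the set is nonempty (fine_partition01). *)
Definition Vp0_pred : {pred Vp} :=
  fun f : Vp => `[< Vp_modulus f e @[e --> 0^'+] --> 0%E >].

Lemma fine_partition01 e : 0 < e -> exists s, partition01 s /\ mesh s <= e.
Proof.
move=> e0; pose n := (Num.truncn e^-1).+1.
have n0 : (0 : R) < n%:R by rewrite ltr0n.
have x0 k : 0 <= Num.min 1 (k%:R / n%:R) :> R.
  by rewrite le_min ler01 divr_ge0.
have x1 k : Num.min 1 (k%:R / n%:R) <= 1 :> R by rewrite ge_min lexx.
pose t k : {i01 R} := Itv01 (x0 k) (x1 k).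
have tE k : (k <= n)%N -> (t k)%:num = k%:R / n%:R :> R.
  by move=> kn; apply/min_idPr; rewrite ler_pdivrMr// mul1r ler_nat.
pose s := mkseq (fun k => t k.+1) n.
have ss : size s = n by rewrite size_mkseq.
have nE k : (k <= n)%N -> node s k = t k.
  case: k => [_|k kn]; last by rewrite /node/= nth_mkseq.
  by apply/val_inj; rewrite [RHS]tE// mul0r.
exists s; split; first split.
- apply/(pathP 0%:i01) => k; rewrite ss => kn.
  rewrite -/(node s k) -[nth _ s k]/(node s k.+1) !nE// 1?ltnW//.
  rewrite -[_ < _]/((t k)%:num < (t k.+1)%:num) !tE// 1?ltnW//.
  by rewrite ltr_pM2r ?invr_gt0// ltr_nat.
- rewrite (last_nth 0%:i01) -/(node s (size s)) ss nE//.
  by apply/val_inj; rewrite [LHS]tE// divff// gt_eqF.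
apply: bigmax_le => [|i _]; first exact: ltW.
have ilt : (i < n)%N by rewrite -ss.
rewrite !nE// 1?ltnW// !tE// 1?ltnW// -mulrBl -natrB// subSnn mul1r.
rewrite -[leRHS]invrK lef_pV2 ?posrE ?invr_gt0//.
by rewrite ltW// truncnS_gt.
Qed.

Lemma Vp_modulus_ge0 (f : {i01 R} -> R^o) e : 0 < e -> (0 <= Vp_modulus f e)%E.
Proof.
move=> /fine_partition01[s se]; apply: (@le_trans _ _ (alpha_p f s)%:E).
  by rewrite lee_fin powR_ge0.
by apply: ereal_sup_ubound; exists s.
Qed.

Lemma Vp0_submod : submod_closed Vp0_pred.
Proof.
have ge0 (f : Vp) : \forall e \near 0^'+, (0 <= Vp_modulus f e)%E.
  near=> e; apply: Vp_modulus_ge0; near: e; exact: nbhs_right_gt.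
split.
  apply/asboolP; apply: cvg_near_cst; near=> e.
  apply/eqP; rewrite eq_le; apply/andP; split; last by near: e; exact: ge0.
  apply: ge_ereal_sup => _ [s _ <-]; rewrite lee_fin.
  have := alpha_pZ 0 (0 : {i01 R} -> R^o) s.
  by rewrite scaler0 normr0 mul0r => ->.
move=> a f g /asboolP f0 /asboolP g0; apply/asboolP.
apply: (@squeeze_cvge _ _ _ _ (cst 0%E) _
  (fun e => `|a|%:E * Vp_modulus f e + Vp_modulus g e)%E).
- near=> e; apply/andP; split; first by near: e; exact: ge0.
  apply: (le_trans (supalpha_pD _ (a *: (f : {i01 R} -> R^o)) g)).
  apply: leeD => //; exact: supalpha_pZ.
- exact: cvg_cst.
- have := cvgeD _ (@cvgeZl _ _ _ _ _ `|a|%:E isT f0) g0.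
  by rewrite mule0 adde0; apply.
Unshelve. all: by end_near. Qed.

HB.instance Definition _ :=
  GRing.isSubmodClosed.Build R Vp Vp0_pred Vp0_submod.

Definition Vp0 := lsubspace Vp0_pred.

End Vp.

(* Main.v *)
(* By James, a non-reflexive Y contains a bounded sequence f whose early and late
   convex combinations keep a positive distance. There are two cases.

   Bumps: for some delta > 0 the ball of radius 2 of Y contains, for every finite
   set of points, a function which is tiny there and at least delta somewhere.
   Along an ultrafilter of such functions, the sets {|h| > tau} are pairwise
   disjoint up to passing to a subsequence, by bounded p-variation. Choose h_i and
   scales eta_i quickly decreasing, and split the intervals I of a partition by
   length: I only sees the h_i whose scale matches its length, and through its
   endpoints the later h_i, which have almost disjoint supports. This gives an
   upper l_p estimate, and the disjoint bumps give a lower one: l_p embeds.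

   No bumps: a subsequence of f converges uniformly to some F in V_p. If it is
   rapidly convergent with scales eta_i, then by Abel summation an interval I of
   size about eta_n satisfies
     (sum_i b_i f_i)(I) = (sum_(i > n) b_i) F(I) + b_n f_n(I) + small.
   If F were in V_p^0, this applied to f_i - F and b_i = 1/M would show that
   averages of f converge to F in norm, since M^(1/p) / M tends to 0, which James
   excludes. So F has a non-vanishing fine variation, and choosing for the tail
   sums of b slowly varying functions with disjoint supports gives c_0. *)
Require Import Defs.
From HB Require Import structures.
From mathcomp Require Import all_boot all_order all_algebra.
From mathcomp Require Import all_classical all_reals all_analysis.
From mathcomp Require Import ring lra.
Import Order.TTheory GRing.Theory Num.Theory.
Import numFieldNormedType.Exports.

Set Implicit Arguments.
Unset Strict Implicit.
Unset Printing Implicit Defensive.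

Local Open Scope classical_set_scope.
Local Open Scope ring_scope.

(** * l_p sums over chains of intervals *)

(** Sums of p-th powers may be restricted to subfamilies of intervals, so all estimates are made
    over chains: finite ordered families with gaps allowed, which can be filtered by length or
    shrunk interval by interval. A function of V_p^0 has a scale below which its variation is
    negligible, and two functions close in the sup norm are close in variation above any fixed scale
    [eta], since at most eta^-1 intervals of a chain are that long. Control in variation thus
    reduces to sup-norm control and separation of scales. The obstacle in the bump case is that
    smallness on finite sets does not make two functions almost disjoint. Along the ultrafilter,
    almost every function is almost disjoint from almost every other one, so a sequence can be built
    term by term, with an invariant that keeps the next choice possible. In the other case the limit
    F may lie outside Y. It is only seen through elements of Y: two averages close to F are compared
    with each other, and the c_0-sequence consists of differences of weighted sums of the f_i. Their
    coefficients are small in l_p, which hides the individual f_i and leaves the tail sums, that is,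
    multiples of F. *)

Lemma le_powR (R : realType) (r a b : R) : 0 <= r -> 0 <= a -> a <= b ->
  a `^ r <= b `^ r.
Proof.
move=> r0 a0 ab; apply: ge0_ler_powR => //; rewrite nnegrE//.
exact: le_trans ab.
Qed.

Section LpSum.
Variables (R : realType) (p : R).
Implicit Types (A : Type).

Definition lpsum A (s : seq A) (phi : A -> R) : R :=
  (\sum_(i <- s) `|phi i| `^ p) `^ p^-1.

Lemma lpsum_ge0 A (s : seq A) phi : 0 <= lpsum s phi.
Proof. exact: powR_ge0. Qed.

Hypothesis p1 : 1 < p.
Let p0 : 0 < p := lt_trans ltr01 p1.

Lemma sum_powR_ge0 A (s : seq A) (phi : A -> R) :
  0 <= \sum_(i <- s) `|phi i| `^ p.
Proof. by apply: sumr_ge0 => i _; exact: powR_ge0. Qed.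

Lemma lpsum_powR A (s : seq A) phi :
  lpsum s phi `^ p = \sum_(i <- s) `|phi i| `^ p.
Proof. by rewrite -powRrM mulVf ?gt_eqF// powRr1// sum_powR_ge0. Qed.

Lemma lpsum_leP A (s : seq A) phi (c : R) : 0 <= c ->
  (lpsum s phi <= c) = (\sum_(i <- s) `|phi i| `^ p <= c `^ p).
Proof.
move=> c0; rewrite -lpsum_powR; apply/idP/idP => [h|].
  by rewrite le_powR ?lpsum_ge0// ltW.
apply: contraTT; rewrite -!ltNge => h.
by apply: gt0_ltr_powR; rewrite ?nnegrE ?lpsum_ge0.
Qed.

Lemma lpsum_le A (s : seq A) phi psi :
  (forall i, `|phi i| <= `|psi i|) -> lpsum s phi <= lpsum s psi.
Proof.
move=> h; rewrite lpsum_leP ?lpsum_ge0// lpsum_powR; apply: ler_sum => i _.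
by rewrite le_powR// ltW.
Qed.

Lemma lpsum_le_in (A : eqType) (s : seq A) phi psi :
  (forall i, i \in s -> `|phi i| <= `|psi i|) -> lpsum s phi <= lpsum s psi.
Proof.
move=> h; rewrite lpsum_leP ?lpsum_ge0// lpsum_powR !big_seq; apply: ler_sum => i si.
by rewrite le_powR ?h// ltW.
Qed.

Lemma lpsumD A (s : seq A) phi psi :
  lpsum s (fun i => phi i + psi i) <= lpsum s phi + lpsum s psi.
Proof.
case: s => [|x s].
  by rewrite /lpsum !big_nil powR0 ?addr0// invr_eq0 gt_eqF.
have := minkowski_fin p1 (size (x :: s)) (fun i => phi (nth x (x :: s) i))
   (fun i => psi (nth x (x :: s) i)).
by rewrite /lpsum !(big_nth x) !big_mkord.
Qed.

Lemma lpsumZ A (s : seq A) a phi :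
  lpsum s (fun i => a * phi i) = `|a| * lpsum s phi.
Proof.
rewrite /lpsum.
under eq_bigr do rewrite normrM powRM//.
rewrite -mulr_sumr powRM ?powR_ge0 ?sum_powR_ge0//.
by rewrite -powRrM mulfV ?gt_eqF// powRr1.
Qed.

Lemma lpsum0 A (s : seq A) : lpsum s (fun=> 0) = 0.
Proof.
have := lpsumZ s 0 (fun=> 0).
by rewrite normr0 !mul0r.
Qed.

Lemma lpsum_eq A (s : seq A) phi psi :
  (forall i, phi i = psi i) -> lpsum s phi = lpsum s psi.
Proof. by move=> /funext ->. Qed.

Lemma lpsum_sum A (s : seq A) (B : Type) (r : seq B) (phi : B -> A -> R) :
  lpsum s (fun i => \sum_(j <- r) phi j i) <= \sum_(j <- r) lpsum s (phi j).
Proof.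
elim: r => [|j r ih].
  by rewrite big_nil (lpsum_eq _ (psi := fun=> 0)) ?lpsum0// => i; rewrite big_nil.
rewrite big_cons; apply: le_trans (lerD (lexx _) ih).
apply: le_trans (lpsumD _ _ _).
by apply: lpsum_le => i; rewrite big_cons.
Qed.

Lemma lpsumB A (s : seq A) phi psi :
  lpsum s (fun i => phi i - psi i) <= lpsum s phi + lpsum s psi.
Proof.
apply: le_trans (lpsumD s phi (fun i => - psi i)) _.
by rewrite lerD2l lpsum_le// => i; rewrite normrN.
Qed.

(** The p-th power is superadditive: write t^p = t t^(p-1) and use that [a] and [b] are at most
    [a + b]. *)
Lemma lpsum_cons A (x : A) (s : seq A) phi :
  lpsum (x :: s) phi <= `|phi x| + lpsum s phi.
Proof.
have sup (a b : R) : 0 <= a -> 0 <= b -> a `^ p + b `^ p <= (a + b) `^ p.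
  move=> a0 b0; have ab0 := addr_ge0 a0 b0.
  rewrite -(mulr_powRB1 a0 p0) -(mulr_powRB1 b0 p0) -(mulr_powRB1 ab0 p0) mulrDl.
  have p10 : 0 <= p - 1 by rewrite subr_ge0 ltW.
  by rewrite lerD// ler_wpM2l// le_powR// ?lerDl ?lerDr.
rewrite lpsum_leP ?addr_ge0 ?lpsum_ge0// big_cons -lpsum_powR; apply: sup => //; exact: lpsum_ge0.
Qed.

Lemma lpsum_le_size A (s : seq A) phi c : (forall i, `|phi i| <= c) ->
  lpsum s phi <= (size s)%:R * c.
Proof.
move=> h; elim: s => [|x s ih].
  by rewrite /lpsum big_nil powR0 ?mul0r// invr_eq0 gt_eqF.
apply: le_trans (lpsum_cons _ _ _) _.
by rewrite /= -natr1 mulrDl mul1r addrC lerD.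
Qed.

Lemma lpsum_filter A (s : seq A) (P : pred A) phi :
  lpsum [seq i <- s | P i] phi = lpsum s (fun i => if P i then phi i else 0).
Proof.
rewrite /lpsum big_filter big_mkcond; congr (_ `^ _).
by apply: eq_bigr => i _; case: ifP => // _; rewrite normr0 powR0 ?gt_eqF.
Qed.

Lemma lpsum_map A B (f : A -> B) (s : seq A) phi :
  lpsum (map f s) phi = lpsum s (phi \o f).
Proof. by rewrite /lpsum big_map. Qed.

Lemma lpsum_perm (A : eqType) (s r : seq A) phi : perm_eq s r ->
  lpsum s phi = lpsum r phi.
Proof. by move=> h; rewrite /lpsum (perm_big _ h). Qed.

Lemma lpsum_const A (s : seq A) c :
  lpsum s (fun=> c) = (size s)%:R `^ p^-1 * `|c|.
Proof.
rewrite /lpsum big_const_seq count_predT iter_addr_0 -[X in X `^ _]mulr_natl powRM ?powR_ge0//.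
by rewrite -powRrM mulfV ?gt_eqF// powRr1.
Qed.

Lemma lpsum_sub (A : eqType) (s r : seq A) phi : subseq s r ->
  lpsum s phi <= lpsum r phi.
Proof.
elim: r s => [|x r ih] [|y s] //=.
  by move=> _; rewrite /lpsum big_nil powR0 ?powR_ge0// invr_eq0 gt_eqF.
move=> h; rewrite lpsum_leP ?lpsum_ge0// lpsum_powR [leRHS]big_cons.
move: h; case: eqP => [-> h|_ h].
  by rewrite big_cons lerD2l -!lpsum_powR ge0_ler_powR ?nnegrE ?lpsum_ge0 ?ih// ltW.
rewrite ler_wpDl ?powR_ge0// -!lpsum_powR.
by rewrite le_powR ?lpsum_ge0 ?ih// ltW.
Qed.

Lemma lpsum_mem (A : eqType) (s : seq A) phi i : i \in s ->
  `|phi i| <= lpsum s phi.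
Proof.
rewrite -sub1seq => /(lpsum_sub phi); apply: le_trans.
by rewrite /lpsum big_seq1 -powRrM mulfV ?gt_eqF// powRr1.
Qed.

(** On p-th powers the two summations can be exchanged, and each [j] then contributes at most |beta
    j|^p D^p. *)
Lemma lpsum_lpsum A B (s : seq A) (r : seq B) (phi : B -> A -> R) beta D :
  0 <= D -> (forall j, lpsum s (phi j) <= D) ->
  lpsum s (fun i => lpsum r (fun j => beta j * phi j i)) <= lpsum r beta * D.
Proof.
move=> D0 h; rewrite lpsum_leP ?mulr_ge0 ?lpsum_ge0//.
under eq_bigr do rewrite (ger0_norm (lpsum_ge0 _ _)) lpsum_powR.
rewrite exchange_big/= powRM ?lpsum_ge0// lpsum_powR mulr_suml.
apply: ler_sum => j _.
under eq_bigr do rewrite normrM powRM//.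
by rewrite -mulr_sumr ler_wpM2l ?powR_ge0// -lpsum_leP.
Qed.

End LpSum.

Section AlmostDisjoint.
Variables (R : realType) (p : R).
Hypothesis p1 : 1 < p.

(* At most one term escapes the tau's; it is absorbed by the l_p norm. *)
Lemma sum_almost_disjoint (r : seq nat) (beta y tau : nat -> R) :
  (forall i, 0 <= tau i) ->
  pairwise (fun i j => (`|y i| <= tau i) || (`|y j| <= tau i)) r ->
  `|\sum_(i <- r) beta i * y i| <=
    lpsum p r (fun i => beta i * y i) + lpsum p r beta * \sum_(i <- r) tau i.
Proof.
move=> tau0 rP; apply: le_trans (ler_norm_sum _ _ _) _.
have [B B0 [rB ->]] : exists2 B, 0 <= B &
    {in r, forall i, `|beta i| <= B} /\ lpsum p r beta = B.
  exists (lpsum p r beta); first exact: lpsum_ge0.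
  by split => // i ri; exact: lpsum_mem.
suff [M [M0|[J rJ M0]] h] : exists2 M, M = 0 \/ (exists2 J, J \in r &
    M = `|beta J * y J|) &
    \sum_(i <- r) `|beta i * y i| <= M + B * \sum_(i <- r) tau i.
- by apply: le_trans h _; rewrite M0 lerD2r lpsum_ge0.
- apply: le_trans h _; rewrite M0 lerD2r.
  exact: (lpsum_mem p1 (fun i => beta i * y i)).
elim: r rP rB => [|n r ih]; first by exists 0; rewrite ?big_nil ?mulr0 ?addr0; auto.
rewrite pairwise_cons => /andP[/allP nr rP] rB.
have rB' : {in r, forall i, `|beta i| <= B}.
  by move=> i ri; rewrite rB// inE ri orbT.
have nB : `|beta n| <= B by rewrite rB ?mem_head.
have [M HM h] := ih rP rB'.
have [yn|yn] := leP `|y n| (tau n).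
  exists M.
    case: HM => [|[J rJ ->]]; [by left|right; exists J => //].
    by rewrite inE rJ orbT.
  rewrite !big_cons mulrDr addrCA; apply: lerD h.
  by rewrite normrM ler_pM.
(* If [y n] is large, every later value is at most [tau n]. The exceptional term of the tail is then
   absorbed by [B * tau n], and [n] becomes the exceptional index. *)
exists `|beta n * y n|; first by right; exists n; rewrite ?mem_head.
rewrite !big_cons lerD2l mulrDr; apply: le_trans h _; rewrite lerD2r.
case: HM => [->|[J rJ ->]]; first by rewrite mulr_ge0.
rewrite normrM ler_pM ?rB'//.
by have := nr _ rJ; rewrite leNgt yn.
Qed.

(** Pointwise in [x] the sum over [r] is at most an l_p norm plus small errors. The l_p norm is
    integrated by [lpsum_lpsum], the errors by the triangle inequality. *)
Lemma lpsum_almost_disjoint (A : eqType) (s : seq A) (r : seq nat)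
    (beta : nat -> R) (phi tau : nat -> A -> R) D E :
  0 <= D -> (forall i x, 0 <= tau i x) ->
  (forall x, x \in s -> pairwise (fun i j =>
    (`|phi i x| <= tau i x) || (`|phi j x| <= tau i x)) r) ->
  (forall i, lpsum p s (phi i) <= D) ->
  \sum_(i <- r) lpsum p s (tau i) <= E ->
  lpsum p s (fun x => \sum_(i <- r) beta i * phi i x) <= lpsum p r beta * (D + E).
Proof.
move=> D0 tau0 rP hD hE.
pose Y x := lpsum p r (fun i => beta i * phi i x).
pose Z x := lpsum p r beta * \sum_(i <- r) tau i x.
apply: (@le_trans _ _ (lpsum p s (fun x => Y x + Z x))).
  apply: lpsum_le_in => // x xs.
  apply: le_trans (ler_norm _); exact: sum_almost_disjoint (rP _ xs).
apply: le_trans (lpsumD p1 _ _ _) _.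
rewrite mulrDr lerD//; first exact: lpsum_lpsum.
rewrite lpsumZ// ger0_norm ?lpsum_ge0// ler_wpM2l ?lpsum_ge0//.
exact: le_trans (lpsum_sum _ _ _ _) hE.
Qed.

End AlmostDisjoint.

(** * Chains of intervals and fine variation *)

Section Chain.
Variable R : realType.
Implicit Types (s : seq (R * R)) (I : R * R) (g : R -> R).

(** Unlike a partition, a chain may have gaps and degenerate intervals, so subfamilies of a chain
    are chains. *)
Definition chain s :=
  all (fun I => [&& 0 <= I.1, I.1 <= I.2 & I.2 <= 1]) s &&
  pairwise (fun I J => I.2 <= J.1) s.

Definition len I := I.2 - I.1.

Definition incr g I := g I.2 - g I.1.

Lemma chain_filter (P : pred (R * R)) s : chain s -> chain [seq I <- s | P I].
Proof.
move=> /andP[/allP s1 s2]; apply/andP; split; last exact: pairwise_filter.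
by apply/allP => I; rewrite mem_filter => /andP[_ /s1].
Qed.

Lemma chain_mem s I : chain s -> I \in s -> [/\ 0 <= I.1, I.1 <= I.2 & I.2 <= 1].
Proof. by move=> /andP[/allP h _] /h /and3P. Qed.

(** The lengths of nonoverlapping intervals in [0, 1] add up to at most 1. The induction carries a
    left bound [a] of the remaining intervals. *)
Lemma chain_size s (eta : R) : chain s -> (forall I, I \in s -> eta <= len I) ->
  (size s)%:R * eta <= 1.
Proof.
move=> /andP[].
suff h (a : R) : 0 <= a <= 1 -> all (fun I => a <= I.1) s ->
    all (fun I => [&& 0 <= I.1, I.1 <= I.2 & I.2 <= 1]) s ->
    pairwise (fun I J => I.2 <= J.1) s -> (forall I, I \in s -> eta <= len I) ->
    a + (size s)%:R * eta <= 1.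
  move=> s1 s2 s3; have := h 0; rewrite add0r ler01 lexx; apply => //.
  by apply: sub_all s1 => I /and3P[].
elim: s a => [|I s ih] a /andP[a0 a1]; first by rewrite mul0r addr0.
rewrite /= => /andP[aI _] /andP[/and3P[I0 I12 I1] s1] /andP[s2 s3] h.
have := ih I.2; rewrite (le_trans I0 I12) I1 => /(_ isT s2 s1 s3).
have h' J : J \in s -> eta <= len J by move=> sJ; apply: h; rewrite inE sJ orbT.
move=> /(_ h') {}ih; have := h _ (mem_head _ _).
rewrite /len -natr1 => hI; lra.
Qed.

Lemma chain1 a b : 0 <= a -> a <= b -> b <= 1 -> chain [:: (a, b)].
Proof. by move=> a0 ab b1; rewrite /chain /= a0 ab b1. Qed.

(** The intervals are sorted by left endpoints. Keeping the permutation of the indices lets an l_p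
    sum over the chain be read as one over [iota 0 m]. *)
Lemma chain_sort (J : nat -> R * R) m :
  (forall i, (i < m)%N -> [/\ 0 <= (J i).1, (J i).1 <= (J i).2 & (J i).2 <= 1]) ->
  (forall i j, (i < m)%N -> (j < m)%N -> i != j ->
    (J i).2 < (J j).1 \/ (J j).2 < (J i).1) ->
  exists2 r, perm_eq r (iota 0 m) & chain (map J r).
Proof.
move=> J1 J2; pose le i j := (J i).1 <= (J j).1.
have le_tr : transitive le by move=> i j k; exact: le_trans.
have le_tot : total le by move=> i j; exact: le_total.
exists (sort le (iota 0 m)); first by rewrite perm_sort.
have mem i : i \in sort le (iota 0 m) -> (i < m)%N.
  by rewrite mem_sort mem_iota add0n.
apply/andP; split.
  apply/allP => _ /mapP[i /mem im ->].
  by have [-> -> ->] := J1 _ im.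
rewrite pairwise_map.
have : pairwise (fun i j => le i j && (i != j)) (sort le (iota 0 m)).
  rewrite (pairwise_relI le (fun i j => i != j)) -sorted_pairwise// sort_sorted//=.
  by rewrite -uniq_pairwise sort_uniq iota_uniq.
apply: (@sub_in_pairwise _ (fun i => i < m)%N); last by apply/allP => i /mem.
move=> i j /= im jm /andP[ij nij]; have [h|h] := J2 _ _ im jm nij; first exact: ltW.
have [_ h2 _] := J1 _ jm; move: ij h; rewrite /le => h3 h4.
by have := lt_le_trans h4 (le_trans h3 h2); rewrite ltxx.
Qed.

End Chain.

(** Dependent choice in which the term chosen at stage [n] may depend on all earlier ones; [Inv]
    records what makes the next choice possible. *)
Lemma history_choice (X : Type) (Inv : seq X -> Prop) (P : seq X -> X -> Prop) :
  Inv [::] ->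
  (forall s, Inv s -> exists x, P s x /\ Inv (rcons s x)) ->
  exists u : nat -> X, forall n, P (mkseq u n) (u n).
Proof.
move=> Inv0 next.
have /choice[f fP] : forall s : {s | Inv s}, exists x,
    P (projT1 s) x /\ Inv (rcons (projT1 s) x).
  by case=> s Is; exact: next.
pose step (s : {s | Inv s}) : {s | Inv s} := exist _ _ (fP s).2.
pose S n := iter n step (exist _ _ Inv0).
exists (fun n => f (S n)) => n.
suff -> : mkseq (fun n => f (S n)) n = projT1 (S n) by exact: (fP _).1.
by elim: n => // n ih; rewrite mkseqS ih.
Qed.

Section Variation.
Variables (R : realType) (p : R).
Implicit Types (g h : R -> R) (s : seq (R * R)).

Definition var_le g C := forall s, chain s -> lpsum p s (incr g) <= C.

Definition fine_var_le g eta eps := forall s, chain s ->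
  (forall I, I \in s -> len I < eta) -> lpsum p s (incr g) <= eps.

(** The condition that cuts V_p^0 out of V_p ([Vp0_predP]). Applied to one-interval chains, it gives
    uniform continuity on [0, 1]. *)
Definition vanishing_var g := forall eps, 0 < eps ->
  exists2 eta, 0 < eta & fine_var_le g eta eps.

Hypothesis p1 : 1 < p.

Lemma fine_var_le_filter g eta eps s : fine_var_le g eta eps -> chain s ->
  lpsum p s (fun I => if len I < eta then incr g I else 0) <= eps.
Proof.
move=> h cs; rewrite -lpsum_filter//; apply: h; first exact: chain_filter.
by move=> I; rewrite mem_filter => /andP[].
Qed.

Lemma var_le_filter g C (P : pred (R * R)) s : var_le g C -> chain s ->
  lpsum p s (fun I => if P I then incr g I else 0) <= C.
Proof. by move=> h cs; rewrite -lpsum_filter//; apply: h; exact: chain_filter. Qed.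

(** At most eta^-1 intervals are this long, and each costs at most [d]. The crude bound suffices
    because [d] will be tiny compared with [eta]. *)
Lemma lpsum_long (phi : R * R -> R) s (eta d : R) : 0 < eta -> 0 <= d ->
  chain s -> (forall I, I \in s -> eta <= len I -> `|phi I| <= d) ->
  lpsum p s (fun I => if eta <= len I then phi I else 0) <= d / eta.
Proof.
move=> eta0 d0 cs h; rewrite -lpsum_filter//.
set r := [seq I <- s | _].
apply: (@le_trans _ _ (lpsum p r (fun=> d))).
  apply: lpsum_le_in => // I; rewrite mem_filter => /andP[eI sI].
  by rewrite (le_trans (h _ sI eI))// ler_norm.
apply: (@le_trans _ _ ((size r)%:R * d)).
  by apply: lpsum_le_size => // _; rewrite ger0_norm.
rewrite mulrC ler_wpM2l// -[leRHS]div1r ler_pdivlMr//; apply: chain_size.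
  exact: chain_filter.
by move=> I; rewrite mem_filter => /andP[].
Qed.

Lemma fine_var_le_pt g (eta eps a b : R) : fine_var_le g eta eps ->
  0 <= a -> a <= b -> b <= 1 -> b - a < eta -> `|g b - g a| <= eps.
Proof.
move=> h a0 ab b1 ba.
have ba' I : I \in [:: (a, b)] -> len I < eta by rewrite inE => /eqP ->.
apply: le_trans (h _ (chain1 a0 ab b1) ba').
exact: (lpsum_mem p1 (incr g) (mem_head (a, b) [::])).
Qed.

End Variation.

Lemma itv01_right (R : realType) (a b : R) :
  0 <= a -> a <= b -> b <= 1 -> 0 <= b <= 1.
Proof. by move=> a0 ab b1; rewrite (le_trans a0 ab). Qed.

Lemma itv01_left (R : realType) (a b : R) :
  0 <= a -> a <= b -> b <= 1 -> 0 <= a <= 1.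
Proof. by move=> a0 ab b1; rewrite a0 (le_trans ab). Qed.

(** * Upper l_p estimates for rapidly separated scales *)

Section Rapid.
Variables (R : realType) (p : R).
Hypothesis p1 : 1 < p.
Variables (f : nat -> R -> R) (eta eps : nat -> R) (C E : R).
Hypothesis f_var : forall k, var_le p (f k) C.
Hypothesis f_fine : forall k, fine_var_le p (f k) (eta k.+1) (eps k).
Hypothesis eta_gt0 : forall k, 0 < eta k.
Hypothesis eta_le : forall k, eta k.+1 <= eta k.
Hypothesis epsE : forall m, \sum_(i <- iota 0 m) eps i <= E.

Lemma rapid_eta_homo i j : (i <= j)%N -> eta j <= eta i.
Proof.
elim: j => [|j ih]; first by rewrite leqn0 => /eqP ->.
rewrite leq_eqVlt => /orP[/eqP -> //|/ih]; exact: le_trans.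
Qed.

Lemma rapid_C_ge0 : 0 <= C.
Proof.
exact: le_trans (lpsum_ge0 _ _ _) (f_var 0 (s := [::]) isT).
Qed.

Lemma rapid_eps_ge0 k : 0 <= eps k.
Proof.
have h (I : R * R) : I \in [::] -> len I < eta k.+1 by [].
exact: le_trans (lpsum_ge0 _ _ _) (f_fine (s := [::]) isT h).
Qed.

Lemma iota_pairwise (P : nat -> nat -> bool) n m :
  (forall i j, (i < j)%N -> P i j) -> pairwise P (iota n m).
Proof.
move=> h; have := iota_ltn_sorted n m.
rewrite (sorted_pairwise ltn_trans); apply: sub_pairwise => i j; exact: h.
Qed.

Lemma rapid_short (beta : nat -> R) m s : chain s ->
  lpsum p s (fun I => \sum_(i <- iota 0 m)
    beta i * (if len I < eta i.+1 then incr (f i) I else 0)) <=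
  \sum_(i <- iota 0 m) `|beta i| * eps i.
Proof.
move=> cs; apply: le_trans (lpsum_sum p1 _ _ _) _.
apply: ler_sum => i _; rewrite lpsumZ// ler_wpM2l//.
exact: fine_var_le_filter.
Qed.

(** A length lies in [eta i.+1, eta i[ for at most one [i], so the terms are exactly disjoint and
    the tolerances can be 0. *)
Lemma rapid_medium (beta : nat -> R) m s : chain s ->
  lpsum p s (fun I => \sum_(i <- iota 0 m)
    beta i * (if eta i.+1 <= len I < eta i then incr (f i) I else 0)) <=
  lpsum p (iota 0 m) beta * C.
Proof.
move=> cs; rewrite -[X in _ * X]addr0.
apply: (@lpsum_almost_disjoint _ _ p1 _ _ _ _ _ (fun _ _ => 0)) => //.
- exact: rapid_C_ge0.
- move=> I _; apply: iota_pairwise => i j ij; rewrite !normr_le0.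
  case: ifP => [/andP[iI _]|_]; last by rewrite eqxx.
  case: ifP => [/andP[_ Ij]|_]; last by rewrite eqxx orbT.
  by have := lt_le_trans Ij (le_trans (rapid_eta_homo ij) iI); rewrite ltxx.
- by move=> i; apply: var_le_filter.
- by rewrite big1// => i _; rewrite lpsum0.
Qed.

(* Short intervals are controlled by the fine variation of f i, long ones by the
   values of f i at their endpoints, and I is medium for at most one i. *)
Lemma rapid_split (beta : nat -> R) m I :
  \sum_(i <- iota 0 m) beta i * incr (f i) I =
  \sum_(i <- iota 0 m) beta i * (if len I < eta i.+1 then incr (f i) I else 0) +
  \sum_(i <- iota 0 m)
    beta i * (if eta i.+1 <= len I < eta i then incr (f i) I else 0) +
  \sum_(i <- iota 0 m) beta i * (if eta i <= len I then incr (f i) I else 0).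
Proof.
rewrite -!big_split/=; apply: eq_bigr => i _; rewrite -!mulrDr; congr (_ * _).
have := eta_le i; case: (ltP (len I) (eta i.+1)) => h1; case: (ltP (len I) (eta i)) => h2 h3 /=;
  rewrite ?addr0 ?add0r//.
by have := lt_le_trans (lt_le_trans h1 h3) h2; rewrite ltxx.
Qed.

Lemma rapid_beta_eps (beta : nat -> R) m :
  \sum_(i <- iota 0 m) `|beta i| * eps i <= lpsum p (iota 0 m) beta * E.
Proof.
apply: le_trans (ler_wpM2l (lpsum_ge0 _ _ _) (epsE m)).
rewrite mulr_sumr big_seq [leRHS]big_seq; apply: ler_sum => i im.
by rewrite ler_wpM2r ?rapid_eps_ge0//; exact: lpsum_mem.
Qed.

Variable tau : nat -> R.
Hypothesis tau_ge0 : forall k, 0 <= tau k.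
Hypothesis tau_eta : forall k, tau k / eta k <= eps k.
Hypothesis f_disj : forall l k y, (l < k)%N -> 0 <= y <= 1 ->
  (`|f l y| <= tau l) || (`|f k y| <= tau l).
Variable c : nat -> R -> R.
Hypothesis c_grid : forall k y, 0 <= y <= 1 ->
  [/\ 0 <= c k y, c k y <= y, y - c k y < eta k & `|f k (c k y)| <= tau k].

(** In an interval of length at least [eta k], the point [c k I.2] lies inside, and [f k] is tiny
    there. The value at an endpoint is therefore almost an increment of [f k] over a subinterval,
    and the errors sum to [tau k / eta k]. *)
Lemma rapid_endpoint (e : R * R -> R) k s :
  (forall I, 0 <= I.1 -> I.1 <= I.2 -> I.2 <= 1 -> e I = I.1 \/ e I = I.2) ->
  (forall s, chain s -> (forall I, I \in s -> eta k <= len I) ->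
    lpsum p s (fun I => f k (e I) - f k (c k I.2)) <= C) ->
  chain s ->
  lpsum p s (fun I => if eta k <= len I then f k (e I) else 0) <= C + eps k.
Proof.
move=> he hC cs.
apply: (@le_trans _ _ (lpsum p s (fun I => (if eta k <= len I then
  f k (e I) - f k (c k I.2) else 0) + (if eta k <= len I then
  f k (c k I.2) else 0)))).
  by apply: lpsum_le => // I; case: ifP => _; rewrite ?addr0// subrK.
apply: le_trans (lpsumD p1 _ _ _) _; apply: lerD.
  rewrite -lpsum_filter//; apply: hC; first exact: chain_filter.
  by move=> I; rewrite mem_filter => /andP[].
apply: le_trans (tau_eta k); apply: lpsum_long => // I /(chain_mem cs)[I0 I12 I1] _.
by have [] := c_grid k (itv01_right I0 I12 I1).
Qed.

(** By [f_disj] the values of the [f i] at a common endpoint are almost disjoint. One [E] bounds the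
    single [eps i] lost in [rapid_endpoint], the other the sum of all tolerances. *)
Lemma rapid_long_endpoint (e : R * R -> R) (beta : nat -> R) m s :
  (forall I, 0 <= I.1 -> I.1 <= I.2 -> I.2 <= 1 -> e I = I.1 \/ e I = I.2) ->
  (forall k s, chain s -> (forall I, I \in s -> eta k <= len I) ->
    lpsum p s (fun I => f k (e I) - f k (c k I.2)) <= C) ->
  chain s ->
  lpsum p s (fun I => \sum_(i <- iota 0 m)
    beta i * (if eta i <= len I then f i (e I) else 0)) <=
  lpsum p (iota 0 m) beta * (C + E + E).
Proof.
move=> he hC cs.
apply: (@lpsum_almost_disjoint _ _ p1 _ _ _ _ _
  (fun i I => if eta i <= len I then tau i else 0)) => //.
- by rewrite addr_ge0 ?rapid_C_ge0// (le_trans _ (epsE 0))// big_nil.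
- by move=> i I; case: ifP.
- move=> I /(chain_mem cs)[I0 I12 I1]; apply: iota_pairwise => i j ij.
  case: (leP (eta i) (len I)) => iI; last by rewrite normr0 lexx.
  rewrite (le_trans (rapid_eta_homo (ltnW ij)) iI); apply: f_disj => //.
  by case: (he _ I0 I12 I1) => ->; [exact: itv01_left I12 I1|exact: itv01_right I12 I1].
- move=> i; apply: le_trans (rapid_endpoint he (hC i) cs) _; rewrite lerD2l.
  apply: le_trans (epsE i.+1); rewrite (bigD1_seq i) ?iota_uniq ?mem_iota//=.
  by rewrite lerDl sumr_ge0// => *; exact: rapid_eps_ge0.
- apply: le_trans (epsE m); apply: ler_sum => i _.
  apply: le_trans (tau_eta i); apply: lpsum_long => // I _ _.
  by rewrite ger0_norm.
Qed.

(** The four summands of the constant come from short intervals, medium intervals, and the right and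
    left endpoints of long ones. *)
Lemma rapid_lp_upper (beta : nat -> R) m s : chain s ->
  lpsum p s (fun I => \sum_(i <- iota 0 m) beta i * incr (f i) I) <=
  lpsum p (iota 0 m) beta * (E + C + (C + E + E) + (C + E + E)).
Proof.
move=> cs; rewrite (lpsum_eq _ _ (rapid_split beta m)).
apply: le_trans (lpsumD p1 _ _ _) _; rewrite mulrDr mulrDr -[leRHS]addrA -mulrDr.
apply: lerD.
  apply: le_trans (lpsumD p1 _ _ _) _; rewrite mulrDr; apply: lerD.
    exact: le_trans (rapid_short _ _ cs) (rapid_beta_eps _ _).
  exact: rapid_medium.
pose e2 (I : R * R) := I.2; pose e1 (I : R * R) := I.1.
rewrite (lpsum_eq _ _ (psi := fun I =>
  \sum_(i <- iota 0 m) beta i * (if eta i <= len I then f i (e2 I) else 0) -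
  \sum_(i <- iota 0 m) beta i * (if eta i <= len I then f i (e1 I) else 0))); last first.
  move=> I; rewrite -sumrB; apply: eq_bigr => i _; rewrite -mulrBr; congr (_ * _).
  by case: ifP; rewrite ?subr0.
apply: le_trans (lpsumB p1 _ _ _) _; rewrite mulrDr; apply: lerD.
  apply: rapid_long_endpoint => //; first by move=> I; right.
  (* Cutting each interval down to the part to the right of its grid point keeps a chain; for left
     endpoints the part to the left is kept. *)
  move=> k r cr hr; pose r' := map (fun I : R * R => (c k I.2, I.2)) r.
  have -> : lpsum p r (fun I => f k (e2 I) - f k (c k I.2)) = lpsum p r' (incr (f k)).
    by rewrite lpsum_map.
  apply: f_var; apply/andP; split.
    apply/allP => _ /mapP[I rI ->] /=; have [I0 I12 I1] := chain_mem cr rI.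
    by have [-> -> _ _] := c_grid k (itv01_right I0 I12 I1); rewrite I1.
  rewrite pairwise_map; move/andP: (cr) => [_].
  apply: (@sub_in_pairwise _ (mem r)); last by apply/allP.
  move=> I J rI rJ /= IJ; apply: le_trans IJ _.
  have [J0 J12 J1] := chain_mem cr rJ.
  have [_ _ h _] := c_grid k (itv01_right J0 J12 J1).
  have := hr _ rJ; rewrite /len; lra.
apply: rapid_long_endpoint => //; first by move=> I; left.
move=> k r cr hr; pose r' := map (fun I : R * R => (I.1, c k I.2)) r.
have -> : lpsum p r (fun I => f k (e1 I) - f k (c k I.2)) = lpsum p r' (incr (f k)).
  by rewrite lpsum_map /lpsum; under eq_bigr do rewrite distrC.
have hc I : I \in r -> I.1 <= c k I.2 /\ c k I.2 <= I.2.
  move=> rI; have [I0 I12 I1] := chain_mem cr rI.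
  have [_ h1 h _] := c_grid k (itv01_right I0 I12 I1).
  have := hr _ rI; rewrite /len; split => //; lra.
apply: f_var; apply/andP; split.
  apply/allP => _ /mapP[I rI ->] /=; have [I0 I12 I1] := chain_mem cr rI.
  by have [-> h] := hc _ rI; rewrite I0 (le_trans h I1).
rewrite pairwise_map; move/andP: (cr) => [_].
apply: (@sub_in_pairwise _ (mem r)); last by apply/allP.
by move=> I J rI rJ /= IJ; apply: le_trans IJ; exact: (hc _ rI).2.
Qed.

End Rapid.

(** * Bumps: sequences equivalent to the basis of l_p *)

Lemma pos_lower_bound (R : realType) (L : seq R) :
  exists2 r : R, 0 < r & forall z, z \in L -> 0 < z -> r <= z.
Proof.
elim: L => [|x L [r r0 rL]]; first by exists 1.
have [x0|x0] := ltP 0 x; last first.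
  exists r => // z; rewrite inE => /orP[/eqP ->|]; last exact: rL.
  by rewrite ltNge x0.
exists (Num.min x r); first by rewrite lt_min x0.
move=> z; rewrite inE => /orP[/eqP -> _|zL z0]; first by rewrite ge_min lexx.
by rewrite ge_min (rL z) ?orbT.
Qed.

Lemma filter_forall_seq (T : Type) (V : set_system T) (I : eqType) (s : seq I)
    (A : I -> set T) : Filter V ->
  (forall i, i \in s -> V (A i)) -> V [set x | forall i, i \in s -> A i x].
Proof.
move=> FV; elim: s => [|i s ih] h; first exact: filterS (@filterT _ V _).
have h1 : V (A i) by apply: h; rewrite mem_head.
have h2 : V [set x | forall j, j \in s -> A j x].
  by apply: ih => j js; apply: h; rewrite inE js orbT.
apply: filterS (filterI h1 h2) => g [g1 g2] j; rewrite inE => /orP[/eqP ->//|].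
exact: g2.
Qed.

Section Bumps.
Variables (R : realType) (p : R).
Hypothesis p1 : 1 < p.
Variables (H : set (R -> R)) (C delta : R).
Hypothesis H_var : forall h, H h -> var_le p h C.
Hypothesis H_van : forall h, H h -> vanishing_var p h.
Hypothesis H_bump : forall (T : seq R) (eps : R), 0 < eps -> exists h,
  [/\ H h, exists2 t : R, 0 <= t <= 1 & delta <= `|h t| &
      forall x : R, x \in T -> 0 <= x <= 1 -> `|h x| <= eps].

(** The sets of functions provided by [H_bump] for finite [T] and positive [eps] form a filter base.
    Along the ultrafilter, functions tend to 0 at each point of [0, 1] while each keeps a value of
    size [delta]. *)
Lemma bump_ultrafilter : exists V : set_system (R -> R),
  [/\ UltraFilter V, V [set h | H h /\ exists2 t : R, 0 <= t <= 1 & delta <= `|h t|] &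
      forall x eps : R, 0 <= x <= 1 -> 0 < eps -> V [set h | `|h x| <= eps]].
Proof.
pose B (Te : seq R * R) := [set h | [/\ H h,
  exists2 t : R, 0 <= t <= 1 & delta <= `|h t| &
  forall x : R, x \in Te.1 -> 0 <= x <= 1 -> `|h x| <= Te.2]].
pose D := [set Te : seq R * R | 0 < Te.2].
have : ProperFilter (filter_from D B).
  apply: filter_from_proper.
    apply: filter_from_filter; first by exists ([::], 1); rewrite /D/= ltr01.
    move=> [T e] [T' e'] /= e0 e'0; exists (T ++ T', Num.min e e').
      by rewrite /D/= lt_min e0.
    move=> h [/= h1 h2 h3]; split; split => // x xT x01.
      by have := h3 x; rewrite mem_cat xT le_min => /(_ isT x01)/andP[].
    by have := h3 x; rewrite mem_cat xT orbT le_min => /(_ isT x01)/andP[].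
  by move=> [T e] /(H_bump T)[h hP]; exists h.
move=> /ultraFilterLemma[V [VU BV]]; exists V; split => //.
  by apply: BV; exists ([::], 1); rewrite /D/= ?ltr01// => h [h1 h2 _].
move=> x e x01 e0; apply: BV; exists ([:: x], e) => //= h [_ _]; apply=> //.
by rewrite inE.
Qed.

Section Ultra.
Variable V : set_system (R -> R).
Hypothesis V_ultra : UltraFilter V.
Hypothesis V_H : V H.
Hypothesis V_null : forall x eps : R, 0 <= x <= 1 -> 0 < eps ->
  V [set h | `|h x| <= eps].

Let V_proper : ProperFilter V.
Proof. exact: ultra_proper. Qed.

(** Points at which the sets {|g| >= tau} accumulate along [V], although [g v] itself tends to 0. *)
Definition recurrent tau (v : R) := 0 <= v <= 1 /\ forall r : R, 0 < r ->
  V [set g | exists x : R, [/\ 0 <= x <= 1, `|x - v| < r & tau <= `|g x|]].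

(* Each recurrent point is the centre of a jump of size tau / 2 of most
   functions, so bounded p-variation leaves room for finitely many. *)
Lemma recurrent_bounded (tau : R) : 0 < tau -> exists K, forall s : seq R,
  uniq s -> (forall v, v \in s -> recurrent tau v) -> (size s < K)%N.
Proof.
(* With n jumps of size tau / 2 over nonoverlapping intervals, n^(1/p) tau / 2 <= C, which bounds
   n. *)
move=> tau0; exists (Num.truncn ((C / (tau / 2)) `^ p)).+1 => s us sP.
have p0 : 0 < p := lt_trans ltr01 p1.
have t20 : 0 < tau / 2 by lra.
(* [r] is at most half of each distance between two points of [s], so the intervals from [v] to a
   point closer than [r] are disjoint. *)
rewrite ltnS; have [r r0 rs] := pos_lower_bound [seq `|v - w| / 2 | v <- s, w <- s].
have Vv v : v \in s -> V [set g | `|g v| <= tau / 2 /\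
    exists x : R, [/\ 0 <= x <= 1, `|x - v| < r & tau <= `|g x|]].
  move=> /sP[v01 h]; exact: filterI (V_null v01 t20) (h _ r0).
have [g [Hg gP]] := filter_ex (filterI V_H (filter_forall_seq _ Vv)).
have /choice[X XP] : forall v : R, exists x : R, v \in s ->
    [/\ 0 <= x <= 1, `|x - v| < r & tau <= `|g x|].
  move=> v; have [/gP[_ [x xP]]|] := boolP (v \in s); [by exists x|by exists 0].
pose I v := (Num.min v (X v), Num.max v (X v)).
have sep (v w : R) : v \in s -> w \in s -> v < w -> (I v).2 < (I w).1.
  move=> vs ws vw; have [_ h1 _] := XP _ vs; have [_ h2 _] := XP _ ws.
  have : r <= `|v - w| / 2.
    apply: rs; first by apply/allpairsP; exists (v, w).
    by rewrite divr_gt0// normr_gt0 subr_eq0 lt_eqF.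
  rewrite ltr0_norm ?subr_lt0// /I /= => h3.
  rewrite gt_max !lt_min.
  move: h1 h2; rewrite !ltr_norml => /andP[h4 h5] /andP[h6 h7].
  by apply/andP; split; apply/andP; split; lra.
have [r' rr' cr'] : exists2 r', perm_eq r' (iota 0 (size s)) &
    chain (map (fun i => I (nth 0 s i)) r').
  apply: chain_sort => [i im|i j im jm ij].
    have si := mem_nth 0 im; have [/andP[a b] _ _] := XP _ si.
    have [/andP[c d] _] := sP _ si.
    by rewrite /I/= le_min a c ge_max b d !ge_min le_max lexx.
  have ne : nth 0 s i != nth 0 s j by rewrite nth_uniq.
  case: (ltgtP (nth 0 s i) (nth 0 s j)) ne => // h _; [left|right];
    by apply: sep => //; exact: mem_nth.
have := H_var Hg cr'; rewrite lpsum_map (lpsum_perm _ _ rr').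
have : lpsum p (iota 0 (size s)) (fun=> tau / 2) <=
    lpsum p (iota 0 (size s)) (incr g \o (fun i => I (nth 0 s i))).
  apply: lpsum_le_in => // i; rewrite mem_iota add0n => /andP[_ im].
  have si := mem_nth 0 im; have [_ _ h1] := XP _ si; have [h2 _] := gP _ si.
  rewrite gtr0_norm// /incr /I /=.
  have : tau / 2 <= `|g (X (nth 0 s i)) - g (nth 0 s i)|.
    by apply: le_trans (lerB_dist _ _); lra.
  by case: (ltP (nth 0 s i) (X (nth 0 s i))) => _ //; rewrite distrC.
move=> /le_trans /[apply].
rewrite lpsum_const// gtr0_norm// size_iota -ler_pdivlMr// => h.
have C0 : 0 <= C / (tau / 2) by apply: le_trans h; exact: powR_ge0.
rewrite truncn_ge_nat ?powR_ge0//.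
apply: le_trans (le_powR (ltW p0) (powR_ge0 _ _) h).
by rewrite -powRrM mulVf ?gt_eqF// powRr1.
Qed.

(** By compactness of [0, 1] the meeting points converge along the ultrafilter. The values of [g]
    make the limit recurrent, and continuity of the fixed [h] passes the lower bound on to it. *)
Lemma recurrent_meet (tau : R) h : H h -> V [set g | exists x : R,
    [/\ 0 <= x <= 1, tau < `|h x| & tau < `|g x|]] ->
  exists2 v, recurrent tau v & tau <= `|h v|.
Proof.
move=> Hh Vh.
have /choice[X XP] : forall g : R -> R, exists y : R,
    (exists x : R, [/\ 0 <= x <= 1, tau < `|h x| & tau < `|g x|]) ->
    [/\ 0 <= y <= 1, tau < `|h y| & tau < `|g y|].
  move=> g; have [[x xP]|nx] := pselect (exists x : R,
    [/\ 0 <= x <= 1, tau < `|h x| & tau < `|g x|]); [by exists x|by exists 0].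
have [v v01 vcl] : exists2 v : R, 0 <= v <= 1 & cluster (X @ V) v.
  have VX : V [set g | X g \in `[0, 1]%R].
    by apply: filterS Vh => g /XP[? _ _]; rewrite /= in_itv.
  have [v [v01 vcl]] := @segment_compact R 0 1 (X @ V) _ VX.
  by exists v => //; move: v01; rewrite /= in_itv.
have Vv (r : R) : 0 < r -> V [set g | `|X g - v| < r].
  move=> r0; have [//|nV] := in_ultra_setVsetC [set g | `|X g - v| < r] V_ultra.
  have [x [/= h1 h2]] := vcl [set x | ~ `|x - v| < r] (ball v r) nV (nbhsx_ballx _ _ r0).
  by exfalso; apply: h1; rewrite distrC.
exists v.
  split => // r r0; apply: filterS (filterI Vh (Vv _ r0)) => g [/XP[x1 x2 x3] /= x4].
  by exists (X g); split => //; exact: ltW.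
apply/ler_addgt0Pr => e e0; have [eta eta0 heta] := H_van Hh e0.
have [g [/XP[/andP[x0 x1] x2 _] /= x4]] := filter_ex (filterI Vh (Vv _ eta0)).
have {x4} : `|h (X g) - h v| <= e.
  move: x4 v01 => + /andP[v0 v1]; rewrite ltr_norml => /andP[h1 h2].
  case: (leP v (X g)) => h3; first by apply: (fine_var_le_pt p1 heta); lra.
  by rewrite distrC; apply: (fine_var_le_pt p1 heta) => //; lra.
have := ler_normD (h (X g) - h v) (h v); rewrite subrK; lra.
Qed.

(** Otherwise any finite set [s] of recurrent points could be enlarged: some [h] violating the
    property satisfies |h| <= tau / 2 on [s], and [recurrent_meet] gives a recurrent [v] with |h v|
    >= tau, which is new. This contradicts [recurrent_bounded]. *)
Lemma mostly_disjoint (tau : R) : 0 < tau ->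
  V [set h | V [set g | forall x : R, 0 <= x <= 1 -> `|h x| <= tau \/ `|g x| <= tau]].
Proof.
move=> tau0; set G := [set h | _].
have [//|nG] := in_ultra_setVsetC G V_ultra.
have [K hK] := recurrent_bounded tau0; exfalso.
suff [s [us ss sP]] : exists s, [/\ uniq s, size s = K &
    forall v, v \in s -> recurrent tau v] by have := hK s us sP; rewrite ss ltnn.
elim: K {hK} => [|n [s [us ss sP]]]; first by exists [::].
have t20 : 0 < tau / 2 by lra.
have Vs v : v \in s -> V [set h | `|h v| <= tau / 2].
  by move=> /sP[v01 _]; exact: V_null.
have [h [[nh Hh] hs]] := filter_ex (filterI (filterI nG V_H) (filter_forall_seq _ Vs)).
have [v vP hv] : exists2 v, recurrent tau v & tau <= `|h v|.
  apply: recurrent_meet => //; have [//|] := in_ultra_setVsetC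
    [set g | forall x : R, 0 <= x <= 1 -> `|h x| <= tau \/ `|g x| <= tau] V_ultra.
  apply: filterS => g /= /existsNP[x /not_implyP[x01 /not_orP[h1 h2]]].
  by exists x; split => //; rewrite ltNge; exact/negP.
exists (v :: s); split => /=; last 2 first.
- by rewrite ss.
- by move=> w; rewrite inE => /orP[/eqP ->|/sP].
by rewrite us andbT; apply/negP => /hs /=; lra.
Qed.

End Ultra.
End Bumps.

(** [c] is the last point before [t] at which |h| <= d. The interval from [c] to [t] then carries a
    large increment while |h| stays large on all of it, which later forces such intervals of
    different functions apart. *)
Lemma last_level (R : realType) (p : R) (p1 : 1 < p) (h : R -> R) (a t d : R) :
  vanishing_var p h -> 0 <= a -> a <= t -> t <= 1 -> `|h a| <= d -> d < `|h t| ->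
  exists c, [/\ a <= c, c <= t, `|h c| <= d &
    forall y, c <= y -> y <= t -> d <= `|h y|].
Proof.
move=> hv a0 at1 t1 ha ht.
pose S := [set y | [/\ a <= y, y <= t & `|h y| <= d]].
have Sa : S a by split.
have hS : has_sup S by split; [exists a|exists t => y []].
pose c := sup S.
have ac : a <= c by exact: sup_upper_bound Sa.
have ct : c <= t by apply: ge_sup; [exists a|move=> y []].
have cont e : 0 < e -> exists2 r, 0 < r & forall y, 0 <= y <= 1 -> `|y - c| < r ->
    `|h y - h c| <= e.
  move=> e0; have [r r0 hr] := hv _ e0; exists r => // y /andP[y0 y1].
  rewrite ltr_norml => /andP[h1 h2].
  case: (leP c y) => h3; first by apply: (fine_var_le_pt p1 hr); lra.
  by rewrite distrC; apply: (fine_var_le_pt p1 hr); lra.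
have hc : `|h c| <= d.
  apply/ler_addgt0Pr => e e0; have [r r0 hr] := cont _ e0.
  have [y [ay yt hy] cy] := sup_adherent r0 hS.
  have yc : y <= c by exact: sup_upper_bound.
  have h1 : `|h y - h c| <= e.
    apply: hr; first by apply/andP; split; lra.
    by rewrite ltr_norml; apply/andP; split; rewrite -/c in cy; lra.
  by have := ler_normD (h y) (h c - h y); rewrite addrC subrK distrC; lra.
have gtc y : c < y -> y <= t -> d < `|h y|.
  move=> cy yt; rewrite ltNge; apply/negP => hy.
  have : y <= c by apply: sup_upper_bound => //; split => //; lra.
  lra.
exists c; split => // y; rewrite le_eqVlt => /orP[/eqP <-{y} _|cy yt]; last first.
  exact/ltW/gtc.
apply/ler_addgt0Pr => e e0; have [r r0 hr] := cont _ e0.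
have ct' : c < t.
  rewrite lt_neqAle ct andbT; apply/eqP => ce; move: ht; rewrite -ce; lra.
pose y := Num.min t (c + r / 2).
have [cy yt yr] : [/\ c < y, y <= t & y <= c + r / 2].
  by rewrite /y; split; rewrite ?lt_min ?ge_min ?lexx ?orbT// ct' ltrDl divr_gt0.
have h1 : `|h y - h c| <= e.
  apply: hr; first by apply/andP; split; lra.
  by rewrite ltr_norml; apply/andP; split; lra.
have := gtc _ cy yt.
by have := ler_normD (h c) (h y - h c); rewrite addrC subrK; lra.
Qed.

Section BumpSequence.
Variables (R : realType) (p : R).
Hypothesis p1 : 1 < p.
Variables (H : set (R -> R)) (C delta : R).
Hypothesis H_var : forall h, H h -> var_le p h C.
Hypothesis H_van : forall h, H h -> vanishing_var p h.
Hypothesis H_bump : forall (T : seq R) (eps : R), 0 < eps -> exists h,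
  [/\ H h, exists2 t : R, 0 <= t <= 1 & delta <= `|h t| &
      forall x : R, x \in T -> 0 <= x <= 1 -> `|h x| <= eps].
Variable eps : nat -> R.
Hypothesis eps_gt0 : forall k, 0 < eps k.
Hypothesis eps_delta : forall k, eps k < delta / 2.

(* eta and eta' are the scales before and after stage k. The factor eta^-1 + k
   accounts for the at most eta^-1 nonoverlapping intervals of length >= eta and
   for the k earlier bumps. *)
Definition bump_stage (k : nat) (eta eta' tau : R) (h : R -> R) (J : R * R) :=
  [/\ H h, 0 <= tau, tau < delta / 2 & tau * (eta^-1 + k%:R) * 2 <= eps k] /\
  [/\ 0 < eta', eta' <= eta & fine_var_le p h eta' (eps k)] /\
  [/\ 0 <= J.1, J.1 <= J.2, J.2 <= 1 & len J < eta] /\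
  [/\ delta <= `|h J.2|, `|h J.1| <= delta / 2 &
    forall y, J.1 <= y -> y <= J.2 -> delta / 2 <= `|h y|] /\
  (forall y, 0 <= y <= 1 -> exists c, [/\ 0 <= c, c <= y, y - c < eta & `|h c| <= tau]).

(** Almost disjointness is measured with the earlier tolerance, which is fixed before the later
    function is known; smallness at the earlier endpoints uses the new one. *)
Definition bump_compatible (hl : R -> R) (taul : R) (Jl : R * R) (h : R -> R) (tau : R) :=
  [/\ `|h Jl.1| <= tau, `|h Jl.2| <= tau &
    forall y, 0 <= y <= 1 -> (`|hl y| <= taul) || (`|h y| <= taul)].

(** A gliding hump along the ultrafilter: each requirement on the next function holds on a set of
    [V], and a stage imposes finitely many of them. *)
Lemma bump_sequence : exists (h : nat -> R -> R) (J : nat -> R * R)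
    (eta tau : nat -> R),
  (forall k, 0 < eta k /\ bump_stage k (eta k) (eta k.+1) (tau k) (h k) (J k)) /\
  forall l k, (l < k)%N -> bump_compatible (h l) (tau l) (J l) (h k) (tau k).
Proof.
have [V [VU VH0 Vnull]] := bump_ultrafilter H_bump.
have VP : ProperFilter V by exact: ultra_proper.
have VH : V H by apply: filterS VH0 => h [].
pose X : Type := ((R -> R) * (R * R) * R * R)%type.
pose hh (x : X) := x.1.1.1; pose JJ (x : X) := x.1.1.2.
pose ee (x : X) := x.1.2; pose tt (x : X) := x.2.
(* The scale 2 before the first stage exceeds every length in [0, 1]. *)
pose eta_of (s : seq X) : R := last 2 (map ee s).
(* The first clause is what makes later choices possible: almost every candidate is still almost
   disjoint from [x]. *)
pose good (x : X) := [/\ V [set g | forall y : R, 0 <= y <= 1 ->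
   `|hh x y| <= tt x \/ `|g y| <= tt x], 0 < ee x, 0 <= (JJ x).1 <= 1 & 0 <= (JJ x).2 <= 1].
pose x0 : X := (fun=> 0, (0, 0), 0, 0).
pose Inv (s : seq X) := forall i, (i < size s)%N -> good (nth x0 s i).
pose P (s : seq X) (x : X) :=
  [/\ 0 < eta_of s, bump_stage (size s) (eta_of s) (ee x) (tt x) (hh x) (JJ x) &
   forall i, (i < size s)%N ->
     let z := nth x0 s i in bump_compatible (hh z) (tt z) (JJ z) (hh x) (tt x)].
have [] := @history_choice X Inv P.
- by [].
- move=> s Is.
  have eta0 : 0 < eta_of s.
    case: (lastP s) Is => [|r x] Ir; first by rewrite /eta_of /=; lra.
    rewrite /eta_of map_rcons last_rcons; have := Ir (size r).
    by rewrite size_rcons nth_rcons ltnn eqxx ltnSn => /(_ isT)[].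
  set eta := eta_of s in eta0 *; set k := size s.
  have ei0 : 0 < eta^-1 by rewrite invr_gt0.
  have k0 : 0 <= k%:R :> R by [].
  (* The denominator is the factor required by [bump_stage], increased so that also
     [tau <= eps k < delta / 2]. *)
  pose tau := eps k / (2 * (eta^-1 + k%:R + 1)).
  have d0 : 0 < 2 * (eta^-1 + k%:R + 1) by lra.
  have tau0 : 0 < tau by rewrite divr_gt0.
  have tauE : tau * (eta^-1 + k%:R) * 2 <= eps k.
    have : tau * (2 * (eta^-1 + k%:R + 1)) = eps k by rewrite /tau divfK// gt_eqF.
    by lra.
  (* A grid of step eta / 2, to find a point of smallness within [eta] to the left of any point, and
     the ends of all earlier bump intervals. *)
  pose T := [seq j%:R * (eta / 2) | j <- iota 0 (Num.truncn (2 / eta)).+1] ++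
    map (fun z : X => (JJ z).1) s ++ map (fun z : X => (JJ z).2) s.
  have VT : V [set h | forall y, y \in T -> 0 <= y <= 1 -> `|h y| <= tau].
    have : forall y : R, y \in T -> V [set h | 0 <= y <= 1 -> `|h y| <= tau].
      move=> y _; have [y01|ny] := boolP (0 <= y <= 1)%R.
        by apply: filterS (Vnull _ _ y01 tau0) => h hy _; exact: hy.
      by apply: filterS (@filterT _ V _).
    by move=> /(filter_forall_seq _).
  have Vs : V [set h | forall i, i \in iota 0 k -> let z := nth x0 s i in
      forall y : R, 0 <= y <= 1 -> `|hh z y| <= tt z \/ `|h y| <= tt z].
    apply: (filter_forall_seq (A := fun i => [set h | let z := nth x0 s i in
      forall y : R, 0 <= y <= 1 -> `|hh z y| <= tt z \/ `|h y| <= tt z])) => i.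
    by rewrite mem_iota => /Is[].
  have Vd := mostly_disjoint p1 H_var H_van VU VH Vnull tau0.
  have [h [[[Hh [t t01 ht]] hT] [hs hd]]] :=
    filter_ex (filterI (filterI VH0 VT) (filterI Vs Vd)).
  have grid y : 0 <= y <= 1 -> exists c, [/\ 0 <= c, c <= y, y - c < eta & `|h c| <= tau].
    move=> /andP[y0 y1]; pose j := Num.truncn (y / (eta / 2)).
    have e20 : 0 < eta / 2 by lra.
    have /andP[j1 j2] : j%:R <= y / (eta / 2) < j.+1%:R.
      by apply: truncn_itv; rewrite divr_ge0// ltW.
    rewrite ler_pdivlMr// in j1; rewrite ltr_pdivrMr// -natr1 mulrDl mul1r in j2.
    have c0 : 0 <= j%:R * (eta / 2) by rewrite mulr_ge0// ltW.
    exists (j%:R * (eta / 2)); split => //; first by lra.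
    apply: hT; last by apply/andP; split => //; lra.
    rewrite mem_cat; apply/orP; left; apply/mapP; exists j => //.
    rewrite mem_iota add0n /= ltnS; apply: le_truncn.
    by rewrite ler_pdivrMr// mulrA divfK ?gt_eqF//; lra.
  have ted : tau < delta / 2.
    apply: le_lt_trans (eps_delta k); rewrite /tau ler_pdivrMr//.
    by rewrite ler_peMr ?(ltW (eps_gt0 k))//; lra.
  move: (t01) => /andP[t0 t1].
  (* Starting from the grid point just before the bump makes the interval shorter than [eta]. *)
  have [c0 [c00 c0t tc0 hc0]] := grid _ t01.
  have hc2 : `|h c0| <= delta / 2 by lra.
  have ht2 : delta / 2 < `|h t| by lra.
  have [c [cc ct hc1 hc2']] := last_level p1 (H_van Hh) c00 c0t t1 hc2 ht2.
  have j0 : 0 <= c by exact: le_trans cc.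
  have lJ : t - c < eta by apply: le_lt_trans tc0; rewrite lerD2l lerN2.
  have [eta' eta'0 heta'] := H_van Hh (eps_gt0 k).
  exists (h, (c, t), Num.min eta eta', tau); split; last first.
    move=> i; rewrite size_rcons ltnS leq_eqVlt => /orP[/eqP ->|ik].
      rewrite nth_rcons ltnn eqxx; split => //=; first by rewrite lt_min eta0.
      by rewrite j0 (le_trans ct).
    by rewrite nth_rcons ik; exact: Is.
  split => //.
    split; first by split => //; exact: ltW.
    split.
      split; rewrite ?lt_min ?eta0 ?ge_min ?lexx//.
      move=> r cr hr; apply: heta' => // I /hr; rewrite lt_min => /andP[]//.
    split; first by split.
    by split.
  move=> i ik z; split.
  - have [_ _ z1 _] := Is i ik; apply: hT => //; rewrite !mem_cat.
    by apply/orP; right; apply/orP; left; apply/(nthP 0); exists i;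
      rewrite ?size_map// (nth_map x0).
  - have [_ _ _ z2] := Is i ik; apply: hT => //; rewrite !mem_cat.
    by apply/orP; right; apply/orP; right; apply/(nthP 0); exists i;
      rewrite ?size_map// (nth_map x0).
  - move=> y y01; have /= := hs i; rewrite mem_iota => /(_ ik y y01).
    by case=> ->; rewrite ?orbT.
move=> u uP.
exists (hh \o u), (JJ \o u), (fun k => if k is k'.+1 then ee (u k') else 2), (tt \o u).
have eta_ofE k : eta_of (mkseq u k) = if k is k'.+1 then ee (u k') else 2.
  by case: k => // k; rewrite /eta_of mkseqS map_rcons last_rcons.
split.
  by move=> k; have [h1 h2 _] := uP k; rewrite -eta_ofE; move: h2; rewrite size_mkseq.
move=> l k lk; have [_ _] := uP k; rewrite size_mkseq => /(_ _ lk).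
by rewrite nth_mkseq.
Qed.

End BumpSequence.

Lemma geometric_sum_le (R : realType) (a : R) m : 0 <= a ->
  \sum_(i <- iota 0 m) a / 2 ^+ i.+1 <= a.
Proof.
move=> a0; rewrite -[iota 0 m](_ : index_iota 0 m = _); last by rewrite /index_iota subn0.
have -> : \sum_(0 <= i < m) a / 2 ^+ i.+1 = a - a / 2 ^+ m.
  elim: m => [|m ih]; first by rewrite big_geq// expr0 divr1 subrr.
  rewrite big_nat_recr//= ih exprS; field.
  by rewrite expf_neq0.
by rewrite gerBl divr_ge0// exprn_ge0.
Qed.

Lemma chain_subseq (R : realType) (s r : seq (R * R)) :
  subseq s r -> chain r -> chain s.
Proof.
move=> sr /andP[r1 r2]; apply/andP; split; last exact: subseq_pairwise sr r2.
by apply/allP => I /(mem_subseq sr); exact: (allP r1).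
Qed.

Lemma quarter_bound (R : realType) (d x a b c : R) : 0 <= d -> 0 <= x ->
  d / 2 * x <= a -> a <= b + c -> c <= d / 8 * x -> d / 4 * x <= b.
Proof.
move=> d0 x0; have := mulr_ge0 d0 x0 => dx h1 h2 h3.
have e1 : d / 2 * x = d * x / 2 by ring.
have e2 : d / 8 * x = d * x / 8 by ring.
have -> : d / 4 * x = d * x / 4 by ring.
lra.
Qed.

Section LpSequence.
Variables (R : realType) (p : R).
Hypothesis p1 : 1 < p.
Variables (H : set (R -> R)) (C delta : R).
Hypothesis H_var : forall h, H h -> var_le p h C.
Hypothesis H_van : forall h, H h -> vanishing_var p h.
Hypothesis delta_gt0 : 0 < delta.
Hypothesis H_bump : forall (T : seq R) (eps : R), 0 < eps -> exists h,
  [/\ H h, exists2 t : R, 0 <= t <= 1 & delta <= `|h t| &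
      forall x : R, x \in T -> 0 <= x <= 1 -> `|h x| <= eps].

(** The lower estimate tests the sum on the bump intervals. The matrix of increments has a diagonal
    of size at least delta / 2, and its off-diagonal part costs at most delta / 8 times the l_p norm
    of [beta]. *)
Lemma lp_sequence : exists (h : nat -> R -> R) (K : R),
  [/\ forall k, H (h k),
    forall beta m s, chain s ->
      lpsum p s (fun I => \sum_(i <- iota 0 m) beta i * incr (h i) I) <=
      K * lpsum p (iota 0 m) beta &
    forall beta m, exists2 s, chain s &
      delta / 4 * lpsum p (iota 0 m) beta <=
      lpsum p s (fun I => \sum_(i <- iota 0 m) beta i * incr (h i) I)].
Proof.
have d16 : delta / 16 < delta / 2 by have := delta_gt0; lra.
(* The sum of the [eps k] is at most delta / 16, and the off-diagonal part costs twice that. *)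
pose eps k : R := delta / 16 / 2 ^+ k.+1.
have p2 k : 0 < (2 : R) ^+ k by rewrite exprn_gt0.
have eps0 k : 0 < eps k by rewrite !divr_gt0.
have epsd k : eps k < delta / 2.
  apply: le_lt_trans d16; rewrite ler_pdivrMr// ler_peMr ?divr_ge0 ?(ltW delta_gt0)//.
  by rewrite exprn_ege1// ler1n.
have epsE m : \sum_(i <- iota 0 m) eps i <= delta / 16.
  by apply: geometric_sum_le; rewrite divr_ge0 ?ltW.
have [h [J [eta [tau [h1 h2]]]]] := bump_sequence p1 H_var H_van H_bump eps0 epsd.
have Hh k : H (h k) by have [_ [[]]] := h1 k.
have hvar k : var_le p (h k) C by exact: H_var.
have hfine k : fine_var_le p (h k) (eta k.+1) (eps k) by have [_ [_ [[]]]] := h1 k.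
have eta0 k : 0 < eta k by have [] := h1 k.
have eta_le k : eta k.+1 <= eta k by have [_ [_ [[]]]] := h1 k.
have tau0 k : 0 <= tau k by have [_ [[]]] := h1 k.
have tau_le k : tau k * ((eta k)^-1 + k%:R) * 2 <= eps k by have [_ [[]]] := h1 k.
have tau_eta k : tau k / eta k <= eps k.
  apply: le_trans (tau_le k); rewrite -mulrA ler_wpM2l//.
  have : 0 < (eta k)^-1 by rewrite invr_gt0.
  have : 0 <= k%:R :> R by []. lra.
have tau_k k : k%:R * (2 * tau k) <= eps k.
  apply: le_trans (tau_le k); rewrite mulrCA mulrC ler_wpM2r// mulrC ler_wpM2l//.
  by rewrite lerDr invr_ge0 ltW.
have disj l k y : (l < k)%N -> 0 <= y <= 1 -> (`|h l y| <= tau l) || (`|h k y| <= tau l).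
  by move=> /h2[_ _]; apply.
have /choice[c0 c0P] : forall ky : nat * R, exists c, 0 <= ky.2 <= 1 ->
    [/\ 0 <= c, c <= ky.2, ky.2 - c < eta ky.1 & `|h ky.1 c| <= tau ky.1].
  move=> [k y] /=; have [_ [_ [_ [_ [_ hg]]]]] := h1 k.
  have [/hg[c cP]|] := boolP (0 <= y <= 1)%R; last by exists 0.
  by exists c.
pose c k y := c0 (k, y).
have c_grid k y : 0 <= y <= 1 ->
    [/\ 0 <= c k y, c k y <= y, y - c k y < eta k & `|h k (c k y)| <= tau k].
  exact: (c0P (k, y)).
exists h, (delta / 16 + C + (C + delta / 16 + delta / 16) + (C + delta / 16 + delta / 16)).
split => // [beta m s cs|beta m].
  by rewrite mulrC; exact: (rapid_lp_upper p1 hvar hfine eta0 eta_le epsE tau0 tau_eta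
    disj c_grid).
have JP k : [/\ 0 <= (J k).1, (J k).1 <= (J k).2, (J k).2 <= 1 & len (J k) < eta k].
  by have [_ [_ [_ [? _]]]] := h1 k.
have Jd k : [/\ delta <= `|h k (J k).2|, `|h k (J k).1| <= delta / 2 &
    forall y, (J k).1 <= y -> y <= (J k).2 -> delta / 2 <= `|h k y|].
  by have [_ [_ [_ [_ [? _]]]]] := h1 k.
have taud k : tau k < delta / 2 by have [_ [[]]] := h1 k.
(* At a common point both functions would have size at least delta / 2 > tau i, against almost
   disjointness. *)
have Jlt i j : (i < j)%N -> (J i).2 < (J j).1 \/ (J j).2 < (J i).1.
  move=> ij; have [//|a] := ltP (J i).2 (J j).1; [by left|right].
  have [//|b] := ltP (J j).2 (J i).1; exfalso.
  have [i0 i12 i1 _] := JP i; have [j0 j12 j1 _] := JP j.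
  pose y := Num.max (J i).1 (J j).1.
  have [y1 y2 y3 y4] : [/\ (J i).1 <= y, (J j).1 <= y, y <= (J i).2 & y <= (J j).2].
    by rewrite /y; split; rewrite ?ge_max ?le_max ?lexx ?orbT// ?i12 ?j12 ?a ?b.
  have y01 : 0 <= y <= 1 by rewrite (le_trans i0 y1) (le_trans y3 i1).
  have [_ _ /(_ y y1 y3) yi] := Jd i; have [_ _ /(_ y y2 y4) yj] := Jd j.
  by have := taud i; case/orP: (disj _ _ _ ij y01); lra.
have [r rm cr] : exists2 r, perm_eq r (iota 0 m) & chain (map J r).
  apply: chain_sort => [i _|i j _ _]; first by have [] := JP i.
  by rewrite neq_ltn => /orP[/Jlt //|/Jlt[]]; [right|left].
exists (map J r) => //.
pose M j i := incr (h j) (J i).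
pose S I := \sum_(i <- iota 0 m) beta i * incr (h i) I.
set L := lpsum p (iota 0 m).
have rL phi : lpsum p r phi = L phi by exact: lpsum_perm.
(* For i > j the interval [J i] is below the fine scale of [h j]. For i < j, [h j] is at most
   [tau j] at both ends of [J i], and there are at most j such intervals. Each case costs
   [eps j]. *)
have hM j : L (fun i => if j == i then 0 else M j i) <= 2 * eps j.
  apply: (@le_trans _ _ (L (fun i => (if (j < i)%N then M j i else 0) +
      (if (i < j)%N then M j i else 0)))).
    by apply: lpsum_le => // i; case: ltngtP; rewrite ?addr0 ?add0r// normr0.
  apply: le_trans (lpsumD p1 _ _ _) _.
  have -> : 2 * eps j = eps j + eps j by ring.
  apply: lerD.
    rewrite -/L -rL -lpsum_filter//.
    rewrite -[X in lpsum _ _ X]/(incr (h j) \o J) -lpsum_map.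
    apply: hfine; first by apply: chain_subseq cr; apply/map_subseq/filter_subseq.
    move=> I /mapP[i]; rewrite mem_filter => /andP[ji _] ->.
    have [_ _ _ h3] := JP i; apply: lt_le_trans h3 _.
    exact: (rapid_eta_homo eta_le).
  rewrite -lpsum_filter//; apply: le_trans (tau_k j).
  apply: (@le_trans _ _ (lpsum p [seq i <- iota 0 m | (i < j)%N] (fun=> 2 * tau j))).
    apply: lpsum_le_in => // i; rewrite mem_filter => /andP[ij _].
    have [h3 h4 _] := h2 _ _ ij.
    rewrite [leRHS]ger0_norm ?mulr_ge0// /M /incr.
    by apply: le_trans (ler_normB _ _) _; lra.
  apply: le_trans (lpsum_le_size p1 _ (c := 2 * tau j) _) _.
    by move=> i; rewrite ger0_norm ?mulr_ge0.
  rewrite ler_wpM2r ?mulr_ge0// ler_nat -[leqRHS](size_iota 0).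
  apply: uniq_leq_size; first by rewrite filter_uniq ?iota_uniq.
  by move=> i; rewrite mem_filter [in X in _ -> X]mem_iota add0n => /andP[->].
have hdiag : delta / 2 * L beta <= L (fun i => beta i * M i i).
  have d20 : 0 < delta / 2 by rewrite divr_gt0.
  rewrite -(gtr0_norm d20) -(lpsumZ p1); apply: lpsum_le => // i.
  rewrite mulrC normrM [leRHS]normrM ler_wpM2l// (gtr0_norm d20).
  by have [h3 h4 _] := Jd i; apply: le_trans (lerB_dist _ _); lra.
have hsplit : L (fun i => beta i * M i i) <= lpsum p (map J r) S +
    L (fun i => \sum_(j <- iota 0 m) beta j * (if j == i then 0 else M j i)).
  rewrite lpsum_map rL; apply: le_trans (lpsumB p1 _ _ _).
  apply: lpsum_le_in => // i im; rewrite /S /= -sumrB.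
  rewrite (bigD1_seq i) ?iota_uniq//= eqxx mulr0 subr0 big1 ?addr0//.
  by move=> j /negPf ->; rewrite subrr.
have hoff : L (fun i => \sum_(j <- iota 0 m) beta j * (if j == i then 0 else M j i)) <=
    delta / 8 * L beta.
  apply: le_trans (lpsum_sum p1 _ _ _) _.
  apply: (@le_trans _ _ (\sum_(j <- iota 0 m) (L beta * (2 * eps j)))).
    rewrite big_seq [leRHS]big_seq; apply: ler_sum => j jm.
    rewrite (lpsumZ p1).
    exact: ler_pM (normr_ge0 _) (lpsum_ge0 _ _ _) (lpsum_mem p1 beta jm) (hM j).
  rewrite -mulr_sumr -mulr_sumr mulrC ler_wpM2r ?lpsum_ge0//.
  have -> : delta / 8 = 2 * (delta / 16) by field.
  by rewrite ler_pM2l.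
have d0 : 0 <= delta by exact: ltW.
exact: quarter_bound d0 (lpsum_ge0 _ _ _) hdiag hsplit hoff.
Qed.

End LpSequence.

(** * Uniform limits: sequences equivalent to the basis of c_0 *)

Section RapidUniform.
Variables (R : realType) (p : R).
Hypothesis p1 : 1 < p.
Variables (f : nat -> R -> R) (F : R -> R) (eta eps : nat -> R) (C CF E : R).
Hypothesis f_var : forall k, var_le p (f k) C.
Hypothesis F_var : var_le p F CF.
Hypothesis f_fine : forall k, fine_var_le p (f k) (eta k.+1) (eps k).
Hypothesis f_long : forall k s, chain s -> (forall I, I \in s -> eta k <= len I) ->
  lpsum p s (fun I => incr (f k) I - incr F I) <= eps k.
Hypothesis eta_le : forall k, eta k.+1 <= eta k.
Hypothesis epsE : forall m, \sum_(i <- iota 0 m) eps i <= E.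

(** Abel summation in disguise: as [eta] decreases, the indices for which an interval is long form a
    tail, so the coefficient in front of [F] is a tail sum. *)
Lemma sum_upward_closed (P : nat -> bool) (beta : nat -> R) m :
  (forall i j, (i <= j)%N -> P i -> P j) -> exists2 n, (n <= m)%N &
  \sum_(i <- iota 0 m) beta i * (if P i then 1 else 0) = \sum_(n <= i < m) beta i.
Proof.
move=> hP; have -> : iota 0 m = index_iota 0 m by rewrite /index_iota subn0.
elim: m => [|m [n nm ih]]; first by exists 0%N; rewrite ?big_geq.
have [Pm|Pm] := boolP (P m).
  exists n; first exact: leqW.
  by rewrite big_nat_recr//= ih Pm mulr1 big_nat_recr.
exists m.+1 => //; rewrite [RHS]big_geq// big_nat big1// => i /andP[_ im].
case: ifP => [Pi|_]; last by rewrite mulr0.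
by have := hP i m; rewrite -ltnS im Pi (negPf Pm) => /(_ isT isT).
Qed.

(** On long intervals each [f i] is replaced by [F], at a total cost of the second [E]; the first
    [E] and [C] come from short and medium intervals, and [B * CF] from the tail sums multiplying
    [F]. *)
Lemma rapid_uniform_upper (beta : nat -> R) m s B : chain s -> 0 <= B ->
  (forall n, (n <= m)%N -> `|\sum_(n <= i < m) beta i| <= B) ->
  lpsum p s (fun I => \sum_(i <- iota 0 m) beta i * incr (f i) I) <=
  lpsum p (iota 0 m) beta * (E + C + E) + B * CF.
Proof.
move=> cs B0 hB; rewrite (lpsum_eq _ _ (rapid_split f eta_le beta m)).
apply: le_trans (lpsumD p1 _ _ _) _; rewrite mulrDr -[leRHS]addrA; apply: lerD.
  apply: le_trans (lpsumD p1 _ _ _) _; rewrite mulrDr; apply: lerD.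
    apply: le_trans (rapid_short p1 f_fine beta m cs) _.
    exact: (rapid_beta_eps p1 f_fine epsE).
  exact: (rapid_medium p1 f_var eta_le).
pose G I := \sum_(i <- iota 0 m) beta i *
  (if eta i <= len I then incr (f i) I - incr F I else 0).
pose T I := \sum_(i <- iota 0 m) beta i * (if eta i <= len I then 1 else 0).
rewrite (lpsum_eq _ _ (psi := fun I => G I + T I * incr F I)); last first.
  move=> I; rewrite /G /T mulr_suml -big_split/=; apply: eq_bigr => i _.
  by case: ifP; rewrite ?mulr0 ?mul0r ?addr0// mulr1 -mulrDr subrK.
apply: le_trans (lpsumD p1 _ _ _) _; apply: lerD.
  apply: le_trans (lpsum_sum p1 _ _ _) _.
  apply: le_trans (rapid_beta_eps p1 f_fine epsE beta m).
  apply: ler_sum => i _; rewrite (lpsumZ p1) ler_wpM2l// -lpsum_filter//.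
  by apply: f_long; [exact: chain_filter|move=> I; rewrite mem_filter => /andP[]].
apply: (@le_trans _ _ (lpsum p s (fun I => B * incr F I))).
  apply: lpsum_le => // I; rewrite !normrM ler_wpM2r// (ger0_norm B0) /T.
  have [|n nm ->] := @sum_upward_closed (fun i => eta i <= len I) beta m.
    by move=> i j ij; apply: le_trans; exact: (rapid_eta_homo eta_le).
  exact: hB.
rewrite (lpsumZ p1) (ger0_norm B0) ler_wpM2l//; exact: F_var.
Qed.

(** The intervals of [s] are thought of as lying between two successive scales: earlier functions
    are negligible on them and later ones look like [F], so only one tail sum is seen. *)
Lemma rapid_uniform_lower (beta : nat -> R) m n s : (n <= m)%N ->
  (forall j, (j < n)%N -> lpsum p s (incr (f j)) <= eps j) ->
  (forall j, (n <= j)%N -> lpsum p s (fun I => incr (f j) I - incr F I) <= eps j) ->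
  `|\sum_(n <= i < m) beta i| * lpsum p s (incr F) <=
  lpsum p s (fun I => \sum_(i <- iota 0 m) beta i * incr (f i) I) +
  lpsum p (iota 0 m) beta * E.
Proof.
move=> nm h1 h2.
pose G i I := if (i < n)%N then incr (f i) I else incr (f i) I - incr F I.
pose S I := \sum_(i <- iota 0 m) beta i * incr (f i) I.
pose D I := \sum_(i <- iota 0 m) beta i * G i I.
have hS I : S I - D I = (\sum_(n <= i < m) beta i) * incr F I.
  have e1 : iota 0 m = iota 0 n ++ iota n (m - n) by rewrite -iotaD subnKC.
  rewrite -sumrB e1 big_cat/= big_seq big1 ?add0r.
    rewrite mulr_suml big_seq [RHS]big_seq; apply: eq_bigr => i.
    rewrite mem_iota => /andP[ni _].
    by rewrite /G ltnNge ni /= -mulrBr opprB addrC subrK.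
  by move=> i; rewrite mem_iota add0n => /andP[_ ni]; rewrite /G ni subrr.
rewrite -(lpsumZ p1) -(lpsum_eq _ _ hS); apply: le_trans (lpsumB p1 _ _ _) _.
rewrite lerD2l; apply: le_trans (lpsum_sum p1 _ _ _) _.
apply: le_trans (rapid_beta_eps p1 f_fine epsE beta m).
apply: ler_sum => i _; rewrite (lpsumZ p1) ler_wpM2l//.
by rewrite /G; case: ltnP => [/h1|/h2].
Qed.

End RapidUniform.

Lemma powR_inv_small (R : realType) (p e : R) : 1 < p -> 0 < e ->
  exists2 M0, (0 < M0)%N & forall M, (M0 <= M)%N -> M%:R `^ p^-1 / M%:R <= e.
Proof.
move=> p1 e0; have p0 : 0 < p := lt_trans ltr01 p1.
pose q := 1 - p^-1.
have q0 : 0 < q by rewrite subr_gt0 invf_lt1.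
pose M0 := (Num.truncn ((e^-1) `^ q^-1)).+1.
exists M0 => // M M0M; have M1 : 0 < M%:R :> R by rewrite ltr0n (leq_trans _ M0M).
have h : e^-1 <= M%:R `^ q.
  rewrite -[e^-1](_ : ((e^-1) `^ q^-1) `^ q = _); last first.
    by rewrite -powRrM mulVf ?gt_eqF// powRr1// invr_ge0 ltW.
  apply: le_powR; [exact: ltW|exact: powR_ge0|].
  by apply/ltW/(lt_le_trans (truncnS_gt _)); rewrite ler_nat.
have e1 : M%:R = M%:R `^ p^-1 * M%:R `^ q :> R.
  rewrite -powRD; last by rewrite (gt_eqF M1) implybT.
  by rewrite /q addrC subrK powRr1// ltW.
have Mp : 0 < M%:R `^ p^-1 :> R by rewrite powR_gt0.
rewrite {2}e1 invfM mulrA mulfV ?gt_eqF// mul1r.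
by rewrite -[leRHS]invrK lef_pV2// posrE ?invr_gt0// powR_gt0.
Qed.

Section RapidSelection.
Variables (R : realType) (p : R).
Hypothesis p1 : 1 < p.
Variables (f : nat -> R -> R) (F : R -> R) (eps : nat -> R).
Variable Q : seq (R * R) -> Prop.
Hypothesis f_van : forall n, vanishing_var p (f n).
Hypothesis f_cvg : forall e : R, 0 < e ->
  exists n, forall x : R, 0 <= x <= 1 -> `|f n x - F x| <= e.
Hypothesis eps_gt0 : forall k, 0 < eps k.
Hypothesis fineQ : forall e : R, 0 < e -> exists s,
  [/\ chain s, forall I, I \in s -> 0 < len I < e & Q s].

(** A stage chooses a function close to [F] relative to the current scale, then a scale below which
    its variation is small, then a chain with [Q] below that scale, and finally a next scale below
    all lengths of the chain. So [sigma k] is short for the functions up to [k] and long for the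
    later ones. *)
Lemma rapid_selection : exists (nu : nat -> nat) (eta : nat -> R)
    (sigma : nat -> seq (R * R)),
  [/\ forall k, eta k.+1 <= eta k,
    forall k, fine_var_le p (f (nu k)) (eta k.+1) (eps k),
    forall k s, chain s -> (forall I, I \in s -> eta k <= len I) ->
      lpsum p s (fun I => incr (f (nu k)) I - incr F I) <= eps k &
    forall k, [/\ chain (sigma k), Q (sigma k),
      forall j, (j < k.+1)%N -> lpsum p (sigma k) (incr (f (nu j))) <= eps j &
      forall j, (k.+1 <= j)%N ->
        lpsum p (sigma k) (fun I => incr (f (nu j)) I - incr F I) <= eps j]].
Proof.
pose X : Type := (nat * R * R * seq (R * R))%type.
pose nn (x : X) := x.1.1.1; pose ee (x : X) := x.1.1.2.
pose ee' (x : X) := x.1.2; pose ss (x : X) := x.2.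
pose eta_of (s : seq X) : R := last 2 (map ee' s).
pose Inv (s : seq X) := 0 < eta_of s.
pose P (s : seq X) (x : X) :=
  [/\ 0 < eta_of s, ee x <= eta_of s, fine_var_le p (f (nn x)) (ee x) (eps (size s)) &
    forall y : R, 0 <= y <= 1 -> `|f (nn x) y - F y| <= eps (size s) * eta_of s / 2] /\
  [/\ ee' x <= ee x, chain (ss x), Q (ss x) &
    forall I, I \in ss x -> ee' x <= len I < ee x].
have [||u uP] := @history_choice X Inv P.
- by rewrite /Inv /eta_of /=.
(* An increment has two endpoints and at most eta^-1 intervals are long, so this accuracy gives
   [eps] in variation. *)
- move=> s Is; have d0 : 0 < eps (size s) * eta_of s / 2 by rewrite divr_gt0 ?mulr_gt0.
  have [n hn] := f_cvg d0; have [eta0 eta00 heta0] := f_van n (eps_gt0 (size s)).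
  pose eta := Num.min eta0 (eta_of s).
  have eta0' : 0 < eta by rewrite lt_min eta00.
  have [r [cr hr Qr]] := fineQ eta0'.
  (* [fineQ] provides positive lengths, so a positive scale below all of them exists. *)
  have [l l0 hl] := pos_lower_bound (map (@len R) r).
  exists (n, eta, Num.min l eta, r); split.
    have e1 : eta <= eta_of s by rewrite ge_min lexx orbT.
    have e2 : Num.min l eta <= eta by rewrite ge_min lexx orbT.
    split; split => //.
      by move=> t ct ht; apply: heta0 => // I /ht; rewrite lt_min => /andP[].
    move=> I rI; have /andP[I0 I1] := hr I rI.
    by rewrite I1 andbT /ee' /= ge_min hl// map_f.
  by rewrite /Inv /eta_of map_rcons last_rcons /ee' /= lt_min l0.
pose eta k : R := if k is k'.+1 then ee' (u k') else 2.
have eta_ofE k : eta_of (mkseq u k) = eta k.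
  by case: k => // k; rewrite /eta_of mkseqS map_rcons last_rcons.
have {}uP k : [/\ 0 < eta k, ee (u k) <= eta k, fine_var_le p (f (nn (u k))) (ee (u k)) (eps k) &
    forall y : R, 0 <= y <= 1 -> `|f (nn (u k)) y - F y| <= eps k * eta k / 2] /\
  [/\ eta k.+1 <= ee (u k), chain (ss (u k)), Q (ss (u k)) &
    forall I, I \in ss (u k) -> eta k.+1 <= len I < ee (u k)].
  by have := uP k; rewrite /P size_mkseq eta_ofE.
have eta_le k : eta k.+1 <= eta k.
  by have [[_ h1 _ _] [h2 _ _ _]] := uP k; exact: le_trans h1.
have long k s : chain s -> (forall I, I \in s -> eta k <= len I) ->
    lpsum p s (fun I => incr (f (nn (u k))) I - incr F I) <= eps k.
  move=> cs hs; have [[e0 _ _ h] _] := uP k.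
  apply: (@le_trans _ _ (lpsum p s (fun I => if eta k <= len I then
      incr (f (nn (u k))) I - incr F I else 0))).
    by apply: lpsum_le_in => // I /hs ->.
  rewrite -[leRHS](mulfK (lt0r_neq0 e0)); apply: lpsum_long => //.
    by rewrite mulr_ge0 ?ltW.
  move=> I /(chain_mem cs)[I0 I12 I1] _.
  have h1 := h _ (itv01_left I0 I12 I1); have h2 := h _ (itv01_right I0 I12 I1).
  have -> : incr (f (nn (u k))) I - incr F I =
    (f (nn (u k)) I.2 - F I.2) - (f (nn (u k)) I.1 - F I.1) by rewrite /incr; ring.
  apply: le_trans (ler_normB _ _) _; lra.
exists (nn \o u), eta, (ss \o u); split => //.
  move=> k s cs hs; have [[_ _ h _] [h' _ _ _]] := uP k.
  by apply: h => // I /hs h2; exact: lt_le_trans h'.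
move=> k; have [_ [h1 h2 h3 h4]] := uP k; split => // j jk.
  have [[_ _ h _] _] := uP j; apply: h => // I /h4 /andP[_ h5].
  apply: lt_le_trans h5 _; move: jk; rewrite ltnS leq_eqVlt => /orP[/eqP -> //|jk].
  have [[_ h6 _ _] _] := uP k; apply: le_trans h6 _.
  have [_ [h7 _ _ _]] := uP j; apply: le_trans h7.
  exact: (rapid_eta_homo eta_le).
apply: long => // I /h4 /andP[h5 _]; apply: le_trans h5.
exact: (rapid_eta_homo eta_le).
Qed.

End RapidSelection.

Section UniformLimit.
Variables (R : realType) (p : R).
Hypothesis p1 : 1 < p.
Variables (f : nat -> R -> R) (F : R -> R) (C CF : R).
Hypothesis f_var : forall n, var_le p (f n) C.
Hypothesis f_van : forall n, vanishing_var p (f n).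
Hypothesis F_var : var_le p F CF.
Hypothesis f_cvg : forall e : R, 0 < e ->
  exists n, forall x : R, 0 <= x <= 1 -> `|f n x - F x| <= e.

Lemma average_cvg (e : R) : vanishing_var p F -> 0 < e ->
  exists (M : nat) (nu : nat -> nat), (0 < M)%N /\ forall s, chain s ->
  lpsum p s (fun I => \sum_(i <- iota 0 M) M%:R^-1 * incr (f (nu i)) I - incr F I) <= e.
Proof.
move=> F_van e0.
pose w n x := f n x - F x.
have incw n I : incr (w n) I = incr (f n) I - incr F I by rewrite /incr /w; ring.
have w_var n : var_le p (w n) (C + CF).
  move=> s cs; rewrite (lpsum_eq _ _ (incw n)); apply: le_trans (lpsumB p1 _ _ _) _.
  by apply: lerD; [exact: f_var|exact: F_var].
have w_van n : vanishing_var p (w n).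
  move=> d d0; have d20 : 0 < d / 2 by rewrite divr_gt0.
  have [r r0 hr] := f_van n d20; have [r' r'0 hr'] := F_van _ d20.
  exists (Num.min r r'); first by rewrite lt_min r0.
  move=> s cs hs; rewrite (lpsum_eq _ _ (incw n)); apply: le_trans (lpsumB p1 _ _ _) _.
  rewrite [leRHS]splitr lerD//; [apply: hr|apply: hr'] => // I /hs;
    by rewrite lt_min => /andP[].
pose eps k : R := 1 / 2 ^+ k.+1.
have eps0 k : 0 < eps k by rewrite divr_gt0// exprn_gt0.
have epsE m : \sum_(i <- iota 0 m) eps i <= 1 by exact: geometric_sum_le.
have w_cvg d : 0 < d -> exists n, forall x : R, 0 <= x <= 1 -> `|w n x - 0| <= d.
  by move=> /f_cvg[n hn]; exists n => x /hn; rewrite subr0.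
(* Only the scales matter here: [Q] is trivial and the chains are empty. The limit of the [w n] is
   0, which removes the tail-sum term. *)
have [nu [eta [_ [h1 h2 h3 _]]]] := @rapid_selection _ _ p1 w (fun=> 0) eps (fun=> True)
  w_van w_cvg eps0 (fun _ _ => ex_intro _ [::] (And3 isT (fun I (H : I \in [::]) =>
    False_ind _ (notF H)) I)).
have zvar : var_le p (fun=> 0 : R) 0.
  move=> s _; rewrite (lpsum_eq _ _ (psi := fun=> 0)) ?lpsum0//.
  by move=> I; rewrite /incr subrr.
pose K := 1 + (C + CF) + 1.
have K0 : 0 < K.
  have := le_trans (lpsum_ge0 p [::] _) (w_var 0%N [::] isT).
  rewrite /K; lra.
have [M M0 hM] := powR_inv_small p1 (divr_gt0 e0 K0).
exists M, nu; split => // s cs.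
have M1 : 0 < M%:R :> R by rewrite ltr0n.
have := rapid_uniform_upper p1 (fun k => w_var (nu k)) zvar h2 h3 h1 epsE
  (beta := fun=> M%:R^-1) (m := M) (B := 1) cs ler01.
rewrite mulr0 addr0 (lpsum_const p1) size_iota gtr0_norm ?invr_gt0// => h.
rewrite (lpsum_eq _ _ (psi := fun I => \sum_(i <- iota 0 M) M%:R^-1 * incr (w (nu i)) I)).
  apply: le_trans (h _) _.
    move=> n nM; rewrite sumr_const_nat.
    have -> : M%:R^-1 *+ (M - n) = (M - n)%:R / M%:R :> R by rewrite mulr_natl.
    rewrite ger0_norm ?mulr_ge0 ?invr_ge0//.
    by rewrite ler_pdivrMr// mul1r ler_nat leq_subr.
  by rewrite -ler_pdivlMr//; exact: hM.
move=> I; under [RHS]eq_bigr do rewrite incw mulrBr.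
rewrite sumrB; congr (_ - _); rewrite -mulr_suml big_const_seq count_predT size_iota.
by rewrite iter_addr_0 -[X in X * _]mulr_natr mulVf ?mul1r// lt0r_neq0.
Qed.

End UniformLimit.

(** * Tents on consecutive blocks of indices *)

Section Tent.
Variables (R : realType) (M : nat -> nat).
Hypothesis M_gt0 : forall k, (0 < M k)%N.

(** Left end of block [k], which has 2 M k indices: [M k] to climb to the peak and [M k] to
    descend. *)
Fixpoint tent_pos k : nat :=
  if k is k'.+1 then (tent_pos k' + (M k' + M k'))%N else 0%N.

(* The c_0-sequence is u k = sum_n (tent k n - tent k n.+1) f n: its tail sums of
   coefficients are tents, bounded by 1 with disjoint supports, whereas the slope
   1 / M k makes the coefficients small in l_p. *)
Definition tent k n : R :=
  Num.max 0 (1 - `|n%:R - (tent_pos k + M k)%:R| / (M k)%:R).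

Lemma tent_pos_homo i j : (i <= j)%N -> (tent_pos i <= tent_pos j)%N.
Proof.
elim: j => [|j ih]; first by rewrite leqn0 => /eqP ->.
rewrite leq_eqVlt => /orP[/eqP -> //|/ih] /leq_trans; apply.
by rewrite /= leq_addr.
Qed.

Let M0 k : 0 < (M k)%:R :> R.
Proof. by rewrite ltr0n. Qed.

Lemma tent_out k n : (n <= tent_pos k)%N || (tent_pos k.+1 <= n)%N -> tent k n = 0.
Proof.
move=> h; apply/max_idPl; rewrite subr_le0 ler_pdivlMr// mul1r.
case/orP: h => h.
  rewrite distrC ger0_norm; last by rewrite subr_ge0 ler_nat (leq_trans h)// leq_addr.
  by rewrite natrD lerBrDr addrC lerD2r ler_nat.
rewrite /= addnA in h.
rewrite ger0_norm; last by rewrite subr_ge0 ler_nat (leq_trans _ h)// leq_addr.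
by rewrite lerBrDr -natrD ler_nat addnC.
Qed.

Lemma tent_ge0 k n : 0 <= tent k n.
Proof. by rewrite le_max lexx. Qed.

Lemma tent_le1 k n : tent k n <= 1.
Proof. by rewrite ge_max ler01 gerBl divr_ge0. Qed.

Lemma tent_peak k : tent k (tent_pos k + M k) = 1.
Proof. by rewrite /tent subrr normr0 mul0r subr0; apply/max_idPr. Qed.

Lemma tent_step k n : `|tent k n - tent k n.+1| <= (M k)%:R^-1.
Proof.
have lip (x y : R) : `|Num.max 0 x - Num.max 0 y| <= `|x - y|.
  case: (leP 0 x) => hx; case: (leP 0 y) => hy //.
  - by rewrite subr0 !ger0_norm//; lra.
  - by rewrite sub0r normrN ger0_norm// distrC ger0_norm; lra.
  - by rewrite subrr normr0.
apply: le_trans (lip _ _) _; rewrite opprD addrACA subrr add0r opprK addrC -mulrBl.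
rewrite normrM (ger0_norm (_ : 0 <= (M k)%:R^-1)) ?invr_ge0//.
rewrite -[leRHS]mul1r ler_wpM2r ?invr_ge0//.
apply: le_trans (ler_dist_dist _ _) _; rewrite -natr1.
set P := (_ + _)%N; have -> : n%:R + 1 - P%:R - (n%:R - P%:R) = 1 :> R by ring.
by rewrite normr1.
Qed.

Lemma sum_tent_le1 n m : \sum_(k <- iota 0 m) tent k n <= 1.
Proof.
have -> : iota 0 m = index_iota 0 m by rewrite /index_iota subn0.
elim: m => [|m ih]; first by rewrite big_geq.
rewrite big_nat_recr//=; have [h|h] := leqP n (tent_pos m).
  by rewrite (tent_out (k := m)) ?h// addr0.
rewrite big_nat big1 ?add0r ?tent_le1// => k /andP[_ km].
by rewrite tent_out//; apply/orP; right; rewrite (leq_trans _ (ltnW h))// tent_pos_homo.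
Qed.

Lemma sum_tent_peak (c : nat -> R) m k : (k < m)%N ->
  \sum_(j <- iota 0 m) c j * tent j (tent_pos k + M k) = c k.
Proof.
move=> km; rewrite (bigD1_seq k) ?iota_uniq ?mem_iota//= tent_peak mulr1 big1 ?addr0//.
move=> j; rewrite neq_ltn => /orP[jk|kj]; rewrite tent_out ?mulr0//.
  by rewrite (leq_trans (tent_pos_homo jk)) ?leq_addr ?orbT.
by rewrite (leq_trans _ (tent_pos_homo kj))//= ?leq_add2l ?leq_addr.
Qed.

End Tent.

Lemma half_bound (R : realType) (e x a b c : R) :
  x * e <= a -> a <= b + c -> c <= x * (e / 2) -> e / 2 * x <= b.
Proof.
have -> : x * (e / 2) = x * e / 2 by ring.
have -> : e / 2 * x = x * e / 2 by ring.
lra.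
Qed.

Section C0Sequence.
Variables (R : realType) (p : R).
Hypothesis p1 : 1 < p.
Variables (H : set (R -> R)) (f : nat -> R -> R) (F : R -> R) (C CF : R).
Hypothesis H0 : H (fun=> 0).
Hypothesis HD : forall (a : R) g h, H g -> H h -> H (fun x => a * g x + h x).
Hypothesis f_H : forall n, H (f n).
Hypothesis f_var : forall n, var_le p (f n) C.
Hypothesis f_van : forall n, vanishing_var p (f n).
Hypothesis F_var : var_le p F CF.
Hypothesis f_cvg : forall e : R, 0 < e ->
  exists n, forall x : R, 0 <= x <= 1 -> `|f n x - F x| <= e.

Lemma linear_closed_sum (r : seq nat) (b : nat -> R) (g : nat -> R -> R) :
  (forall i, H (g i)) -> H (fun x => \sum_(i <- r) b i * g i x).
Proof.
move=> Hg; elim: r => [|i r ih].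
  have -> : (fun x => \sum_(i <- [::]) b i * g i x) = (fun=> 0) => //.
  by apply/funext => x; rewrite big_nil.
have -> : (fun x => \sum_(i <- i :: r) b i * g i x) =
    (fun x => b i * g i x + \sum_(i <- r) b i * g i x).
  by apply/funext => x; rewrite big_cons.
exact: HD.
Qed.

Lemma sum_iota_widen (b : nat -> R) n m : (n <= m)%N ->
  (forall i, (n <= i)%N -> b i = 0) ->
  \sum_(i <- iota 0 m) b i = \sum_(i <- iota 0 n) b i.
Proof.
move=> nm hb; have -> : iota 0 m = iota 0 n ++ iota n (m - n) by rewrite -iotaD subnKC.
rewrite big_cat/= [X in _ + X = _]big1_seq ?addr0// => i /=.
by rewrite mem_iota => /andP[/hb].
Qed.

(** Tail sums of the combined coefficients are sums of disjoint tents, hence at most max |c k|,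
    which gives the upper estimate. For the lower one, the chain attached to the peak of tent [k]
    sees the tail sum [c k], times a variation of [F] larger than [e0]. *)
Lemma c0_sequence : ~ vanishing_var p F -> exists (u : nat -> R -> R) (K c0 : R),
  [/\ forall k, H (u k), 0 < c0,
    forall (c : nat -> R) m (B : R) s, chain s -> 0 <= B ->
      (forall k, (k < m)%N -> `|c k| <= B) ->
      lpsum p s (fun I => \sum_(k <- iota 0 m) c k * incr (u k) I) <= K * B &
    forall (c : nat -> R) m k, (k < m)%N ->
      (forall j, (j < m)%N -> `|c j| <= `|c k|) ->
      exists2 s, chain s &
        c0 * `|c k| <= lpsum p s (fun I => \sum_(k <- iota 0 m) c k * incr (u k) I)].
Proof.
move=> /existsNP[e0 /not_implyP[e00 he0]].
have fineQ (e : R) : 0 < e -> exists s, [/\ chain s, forall I, I \in s -> 0 < len I < e &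
    e0 < lpsum p s (incr F)].
  move=> e_gt0; apply: contrapT => hn; apply: he0; exists e => // s cs hs.
  rewrite leNgt; apply/negP => h; apply: hn.
  (* Degenerate intervals have zero increment; dropping them gives the positive lengths that the
     selection needs. *)
  exists [seq I <- s | 0 < len I]; split; first exact: chain_filter.
    by move=> I; rewrite mem_filter => /andP[-> /hs ->].
  apply: lt_le_trans h _; rewrite (lpsum_filter p1); apply: (lpsum_le_in p1) => I sI.
  case: ifP => // /negbT; have [_ I12 _] := chain_mem cs sI.
  rewrite -leNgt subr_le0 => I21.
  by have -> : incr F I = 0 by rewrite /incr (le_anti (introT andP (conj I12 I21))) subrr.
(* The total error e0 / 2 is half of the lower bound for the variation of [F]. *)
pose eps k : R := e0 / 2 / 2 ^+ k.+1.
have eps0 k : 0 < eps k by rewrite !divr_gt0// exprn_gt0.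
have epsE m : \sum_(i <- iota 0 m) eps i <= e0 / 2.
  by apply: geometric_sum_le; rewrite divr_ge0// ltW.
have [nu [eta [sigma [h1 h2 h3 h4]]]] :=
  rapid_selection p1 f_van f_cvg eps0 fineQ.
pose del k : R := 1 / 2 ^+ k.+1.
have del0 k : 0 < del k by rewrite divr_gt0// exprn_gt0.
have delE m : \sum_(i <- iota 0 m) del i <= 1 by exact: geometric_sum_le.
(* This is used at m = 2 M k: slopes 1 / M k over a block have l_p norm at most (2 M k)^(1/p) / M k
   <= del k. *)
have /choice[M MP] : forall k, exists M, (0 < M)%N /\
    forall m, (M <= m)%N -> m%:R `^ p^-1 / m%:R <= del k / 2.
  by move=> k; have [M ? ?] := powR_inv_small p1 (divr_gt0 (del0 k) (ltr0n _ 2)); exists M.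
have M0 k : (0 < M k)%N by have [] := MP k.
pose b k i : R := tent R M k i - tent R M k i.+1.
have b_out k i : (tent_pos M k.+1 <= i)%N -> b k i = 0.
  by move=> h; rewrite /b !tent_out ?subrr// ?(leqW h) ?h ?orbT.
have b_norm k N : lpsum p (iota 0 N) (b k) <= del k.
  have Mk : 0 < (M k)%:R :> R by rewrite ltr0n.
  have Mi : 0 <= (M k)%:R^-1 :> R by rewrite invr_ge0 ltW.
  set r := [seq i <- iota 0 N | (tent_pos M k <= i < tent_pos M k.+1)%N].
  apply: (@le_trans _ _ (lpsum p r (fun=> (M k)%:R^-1))).
    rewrite (lpsum_filter p1); apply: (lpsum_le p1) => i.
    case: ifP => [_|/negbT]; first by rewrite [leRHS]ger0_norm// tent_step.
    rewrite negb_and -leqNgt -ltnNge => /orP[h|/b_out -> //].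
    by rewrite /b !tent_out ?subrr// ?h ?(ltnW h).
  rewrite (lpsum_const p1) ger0_norm//.
  apply: (@le_trans _ _ ((M k + M k)%:R `^ p^-1 / (M k)%:R)).
    rewrite ler_wpM2r// le_powR ?invr_ge0 ?(ltW (lt_trans ltr01 p1))// ler_nat.
    rewrite -(size_iota (tent_pos M k) (M k + M k)); apply: uniq_leq_size.
      by rewrite filter_uniq ?iota_uniq.
    by move=> i; rewrite mem_filter => /andP[h _]; rewrite mem_iota.
  have [_ /(_ (M k + M k)%N (leq_addr _ _))] := MP k.
  rewrite natrD -mulr2n -[X in _ / X]mulr_natr invfM mulrA.
  by rewrite ler_pM2r ?invr_gt0.
pose u k x := \sum_(i <- iota 0 (tent_pos M k.+1)) b k i * f (nu i) x.
pose beta (c : nat -> R) m i := \sum_(k <- iota 0 m) c k * b k i.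
have uE c m I : \sum_(k <- iota 0 m) c k * incr (u k) I =
    \sum_(i <- iota 0 (tent_pos M m)) beta c m i * incr (f (nu i)) I.
  transitivity (\sum_(k <- iota 0 m) \sum_(i <- iota 0 (tent_pos M m))
      c k * (b k i * incr (f (nu i)) I)).
    rewrite big_seq [RHS]big_seq; apply: eq_bigr => k.
    rewrite mem_iota add0n => /andP[_ km].
    rewrite -mulr_sumr; congr (_ * _).
    rewrite (@sum_iota_widen _ (tent_pos M k.+1)).
    - by rewrite /incr /u -sumrB; apply: eq_bigr => i _; rewrite mulrBr.
    - exact: tent_pos_homo.
    - by move=> i /b_out ->; rewrite mul0r.
  rewrite exchange_big/=; apply: eq_bigr => i _; rewrite mulr_suml.
  by apply: eq_bigr => k _; rewrite mulrA.
have beta_norm c m (B : R) : 0 <= B -> (forall k, (k < m)%N -> `|c k| <= B) ->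
    lpsum p (iota 0 (tent_pos M m)) (beta c m) <= B.
  move=> B0 hB; apply: le_trans (lpsum_sum p1 _ _ _) _.
  rewrite -[leRHS]mulr1; apply: le_trans (ler_wpM2l B0 (delE m)).
  rewrite mulr_sumr big_seq [leRHS]big_seq; apply: ler_sum => k.
  rewrite mem_iota add0n => /andP[_ km]; rewrite (lpsumZ p1).
  exact: ler_pM (normr_ge0 _) (lpsum_ge0 _ _ _) (hB _ km) (b_norm _ _).
(* The coefficients of each [u k] telescope, and all tents involved vanish at the last index. *)
have beta_tail c m n : (n <= tent_pos M m)%N ->
    \sum_(n <= i < tent_pos M m) beta c m i = \sum_(k <- iota 0 m) c k * tent R M k n.
  move=> nN; rewrite exchange_big/= big_seq [RHS]big_seq; apply: eq_bigr => k.
  rewrite mem_iota add0n => /andP[_ km]; rewrite -mulr_sumr; congr (_ * _).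
  rewrite (eq_bigr (fun i => - (tent R M k i.+1 - tent R M k i))); last first.
    by move=> i _; rewrite opprB.
  rewrite sumrN telescope_sumr// opprB (@tent_out _ _ M0 _ (tent_pos M m)) ?subr0//.
  by rewrite (tent_pos_homo _ km) orbT.
exists u, (e0 / 2 + C + e0 / 2 + CF), (e0 / 2); split.
- by move=> k; apply: linear_closed_sum.
- by rewrite divr_gt0.
- move=> c m B s cs B0 hB; rewrite (lpsum_eq _ _ (uE c m)).
  apply: le_trans (rapid_uniform_upper p1 (fun k => f_var (nu k)) F_var h2 h3 h1 epsE
    (B := B) cs B0 _) _.
    move=> n nN; rewrite beta_tail//.
    apply: le_trans (ler_norm_sum _ _ _) _.
    rewrite -[leRHS]mulr1; apply: le_trans (ler_wpM2l B0 (@sum_tent_le1 R M M0 n m)).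
    rewrite mulr_sumr big_seq [leRHS]big_seq; apply: ler_sum => k.
    rewrite mem_iota add0n => /andP[_ km].
    by rewrite normrM (ger0_norm (tent_ge0 _ _ _ _)) ler_wpM2r ?tent_ge0 ?hB.
  rewrite mulrDl [X in _ <= _ + X]mulrC lerD2r mulrC ler_wpM2l ?beta_norm//.
  have := le_trans (lpsum_ge0 p [::] _) (f_var 0%N (s := [::]) isT).
  have : 0 <= e0 / 2 by rewrite divr_ge0// ltW.
  by move=> a1 a2; rewrite addr_ge0// addr_ge0.
move=> c m k km hk.
pose n := (tent_pos M k + M k)%N.
have n0 : (0 < n)%N by rewrite /n ltn_addl.
have nN : (n <= tent_pos M m)%N.
  by apply: leq_trans (tent_pos_homo _ km); rewrite /= leq_add2l leq_addr.
(* [sigma n.-1] is short exactly for the functions before index [n], so the tail sum starting at the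
   peak [n] is the one it sees. *)
have [c1 Qs h5 h6] := h4 n.-1; rewrite prednK// in h5 h6.
exists (sigma n.-1); first exact: c1.
rewrite (lpsum_eq _ _ (uE c m)).
have := rapid_uniform_lower p1 h2 epsE (beta c m) nN h5 h6.
rewrite (beta_tail _ _ _ nN) (sum_tent_peak M0 c km) => h7.
have h8 := beta_norm c m _ (normr_ge0 _) hk.
have h9 : `|c k| * e0 <= `|c k| * lpsum p (sigma n.-1) (incr F).
  exact: ler_wpM2l (normr_ge0 _) _ _ (ltW Qs).
exact: half_bound h9 h7 (ler_wpM2r (divr_ge0 (ltW e00) (ler0n _ 2)) h8).
Qed.

End C0Sequence.

(** * James sequences *)

(* The normal direction c is taken at an approximate nearest point of S to P. *)
Lemma finite_separation (R : realType) (n : nat) (S : set (nat -> R)) (B m : R)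
    (P : nat -> R) : S !=set0 -> 0 < m ->
  (forall v w t, S v -> S w -> 0 <= t <= 1 -> S (fun i => v i + t * (w i - v i))) ->
  (forall w i, S w -> `|w i| <= B) ->
  (forall w, S w -> m <= \sum_(i < n) (P i - w i) ^+ 2) ->
  exists c : nat -> R, forall w, S w ->
    \sum_(i < n) c i * w i <= \sum_(i < n) c i * P i - m / 2.
Proof.
move=> [w1 Sw1] m0 S_conv S_bd S_far.
pose q (w : nat -> R) := \sum_(i < n) (P i - w i) ^+ 2.
pose K := n%:R * (2 * B) ^+ 2.
have K0 : 0 <= K by rewrite mulr_ge0// sqr_ge0.
have hK v w : S v -> S w -> \sum_(i < n) (w i - v i) ^+ 2 <= K.
  move=> Sv Sw; rewrite /K mulr_natl -[n in leRHS]card_ord -sumr_const.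
  apply: ler_sum => i _; rewrite -[leLHS]real_normK ?num_real//.
  rewrite lerXn2r ?nnegrE//.
    by have := S_bd _ i Sv; have := normr_ge0 (v i); lra.
  by apply: le_trans (ler_normB _ _) _; have := S_bd _ i Sv; have := S_bd _ i Sw; lra.
have hinf : has_inf [set q w | w in S].
  by split; [exists (q w1), w1|exists 0 => _ [w Sw <-]; apply: sumr_ge0 => i _; exact: sqr_ge0].
pose D := inf [set q w | w in S].
have hD w : S w -> D <= q w by move=> Sw; apply: inf_lbound; [case: hinf|exists w].
(* A step of length [lam] towards [w] has second-order cost lam^2 K; this choice gives [lam <= 1]
   and [lam * K <= m / 2]. *)
pose lam := m / (2 * (K + m)).
have d0 : 0 < 2 * (K + m) by lra.
have lam0 : 0 < lam by rewrite divr_gt0.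
have lam1 : lam <= 1 by rewrite ler_pdivrMr// mul1r; lra.
have lamK : lam * K <= m / 2.
  have e : lam * (2 * (K + m)) = m by rewrite /lam divfK// gt_eqF.
  have := mulr_gt0 lam0 m0; lra.
(* [S] need not be closed, so the infimum is only approached, within an error that is small compared
   with [lam]. *)
have [_ [w0 Sw0 <-] hw0] := inf_adherent (mulr_gt0 lam0 (divr_gt0 m0 (ltr0n R 2))) hinf.
exists (fun i => P i - w0 i) => w Sw.
have Sl : S (fun i => w0 i + lam * (w i - w0 i)) by apply: S_conv; rewrite ?(ltW lam0).
pose A := \sum_(i < n) (P i - w0 i) * (w i - w0 i).
have hq : q (fun i => w0 i + lam * (w i - w0 i)) =
    q w0 - 2 * lam * A + lam ^+ 2 * \sum_(i < n) (w i - w0 i) ^+ 2.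
  rewrite /q /A !mulr_sumr -sumrB -big_split/=; apply: eq_bigr => i _; ring.
have h1 := hD _ Sl; have h2 := hK _ _ Sw0 Sw; have h3 := S_far _ Sw0.
have h4 : lam * (2 * A) <= lam * (m / 2 + lam * K).
  have : lam ^+ 2 * \sum_(i < n) (w i - w0 i) ^+ 2 <= lam ^+ 2 * K.
    by rewrite ler_wpM2l// sqr_ge0.
  rewrite hq -/D in h1 hw0; move: h1 hw0; rewrite expr2 => h1 hw0 h5.
  have -> : lam * (2 * A) = 2 * lam * A by ring.
  have -> : lam * (m / 2 + lam * K) = lam * (m / 2) + lam * lam * K by ring.
  lra.
rewrite ler_pM2l// in h4.
have e1 : \sum_(i < n) (P i - w0 i) * w i = A + \sum_(i < n) (P i - w0 i) * w0 i.
  by rewrite -big_split/=; apply: eq_bigr => i _; ring.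
have e2 : \sum_(i < n) (P i - w0 i) * P i = q w0 + \sum_(i < n) (P i - w0 i) * w0 i.
  by rewrite -big_split/=; apply: eq_bigr => i _; ring.
rewrite e1 e2; rewrite -/(q w0) in h3; lra.
Qed.

Lemma cdual_le (R : realType) (E : normedModType R) (phi : cdual E) x :
  `|phi x| <= `|phi| * `|x|.
Proof.
have [->|x0] := eqVneq x 0; first by rewrite linear0 !normr0 mulr0.
have nx : 0 < `|x| by rewrite normr_gt0.
rewrite -ler_pdivrMr//.
have h : `|(`|x|^-1 *: x)| <= 1.
  by rewrite normrZ normfV normr_id mulVf// normr_eq0.
by have := dual_norm_ub phi h; rewrite linearZ/= normrM normfV normr_id mulrC.
Qed.

Lemma unit_ball_convex (R : realType) (E : normedModType R) (x y : E) (t : R) :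
  `|x| <= 1 -> `|y| <= 1 -> 0 <= t <= 1 -> `|x + t *: (y - x)| <= 1.
Proof.
move=> x1 y1 /andP[t0 t1].
have -> : x + t *: (y - x) = (1 - t) *: x + t *: y.
  by rewrite scalerBr scalerBl scale1r addrA addrAC.
apply: le_trans (ler_normD _ _) _; rewrite !normrZ (ger0_norm t0).
rewrite ger0_norm ?subr_ge0//.
have : (1 - t) * `|x| <= (1 - t) * 1 by rewrite ler_wpM2l// subr_ge0.
have : t * `|y| <= t * 1 by rewrite ler_wpM2l.
lra.
Qed.

Section James.
Variables (R : realType) (X : normedModType R).

Lemma cdual_sum n (c : nat -> R) (phi : nat -> cdual X) x :
  (\sum_(i < n) c i *: phi i) x = \sum_(i < n) c i * phi i x.
Proof.
elim: n => [|n ih]; first by rewrite !big_ord0.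
by rewrite !big_ord_recr /= -ih.
Qed.


(** If the image of the unit ball in R^n stayed away from the values of [Phi], a separating [c]
    would give psi = sum c_i phi_i with |psi| < Phi psi <= |psi|. *)
Lemma goldstine (Phi : cdual (cdual X)) n (phi : nat -> cdual X) (e : R) :
  `|Phi| <= 1 -> 0 < e ->
  exists2 x : X, `|x| <= 1 & forall i, (i < n)%N -> `|phi i x - Phi (phi i)| <= e.
Proof.
move=> Phi1 e0; apply: contrapT => hn.
pose S := [set (fun i => if (i < n)%N then phi i x else 0) | x in [set x : X | `|x| <= 1]].
pose P i := if (i < n)%N then Phi (phi i) else 0 : R.
have [||v w t|w i|w|c hc] := @finite_separation R n S (\sum_(i < n) `|phi i|) (e ^+ 2) P.
- by exists (fun i => if (i < n)%N then phi i 0 else 0); exists 0; rewrite //= normr0.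
- by rewrite exprn_gt0.
- move=> [x /= x1 <-] [y /= y1 <-] t01; exists (x + t *: (y - x)) => /=.
    exact: unit_ball_convex.
  apply/funext => i; case: ifP => _; last by rewrite subrr mulr0 addr0.
  by rewrite linearD linearZ/= linearB.
- move=> [x /= x1 <-]; case: ifP => [ni|_]; last first.
    by rewrite normr0 sumr_ge0.
  apply: le_trans (cdual_le _ _) _; apply: (@le_trans _ _ `|phi i|).
    by rewrite ler_piMr.
  by rewrite (bigD1 (Ordinal ni))//= lerDl sumr_ge0.
- move=> [x /= x1 <-].
  have [i ni hi] : exists2 i, (i < n)%N & e < `|phi i x - Phi (phi i)|.
    apply: contrapT => h; apply: hn; exists x => // i ni.
    by rewrite leNgt; apply/negP => hi; apply: h; exists i.
  rewrite (bigD1 (Ordinal ni))//= /P ni; apply: (@le_trans _ _ ((Phi (phi i) - phi i x) ^+ 2)).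
    rewrite -[leRHS]real_normK ?num_real// lerXn2r ?nnegrE// ?(ltW e0)//.
    by rewrite distrC ltW.
  by rewrite lerDl sumr_ge0// => j _; exact: sqr_ge0.
pose psi : cdual X := \sum_(i < n) c i *: phi i.
have psi_le : `|psi| <= Phi psi - e ^+ 2 / 2.
  have PhiE : Phi psi = \sum_(i < n) c i * P i.
    rewrite /psi linear_sum; apply: eq_bigr => i _.
    by rewrite linearZ/= /P ltn_ord.
  apply: dual_norm_le => x x1.
  have h y : `|y| <= 1 -> psi y <= Phi psi - e ^+ 2 / 2.
    move=> y1; rewrite PhiE; apply: le_trans (hc (fun i => if (i < n)%N then phi i y else 0) _).
      by rewrite /psi cdual_sum; apply: ler_sum => i _; rewrite ltn_ord.
    by exists y.
  rewrite ler_norml h// andbT.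
  by have := h (- x); rewrite normrN linearN => /(_ x1); lra.
have := cdual_le Phi psi.
have : `|Phi| * `|psi| <= 1 * `|psi| by rewrite ler_wpM2r.
have := ler_norm (Phi psi).
have : 0 < e ^+ 2 by rewrite exprn_gt0.
lra.
Qed.

(** The points (phi (f 0), ..., phi (f (n-1)), Phi phi) are separated from (0, ..., 0, d). Dividing
    the separating inequality by its last coefficient gives a [y] in the span of the [f i] with Phi
    phi - phi y < d for every [phi] in the ball. *)
Lemma almost_annihilator (Phi : cdual (cdual X)) (d e : R) n (f : nat -> X) :
  (forall y : X, exists2 phi : cdual X, `|phi| <= 1 & d < Phi phi - phi y) ->
  0 < d -> 0 < e ->
  exists2 phi : cdual X, `|phi| <= 1 &
    d - e <= Phi phi /\ forall i, (i < n)%N -> `|phi (f i)| <= e.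
Proof.
move=> hd d0 e0; apply: contrapT => hn.
pose vec (phi : cdual X) (i : nat) : R :=
  if (i < n)%N then phi (f i) else if i == n then Phi phi else 0.
pose S := [set vec phi | phi in [set phi : cdual X | `|phi| <= 1]].
pose P i : R := if i == n then d else 0.
have [||v w t|w i|w|c hc] := @finite_separation R n.+1 S
    (`|Phi| + \sum_(i < n) `|f i|) (e ^+ 2) P.
- by exists (vec 0); exists 0; rewrite //= normr0.
- by rewrite exprn_gt0.
- move=> [x /= x1 <-] [y /= y1 <-] t01; exists (x + t *: (y - x)) => /=.
    exact: unit_ball_convex.
  apply/funext => i; rewrite /vec; case: ifP => _ //.
  case: ifP => _; last by rewrite subrr mulr0 addr0.
  by rewrite linearD linearZ/= linearB.
- move=> [x /= x1 <-]; rewrite /vec; case: ifP => [ni|_].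
    apply: le_trans (cdual_le _ _) _; apply: (@le_trans _ _ `|f i|).
      by rewrite ler_piMl.
    by rewrite (bigD1 (Ordinal ni))//= addrCA lerDl addr_ge0// sumr_ge0.
  case: ifP => _; last by rewrite normr0 addr_ge0// sumr_ge0.
  apply: le_trans (cdual_le _ _) _; apply: (@le_trans _ _ `|Phi|).
    by rewrite ler_piMr.
  by rewrite lerDl sumr_ge0.
- move=> [x /= x1 <-]; rewrite big_ord_recr/= /P /vec eqxx ltnn.
  have [h|h] := leP (d - e) (Phi x); last first.
    apply: (@le_trans _ _ ((d - Phi x) ^+ 2)).
      by rewrite lerXn2r ?nnegrE//; lra.
    by rewrite lerDr sumr_ge0// => j _; exact: sqr_ge0.
  have [i ni hi] : exists2 i, (i < n)%N & e < `|x (f i)|.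
    apply: contrapT => h'; apply: hn; exists x => //; split => // i ni.
    by rewrite leNgt; apply/negP => hi; apply: h'; exists i.
  rewrite (bigD1 (Ordinal ni))//= ni (ltn_eqF ni) sub0r sqrrN -addrA.
  apply: (@le_trans _ _ ((x (f i)) ^+ 2)).
    by rewrite -[leRHS]real_normK ?num_real// lerXn2r ?nnegrE// ltW.
  by rewrite lerDl addr_ge0 ?sqr_ge0// sumr_ge0// => j _; exact: sqr_ge0.
have e20 : 0 < e ^+ 2 by rewrite exprn_gt0.
have {}hc (phi : cdual X) : `|phi| <= 1 ->
    \sum_(i < n) c i * phi (f i) + c n * Phi phi <= c n * d - e ^+ 2 / 2.
  move=> phi1; have := hc (vec phi) (ex_intro2 _ _ phi phi1 erefl).
  rewrite !big_ord_recr/= /P /vec eqxx ltnn.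
  rewrite [X in _ <= X + _ - _]big1 ?add0r; last first.
    by move=> i _; rewrite (ltn_eqF (ltn_ord i)) mulr0.
  by under eq_bigr do rewrite ltn_ord.
(* The separating inequality at phi = 0 forces a positive last coefficient. *)
have cn : 0 < c n.
  have := hc 0; rewrite normr0 ler01 => /(_ isT).
  rewrite [X in X + _]big1 ?add0r; last by move=> i _; rewrite /= mulr0.
  rewrite linear0 mulr0 => h.
  have : 0 < c n * d by lra.
  by rewrite pmulr_lgt0.
pose y : X := - \sum_(i < n) (c i / c n) *: f i.
have [phi phi1] := hd y; apply/negP; rewrite -leNgt -(ler_pM2l cn) mulrBr.
have -> : c n * phi y = - \sum_(i < n) c i * phi (f i).
  rewrite /y linearN linear_sum mulrN mulr_sumr; congr (- _).
  by apply: eq_bigr => i _; rewrite linearZ/= mulrA mulrCA mulfV ?mulr1// gt_eqF.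
have := hc _ phi1; lra.
Qed.

(* A convex combination of the first terms of f stays at distance 3 d / 8 from
   every convex combination of late terms. *)
Lemma james_sequence (Phi : cdual (cdual X)) (d : R) : `|Phi| <= 1 -> 0 < d ->
  (forall y : X, exists2 phi : cdual X, `|phi| <= 1 & d < Phi phi - phi y) ->
  exists (f : nat -> X) (phi : nat -> cdual X),
  [/\ forall n, `|f n| <= 1, forall n, `|phi n| <= 1,
    forall i n, (i <= n)%N -> d / 2 <= phi i (f n) &
    forall i n, (n < i)%N -> `|phi i (f n)| <= d / 8].
Proof.
move=> Phi1 d0 hd; have d80 : 0 < d / 8 by rewrite divr_gt0.
pose T : Type := (cdual X * X)%type; pose t0 : T := (0, 0).
pose P (s : seq T) (x : T) := [/\ `|x.1| <= 1, `|x.2| <= 1, d - d / 8 <= Phi x.1,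
  forall i, (i < size s)%N -> `|x.1 (nth t0 s i).2| <= d / 8 &
  forall i, (i <= size s)%N ->
    `|(nth t0 (rcons s x) i).1 x.2 - Phi (nth t0 (rcons s x) i).1| <= d / 8].
have [//|s _|u uP] := @history_choice T (fun=> True) P.
  (* The functional comes first: it almost annihilates all earlier vectors. The vector then imitates
     [Phi] on all functionals so far, the new one included, hence values at least d - d/8 - d/8. *)
  have [phi phi1 [hphi hphi']] := almost_annihilator (size s) (fun i => (nth t0 s i).2) hd d0 d80.
  have [f f1 hf] := goldstine (size s).+1 (fun i => (nth t0 (rcons s (phi, 0)) i).1) Phi1 d80.
  exists (phi, f); split => //; split => // i si.
  have := hf i si; rewrite !nth_rcons; case: ifP => // _; case: ifP => //.
exists (fun n => (u n).2), (fun n => (u n).1); split.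
- by move=> n; have [] := uP n.
- by move=> n; have [] := uP n.
- move=> i n le_in; have [_ _ _ _] := uP n; rewrite size_mkseq => /(_ i le_in).
  rewrite -mkseqS nth_mkseq ?ltnS// => h; have [_ _ h' _ _] := uP i.
  by move: h; rewrite ler_norml => /andP[h _]; lra.
- move=> i n ni; have [_ _ _ h _] := uP i.
  by have := h n; rewrite size_mkseq nth_mkseq//; apply.
Qed.

End James.

(** * Partitions and chains of intervals *)

Section Consecutive.
Variables (R : realType) (p : R).
Hypothesis p1 : 1 < p.

Fixpoint path_var A (h : A -> R) (x : A) (r : seq A) : R :=
  if r is y :: r' then `|h y - h x| `^ p + path_var h y r' else 0.

Lemma path_var_ge0 A (h : A -> R) x r : 0 <= path_var h x r.
Proof. by elim: r x => //= y r ih x; rewrite addr_ge0 ?powR_ge0. Qed.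

Lemma path_var_cat A (h : A -> R) x r r' :
  path_var h x (r ++ r') = path_var h x r + path_var h (last x r) r'.
Proof. by elim: r x => /= [|y r ih] x; rewrite ?add0r// ih addrA. Qed.

Lemma path_var_map A B (h : B -> R) (k : A -> B) x r :
  path_var h (k x) (map k r) = path_var (h \o k) x r.
Proof. by elim: r x => //= y r ih x; rewrite ih. Qed.

Lemma path_varE A (h : A -> R) x0 x r :
  path_var h x r =
  \sum_(i < size r) `|h (nth x0 (x :: r) i.+1) - h (nth x0 (x :: r) i)| `^ p.
Proof.
elim: r x => /= [|y r ih] x; first by rewrite big_ord0.
by rewrite big_ord_recl /= ih.
Qed.

Fixpoint intervals (x : R) (r : seq R) : seq (R * R) :=
  if r is y :: r' then (x, y) :: intervals y r' else [::].

Lemma intervals_var g x r :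
  path_var g x r = \sum_(I <- intervals x r) `|incr g I| `^ p.
Proof.
elim: r x => /= [|y r ih] x; first by rewrite big_nil.
by rewrite big_cons ih.
Qed.

Lemma intervals_chain x r : 0 <= x -> path <%R x r -> last x r <= 1 ->
  chain (intervals x r) /\ forall I, I \in intervals x r -> x <= I.1.
Proof.
elim: r x => //= y r ih x x0 /andP[xy yr] r1.
have y0 : 0 <= y by apply: le_trans (ltW xy).
have [/andP[c1 c2] hy] := ih _ y0 yr r1.
have y1 : y <= 1.
  apply: le_trans r1; have := order_path_min lt_trans yr.
  by case: (lastP r) => [//|r' z] /allP/(_ z); rewrite mem_rcons mem_head last_rcons => /(_ isT)/ltW.
split; last first.
  by move=> I; rewrite inE => /orP[/eqP ->//|/hy]; apply: le_trans; exact: ltW.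
rewrite /chain /= x0 (ltW xy) y1 c1 c2 !andbT /=.
by apply/allP => I /hy.
Qed.

Lemma intervals_step (e : rel R) x r : path e x r ->
  forall I, I \in intervals x r -> e I.1 I.2.
Proof.
elim: r x => //= y r ih x /andP[xy /ih h] I.
by rewrite inE => /orP[/eqP ->//|/h].
Qed.

Definition step_rel (eta : R) : rel R := fun x y => (x < y) && (y - x <= eta).

Lemma fill (eta x a : R) : 0 < eta -> x <= a ->
  exists2 r, path (step_rel eta) x r & last x r = a.
Proof.
move=> eta0 xa.
have [n] : exists n, a - x <= n%:R * eta.
  exists (Num.truncn ((a - x) / eta)).+1.
  by rewrite -ler_pdivrMr//; exact/ltW/truncnS_gt.
elim: n x xa => [|n ih] x xa.
  rewrite mul0r subr_le0 => ax; exists [::] => //=.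
  by apply/eqP; rewrite eq_le xa ax.
rewrite -natr1 mulrDl mul1r => h.
have [->|nxa] := eqVneq x a; first by exists [::].
have xa' : x < a by rewrite lt_neqAle nxa.
have [h1|h1] := leP (a - x) eta.
  by exists [:: a] => //=; rewrite /step_rel xa' h1.
have [||r h2 h3] := ih (x + eta); [lra..|].
exists (x + eta :: r) => //=; rewrite h2 andbT /step_rel.
by apply/andP; split; lra.
Qed.

(** Filling the gaps with steps of size at most [eta] adds only nonnegative terms. *)
Lemma chain_complete (g : R -> R) (eta x : R) c : 0 < eta -> 0 <= x -> x <= 1 ->
  chain c -> (forall I, I \in c -> x <= I.1) -> (forall I, I \in c -> len I <= eta) ->
  exists r, [/\ path (step_rel eta) x r, last x r = 1 &
    \sum_(I <- c) `|incr g I| `^ p <= path_var g x r].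
Proof.
move=> eta0; elim: c x => [|[a b] c ih] x x0 x1 cc hx hl.
  have [r h1 h2] := fill eta0 x1; exists r; split => //.
  by rewrite big_nil path_var_ge0.
have [a0 ab b1] := chain_mem cc (mem_head _ _).
have xa : x <= a := hx _ (mem_head _ _).
have [r h1 h2] := fill eta0 xa.
have cc' : chain c by apply: chain_subseq cc; exact: subseq_cons.
have b0 : 0 <= b by exact: le_trans ab.
have hb I : I \in c -> b <= I.1.
  by move: cc => /andP[_] /= /andP[/allP h _] /h.
have [|r' [h3 h4 h5]] := ih b b0 b1 cc' hb.
  by move=> I cI; apply: hl; rewrite inE cI orbT.
have lab : b - a <= eta by exact: (hl _ (mem_head _ _)).
have hr : path_var g x r >= 0 by exact: path_var_ge0.
(* A degenerate interval contributes 0 and is skipped, since the path must increase strictly. *)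
move: ab => /=; rewrite le_eqVlt => /orP[/eqP ab|ab].
  exists (r ++ r'); rewrite cat_path last_cat path_var_cat h1 h2 -ab in h3 h4 h5 *.
  split => //=; rewrite big_cons /incr /= subrr normr0 powR0 ?gt_eqF ?(lt_trans ltr01)//.
  by rewrite add0r ler_wpDl// ab.
exists (r ++ b :: r'); rewrite cat_path last_cat path_var_cat h1 h2 /=; split => //.
  by rewrite h3 andbT /step_rel ab.
by rewrite big_cons ler_wpDl// lerD2l.
Qed.

End Consecutive.

Section Bridge.
Variables (R : realType) (p : R).
Hypothesis p1 : 1 < p.
Implicit Types (f : {i01 R} -> R^o) (s : seq {i01 R}).

Lemma clamp01_ge0 (x : R) : 0 <= Num.min 1 (Num.max 0 x).
Proof. by rewrite le_min ler01 le_max lexx. Qed.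

Lemma clamp01_le1 (x : R) : Num.min 1 (Num.max 0 x) <= 1.
Proof. by rewrite ge_min lexx. Qed.

Definition clamp01 (x : R) : {i01 R} := Itv01 (clamp01_ge0 x) (clamp01_le1 x).

Lemma clamp01K (x : R) : 0 <= x <= 1 -> (clamp01 x)%:num = x.
Proof. by move=> /andP[x0 x1]; rewrite /=; rewrite (max_idPr x0); apply/min_idPr. Qed.

Lemma num01 (t : {i01 R}) : 0 <= t%:num <= 1.
Proof. by apply/andP; split. Qed.

Lemma clamp01_num (t : {i01 R}) : clamp01 t%:num = t.
Proof. by apply/val_inj; rewrite [LHS]clamp01K// num01. Qed.

(** Composition with the clamp extends [f] to the line, so that chains can have real endpoints
    without proofs of membership in [0, 1]. *)
Definition ext01 f (x : R) : R := f (clamp01 x).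

Let num (t : {i01 R}) : R := t%:num.

Lemma alpha_pE f s : alpha_p p f s = path_var p (ext01 f) 0 (map num s) `^ p^-1.
Proof.
have -> : 0 = num 0%:i01 by [].
rewrite path_var_map (path_varE _ _ 0%:i01) /alpha_p; congr (_ `^ _).
by apply: eq_bigr => i _; rewrite /= /ext01 !clamp01_num.
Qed.

Lemma partition01_path s : partition01 s ->
  path <%R 0 (map num s) /\ last 0 (map num s) = 1.
Proof.
move=> [h1 h2]; have -> : 0 = num 0%:i01 by [].
by rewrite path_map last_map h2; split => //; exact: h1.
Qed.

Lemma path_partition01 (r : seq R) : path <%R 0 r -> last 0 r = 1 ->
  partition01 (map clamp01 r) /\ map num (map clamp01 r) = r.
Proof.
move=> hr lr.
have r01 x : x \in r -> 0 <= x <= 1.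
  move=> xr; apply/andP; split.
    by have /allP := order_path_min lt_trans hr; move=> /(_ _ xr)/ltW.
  rewrite -lr; case/splitPr: xr hr {lr} => r1 r2; rewrite cat_path last_cat /=.
  move=> /and3P[_ _ h]; have /allP := order_path_min lt_trans h.
  by case: (lastP r2) => [//|r3 z] /(_ z); rewrite mem_rcons mem_head last_rcons => /(_ isT)/ltW.
have e : map num (map clamp01 r) = r.
  by rewrite -map_comp -[RHS]map_id; apply/eq_in_map => x /r01 h; exact: clamp01K.
split => //; split.
  have : path <%R (num 0%:i01) (map num (map clamp01 r)) by rewrite e.
  by rewrite path_map.
have el : last (num 0%:i01) (map num (map clamp01 r)) = 1 by rewrite e.
by rewrite last_map in el; exact/val_inj.
Qed.

Lemma node_num s j : (j <= size s)%N ->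
  (node s j)%:num = nth 0 (0 :: map num s) j.
Proof. by case: j => [//|j] js; rewrite /node /= (nth_map 0%:i01). Qed.

Lemma mesh_leP s (e : R) : 0 <= e -> mesh s <= e <->
  forall i, (i < size s)%N -> (node s i.+1)%:num - (node s i)%:num <= e.
Proof.
move=> e0; split => [h i si|h]; last by apply: bigmax_le => // i _; exact: h.
apply: le_trans h; exact: (le_bigmax _ _ (Ordinal si)).
Qed.

Lemma lpsum_le_alpha f (eta : R) c : 0 < eta -> chain c ->
  (forall I, I \in c -> len I <= eta) ->
  exists s, [/\ partition01 s, mesh s <= eta & lpsum p c (incr (ext01 f)) <= alpha_p p f s].
Proof.
move=> eta0 cc hc.
have [|r [r1 r2 r3]] := chain_complete p1 (ext01 f) eta0 (lexx 0) ler01 cc _ hc.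
  by move=> I /(chain_mem cc)[].
have hr : path <%R 0 r by apply: sub_path r1 => x y /andP[].
have [h1 h2] := path_partition01 hr r2.
exists (map clamp01 r); split => //; last first.
  rewrite alpha_pE h2 le_powR ?invr_ge0 ?(ltW (lt_trans ltr01 p1))//.
  exact: sum_powR_ge0.
apply/mesh_leP; first exact: ltW.
move=> i; rewrite size_map => ir.
have /(pathP 0)/(_ i ir)/andP[_] := r1.
by rewrite !node_num ?size_map ?h2//; exact: ltnW.
Qed.

Lemma alpha_le_lpsum f s (e : R) : partition01 s -> 0 <= e -> mesh s <= e ->
  exists c, [/\ chain c, forall I, I \in c -> len I <= e &
    alpha_p p f s = lpsum p c (incr (ext01 f))].
Proof.
move=> ps e0 /mesh_leP-/(_ e0) hm; have [h1 h2] := partition01_path ps.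
have h2' : last 0 (map num s) <= 1 by rewrite h2.
have [c1 _] := intervals_chain (lexx 0) h1 h2'.
exists (intervals 0 (map num s)); split => //; last by rewrite alpha_pE intervals_var.
apply: (@intervals_step R (fun x y : R => y - x <= e)); apply/(pathP 0) => i; rewrite size_map => si.
by have := hm i si; rewrite !node_num//; exact: ltnW.
Qed.

Lemma mesh_le1 s : mesh s <= 1.
Proof.
by apply/mesh_leP => // i _; rewrite lerBlDr ler_wpDr.
Qed.

Lemma Vp_enorm_leP f (c : R) : (Vp_enorm p f <= c%:E)%E <-> var_le p (ext01 f) c.
Proof.
split => [h r cr|h].
  have [|s [ps _ hs]] := lpsum_le_alpha f ltr01 cr.
    by move=> I /(chain_mem cr)[]; rewrite /len; lra.
  by apply: le_trans hs _; rewrite -lee_fin; apply: le_trans h; exact: Vp_enorm_ge.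
apply: ge_ereal_sup => _ [s ps <-]; rewrite lee_fin.
by have [r [cr _ ->]] := alpha_le_lpsum f ps ler01 (mesh_le1 s); exact: h.
Qed.

Lemma Vp_modulus_leP f (eta c : R) : 0 < eta -> (Vp_modulus p f eta <= c%:E)%E <->
  forall r, chain r -> (forall I, I \in r -> len I <= eta) ->
    lpsum p r (incr (ext01 f)) <= c.
Proof.
move=> eta0; split => [h r cr hr|h].
  have [s [ps ms hs]] := lpsum_le_alpha f eta0 cr hr.
  apply: le_trans hs _; rewrite -lee_fin; apply: le_trans h.
  by apply: ereal_sup_ubound; exists s.
apply: ge_ereal_sup => _ [s [ps ms] <-]; rewrite lee_fin.
have [r [cr hr ->]] := alpha_le_lpsum f ps (ltW eta0) ms; exact: h.
Qed.

Lemma Vp_norm_leP (f : Vp p1) (c : R) : `|f| <= c <-> var_le p (ext01 f) c.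
Proof.
rewrite -Vp_enorm_leP -[`|f|]/(fine (Vp_enorm p f)) -lee_fin fineK//.
by apply: (extnorm_fin (@Vp_enorm_ge0 _ _)); exact: (VpP f).2.
Qed.

Lemma Vp0_predP (f : Vp p1) : f \in Vp0_pred (p1 := p1) <-> vanishing_var p (ext01 f).
Proof.
split=> [/asboolP h e e0|h].
  have : \forall x \near 0^'+, (Vp_modulus p f x < e%:E)%E.
    apply: (h [set y | (y < e%:E)%E]); apply: open_nbhs_nbhs.
    by split; [exact: open_ereal_lt_ereal|rewrite /= lte_fin].
  (* The filter [0^'+] bounds the modulus only for parameters in ]0, d[, hence the half. *)
  move=> [d /= d0 hd]; exists (d / 2); first by rewrite divr_gt0.
  have h' : (Vp_modulus p f (d / 2) <= e%:E)%E.
    apply: ltW; apply: hd; last by rewrite /= divr_gt0.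
    by rewrite /ball_ /= sub0r normrN gtr0_norm ?divr_gt0//; lra.
  move=> r cr hr; have /Vp_modulus_leP : 0 < d / 2 by rewrite divr_gt0.
  by move=> /(_ f e)[/(_ h') h2 _]; apply: h2 => // I /hr/ltW.
apply/asboolP.
have small e : 0 < e -> \forall d \near 0^'+, (0 <= Vp_modulus p f d <= e%:E)%E.
  move=> /h[eta eta0 heta]; near=> d.
  have d0 : 0 < d by near: d; exact: nbhs_right_gt.
  have dlt : d < eta by near: d; exact: nbhs_right_lt.
  rewrite Vp_modulus_ge0//=; apply/Vp_modulus_leP => // r cr hr.
  by apply: heta => // I /hr h1; exact: le_lt_trans dlt.
apply/fine_cvgP; split.
  apply: filterS (small _ ltr01) => d /andP[d0 d1].
  by rewrite ge0_fin_numE// (le_lt_trans d1)// ltry.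
apply/cvgrPdist_le => e e0; apply: filterS (small _ e0) => d /andP[d0 d1].
have fd : Vp_modulus p f d \is a fin_num by rewrite ge0_fin_numE// (le_lt_trans d1)// ltry.
by rewrite /= sub0r normrN ger0_norm ?fine_ge0// -lee_fin fineK.
Unshelve. all: by end_near. Qed.

End Bridge.

(** * Embeddings given by sequences *)

Lemma lipschitz_bound_continuous (R : realType) (E F : normedModType R) (f : E -> F)
    (K : R) : (forall x y, `|f x - f y| <= K * `|x - y|) -> continuous f.
Proof.
move=> h x; apply/cvgrPdist_le => e e0; near=> y.
have K1 : 0 < `|K| + 1 by rewrite ltr_wpDl.
apply: le_trans (h x y) _; apply: (@le_trans _ _ ((`|K| + 1) * `|x - y|)).
  by rewrite ler_wpM2r// (le_trans (ler_norm K))// lerDl.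
rewrite -ler_pdivlMl// mulrC; near: y.
by apply: cvgr_dist_le => //; rewrite divr_gt0.
Unshelve. all: by end_near. Qed.

Section RangeEmbedding.
Variables (R : realType) (E F : normedModType R) (T : {linear E -> F}).
Variables (c K : R).
Hypothesis c_gt0 : 0 < c.
Hypothesis T_lower : forall x : E, c * `|x| <= `|T x|.
Hypothesis T_upper : forall x, `|T x| <= K * `|x|.

Definition range_pred : {pred F} := fun y => `[< exists x, T x = y >].

Lemma range_submod : submod_closed range_pred.
Proof.
split; first by apply/asboolP; exists 0; rewrite linear0.
move=> a _ _ /asboolP[x <-] /asboolP[y <-]; apply/asboolP.
by exists (a *: x + y); rewrite linearP.
Qed.

HB.instance Definition _ :=
  GRing.isSubmodClosed.Build R F range_pred range_submod.

Lemma range_predP x : T x \in range_pred.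
Proof. by apply/asboolP; exists x. Qed.

Definition to_range (x : E) : lsubspace range_pred := Lsubspace (range_predP x).

Lemma to_range_linear : linear to_range.
Proof. by move=> a x y; apply/val_inj; rewrite /= linearP. Qed.

HB.instance Definition _ := GRing.isLinear.Build R E (lsubspace range_pred) _ to_range
  to_range_linear.

Lemma embedding_inj : injective T.
Proof.
move=> x y xy; apply/eqP; rewrite -subr_eq0 -normr_eq0 eq_le normr_ge0 andbT.
rewrite -(ler_pM2l c_gt0) mulr0; apply: le_trans (T_lower _) _.
by rewrite linearB/= xy subrr normr0.
Qed.

Lemma from_range_ex (y : lsubspace range_pred) : exists x, T x = val y.
Proof. by have /asboolP := valP y. Qed.

Definition from_range (y : lsubspace range_pred) : E := projT1 (cid (from_range_ex y)).

Lemma from_rangeK y : T (from_range y) = val y.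
Proof. by rewrite /from_range; case: cid. Qed.

Lemma from_range_linear : linear from_range.
Proof.
by move=> a x y; apply: embedding_inj; rewrite from_rangeK [RHS]linearP/= !from_rangeK.
Qed.

HB.instance Definition _ := GRing.isLinear.Build R (lsubspace range_pred) E _ from_range
  from_range_linear.

Lemma contains_copy_range : contains_copy F E.
Proof.
suff iso : isomorphic E (lsubspace range_pred).
  exact: (ex_intro (fun Z : submodClosed F => isomorphic E (lsubspace Z)) _ iso).
exists to_range, from_range; split.
- by move=> x; apply: embedding_inj; rewrite from_rangeK.
- by move=> y; apply/val_inj; rewrite /= from_rangeK.
- apply: (@lipschitz_bound_continuous _ _ _ _ K) => x y.
  by rewrite -linearB; exact: T_upper.
apply: (@lipschitz_bound_continuous _ _ _ _ c^-1) => x y.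
rewrite -linearB ler_pdivlMl//; apply: le_trans (T_lower _) _.
by rewrite from_rangeK.
Qed.

End RangeEmbedding.

Definition seq_complete (R : realType) (X : normedModType R) :=
  forall y : nat -> X,
  (forall e : R, 0 < e -> exists N, forall n m, (N <= n)%N -> (N <= m)%N ->
    `|y n - y m| <= e) ->
  exists z, forall e : R, 0 < e -> exists N, forall n, (N <= n)%N -> `|y n - z| <= e.

Section SequenceEmbedding.
Variables (R : realType) (E X : normedModType R) (coord : E -> nat -> R) (u : nat -> X).
Variables (c K : R).
Hypothesis X_complete : seq_complete X.
Hypothesis c_gt0 : 0 < c.
Hypothesis coordP : forall (a : R) x y k, coord (a *: x + y) k = a * coord x k + coord y k.
Let S x m : X := \sum_(k <- iota 0 m) coord x k *: u k.
Hypothesis S_cauchy : forall x (e : R), 0 < e -> exists N, forall n m,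
  (N <= n)%N -> (n <= m)%N -> `|\sum_(k <- iota n (m - n)) coord x k *: u k| <= e.
Hypothesis S_upper : forall x m, `|S x m| <= K * `|x|.
Hypothesis S_lower : forall x (e : R), 0 < e -> exists N, forall m, (N <= m)%N ->
  c * `|x| - e <= `|S x m|.

(** The embedding maps [x] to the limit of its partial sums, and both bounds pass to the limit. The
    error in [S_lower] is there because a truncated norm only approximates the norm. *)
Lemma contains_copy_sequence : contains_copy X E.
Proof.
have /choice[T TP] : forall x, exists z, forall e : R, 0 < e -> exists N, forall n,
    (N <= n)%N -> `|S x n - z| <= e.
  move=> x; apply: X_complete => e e0; have [N hN] := S_cauchy x e0.
  have h n m : (N <= n)%N -> (n <= m)%N -> `|S x n - S x m| <= e.
    move=> Nn nm; rewrite distrC; apply: le_trans (hN n m Nn nm).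
    rewrite /S; have -> : iota 0 m = iota 0 n ++ iota n (m - n) by rewrite -iotaD subnKC.
    by rewrite big_cat /= addrAC subrr add0r.
  exists N => n m Nn Nm; case/orP: (leq_total n m) => nm; first exact: h.
  by rewrite distrC; exact: h.
have SP a x y m : S (a *: x + y) m = a *: S x m + S y m.
  rewrite /S scaler_sumr -big_split/=; apply: eq_bigr => k _.
  by rewrite coordP scalerDl scalerA.
have T_lin : linear T.
  move=> a x y; apply/eqP; rewrite -subr_eq0 -normr_eq0 eq_le normr_ge0 andbT.
  apply/ler_addgt0Pr => e e0; rewrite add0r.
  have a1 : 0 < `|a| + 2 by rewrite ltr_wpDl.
  (* The three approximations enter with weights 1, |a| and 1. *)
  have d0 : 0 < e / (`|a| + 2) by rewrite divr_gt0.
  have [N1 h1] := TP (a *: x + y) _ d0; have [N2 h2] := TP x _ d0.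
  have [N3 h3] := TP y _ d0; pose n := (N1 + N2 + N3)%N.
  have {}h1 : `|S (a *: x + y) n - T (a *: x + y)| <= e / (`|a| + 2).
    by apply: h1; rewrite /n -addnA leq_addr.
  have {}h2 : `|S x n - T x| <= e / (`|a| + 2).
    by apply: h2; rewrite /n addnAC leq_addl.
  have {}h3 : `|S y n - T y| <= e / (`|a| + 2) by apply: h3; rewrite /n leq_addl.
  have -> : T (a *: x + y) - (a *: T x + T y) =
      - (S (a *: x + y) n - T (a *: x + y)) + (a *: (S x n - T x) + (S y n - T y)).
    rewrite SP scalerBr opprB [X in _ = _ + X]addrACA -opprD.
    by rewrite addrA subrK.
  apply: le_trans (ler_normD _ _) _; rewrite normrN.
  have h4 : `|a *: (S x n - T x)| <= `|a| * (e / (`|a| + 2)).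
    by rewrite normrZ ler_wpM2l.
  have := ler_normD (a *: (S x n - T x)) (S y n - T y).
  have : e / (`|a| + 2) * (`|a| + 2) = e by rewrite divfK// gt_eqF.
  lra.
have T_upper x : `|T x| <= K * `|x|.
  apply/ler_addgt0Pr => e e0; have [N hN] := TP x _ e0.
  have := hN N (leqnn N); have := S_upper x N; have := ler_normD (S x N) (T x - S x N).
  by rewrite addrC subrK distrC; lra.
have T_lower x : c * `|x| <= `|T x|.
  apply/ler_addgt0Pr => e e0; have e20 : 0 < e / 2 by rewrite divr_gt0.
  have [N hN] := TP x _ e20; have [N' hN'] := S_lower x e20.
  have h1 := hN (N + N')%N (leq_addr _ _); have h2 := hN' (N + N')%N (leq_addl _ _).
  by have := ler_normD (S x (N + N')%N - T x) (T x); rewrite subrK; lra.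
pose TL : {linear E -> X} := HB.pack T (GRing.isLinear.Build R E X *:%R T T_lin).
exact: (@contains_copy_range _ _ _ TL c K c_gt0 T_lower T_upper).
Qed.

End SequenceEmbedding.

(** * Closed subspaces of V_p^0 *)

Section Subspace.
Variables (R : realType) (p : R) (p1 : 1 < p) (Y : submodClosed (Vp0 p1)).
Notation X := (lsubspace Y).

Definition ev (y : X) : R -> R := ext01 (val (val y) : Vp p1).

Lemma evP (a : R) x y t : ev (a *: x + y) t = a * ev x t + ev y t.
Proof.
rewrite /ev; have -> : val (val (a *: x + y)) = a *: val (val x) + val (val y) :> Vp p1.
  by rewrite !linearP.
rewrite /ext01; set f := val (val x); set g := val (val y).
by have -> : Vp_fun (a *: f + g) = a *: Vp_fun f + Vp_fun g by exact: (linearP val).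
Qed.

Lemma evB x y t : ev (x - y) t = ev x t - ev y t.
Proof. by rewrite addrC -scaleN1r evP mulN1r addrC. Qed.

Lemma ev0 t : ev 0 t = 0.
Proof. by have := evB 0 0 t; rewrite subrr => ->; rewrite subrr. Qed.

Lemma ev_norm_leP y (c : R) : `|y| <= c <-> var_le p (ev y) c.
Proof. exact: Vp_norm_leP. Qed.

Lemma ev_norm y s : chain s -> lpsum p s (incr (ev y)) <= `|y|.
Proof. by have /ev_norm_leP := lexx `|y|; apply. Qed.

Lemma ev_van y : vanishing_var p (ev y).
Proof. by apply/Vp0_predP; exact: valP. Qed.

Lemma ev_pt y t : `|ev y t| <= `|y|.
Proof.
pose t' : R := (clamp01 t)%:num.
have -> : ev y t = ev y t' by rewrite /ev /ext01 clamp01_num.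
have y0 : ev y 0 = 0.
  rewrite /ev /ext01; have -> : clamp01 0 = 0%:i01 :> {i01 R}.
    by apply/val_inj; rewrite [LHS]clamp01K// lexx ler01.
  by have [] := VpP (val (val y)).
have /andP[t0 t1] := num01 (clamp01 t).
have c0 : chain [:: (0, t')] by exact: chain1.
apply: le_trans (ev_norm y c0).
have := lpsum_mem p1 (incr (ev y)) (mem_head (0, t') [::]).
by rewrite /incr /= y0 subr0.
Qed.

Lemma ev_sum (r : seq nat) (beta : nat -> R) (u : nat -> X) t :
  ev (\sum_(k <- r) beta k *: u k) t = \sum_(k <- r) beta k * ev (u k) t.
Proof.
elim: r => [|k r ih]; first by rewrite !big_nil ev0.
by rewrite !big_cons evP -ih.
Qed.

Lemma incr_ev_sum (r : seq nat) (beta : nat -> R) (u : nat -> X) I :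
  incr (ev (\sum_(k <- r) beta k *: u k)) I = \sum_(k <- r) beta k * incr (ev (u k)) I.
Proof. by rewrite /incr !ev_sum -sumrB; apply: eq_bigr => k _; rewrite mulrBr. Qed.

(** Lower semicontinuity of the p-variation: a chain has finitely many endpoints, so [h] may depend
    on the finite set and the accuracy. *)
Lemma var_le_limit (g : R -> R) (c : R) : (forall (T : seq R) (d : R), 0 < d ->
    exists h, var_le p h c /\ forall t, t \in T -> 0 <= t <= 1 -> `|h t - g t| <= d) ->
  var_le p g c.
Proof.
move=> hg s cs; apply/ler_addgt0Pr => e e0.
(* Each of the [size s] increments moves by at most 2 d; the added 1 covers the empty chain. *)
pose d := e / ((size s)%:R * 2 + 1).
have s1 : 0 < (size s)%:R * 2 + 1 :> R by rewrite ltr_wpDl// mulr_ge0.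
have d0 : 0 < d by rewrite divr_gt0.
have [h [hv hT]] := hg (map fst s ++ map snd s) d d0.
apply: (@le_trans _ _ (lpsum p s (fun I => incr h I + (incr g I - incr h I)))).
  by apply: (lpsum_le p1) => I; rewrite addrC subrK.
apply: le_trans (lpsumD p1 _ _ _) _; apply: lerD; first exact: hv.
apply: (@le_trans _ _ (lpsum p s (fun=> 2 * d))).
  apply: (lpsum_le_in p1) => I sI; have [I0 I12 I1] := chain_mem cs sI.
  have h1 : `|h I.1 - g I.1| <= d.
    by apply: hT (itv01_left I0 I12 I1); rewrite mem_cat map_f.
  have h2 : `|h I.2 - g I.2| <= d.
    by apply: hT (itv01_right I0 I12 I1); rewrite mem_cat map_f ?orbT.
  have -> : incr g I - incr h I = (h I.1 - g I.1) - (h I.2 - g I.2).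
    by rewrite /incr; ring.
  rewrite [leRHS]ger0_norm; last by rewrite mulr_ge0// ltW.
  by apply: le_trans (ler_normB _ _) _; lra.
have d20 : 0 <= 2 * d by rewrite mulr_ge0// ltW.
apply: le_trans (lpsum_le_size p1 s (fun i => _ : `|2 * d| <= 2 * d)) _.
  by rewrite ger0_norm.
have -> : e = ((size s)%:R * 2 + 1) * d by rewrite mulrC /d divfK// gt_eqF.
by rewrite mulrA ler_wpM2r ?(ltW d0)// lerDl.
Qed.

Lemma eventually_seq (A : eqType) (T : seq A) (P : A -> nat -> Prop) :
  (forall t, t \in T -> exists N, forall n, (N <= n)%N -> P t n) ->
  exists N, forall n, (N <= n)%N -> forall t, t \in T -> P t n.
Proof.
elim: T => [|t T ih] h; first by exists 0%N.
have [N1 h1] := h t (mem_head _ _).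
have [|N2 h2] := ih; first by move=> t' tT; apply: h; rewrite inE tT orbT.
exists (N1 + N2)%N => n hn t'; rewrite inE => /orP[/eqP ->|].
  by apply: h1; apply: leq_trans hn; exact: leq_addr.
by apply: h2; apply: leq_trans hn; exact: leq_addl.
Qed.

Hypothesis Y_closed : closed [set f : Vp0 p1 | f \in Y].

(** The sup norm is dominated by the variation, so a Cauchy sequence converges pointwise; by
    semicontinuity it converges in variation too, which puts the limit into V_p, V_p^0 and then
    Y. *)
Lemma subspace_complete : seq_complete X.
Proof.
move=> y hy.
have /choice[g gP] : forall t : {i01 R}, exists l : R, forall e : R, 0 < e ->
    exists N, forall n, (N <= n)%N -> `|(val (val (y n)) : Vp p1) t - l| <= e.
  move=> t; pose u n : R := (val (val (y n)) : Vp p1) t.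
  have hu n m : `|u n - u m| <= `|y n - y m|.
    by have := ev_pt (y n - y m) t%:num; rewrite evB /ev /ext01 clamp01_num.
  have : cvgn u.
    apply: cauchy_cvg; apply: cauchy_exP => e e0.
    have e20 : 0 < e / 2 by rewrite divr_gt0.
    have [N hN] := hy _ e20; exists (u N); exists N => // n /= Nn.
    rewrite /ball /= (le_lt_trans (hu _ _))// (le_lt_trans (hN _ _ _ Nn))//; lra.
  move=> /cvg_ex[l /cvgrPdist_le ul]; exists l => e e0.
  have [N _ hN] := ul e e0; exists N => n Nn.
  by rewrite distrC; exact: (hN n Nn).
have g0 : g 0%:i01 = 0.
  apply/eqP; rewrite -normr_eq0 eq_le normr_ge0 andbT; apply/ler_addgt0Pr => e e0.
  have [N /(_ N (leqnn N))] := gP 0%:i01 e e0.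
  by have [-> _] := VpP (val (val (y N))); rewrite sub0r normrN add0r.
have dist e : 0 < e -> exists N, forall n, (N <= n)%N ->
    var_le p (fun t => ext01 (g : _ -> R^o) t - ev (y n) t) e.
  move=> e0; have [N hN] := hy e e0; exists N => n Nn; apply: var_le_limit => T d d0.
  have [M hM] := @eventually_seq _ T (fun t m => `|ev (y m) t - ext01 (g : _ -> R^o) t| <= d)
    (fun t _ => gP (clamp01 t) d d0).
  exists (ev (y (M + N)%N - y n)); split.
    by apply/ev_norm_leP; apply: hN => //; exact: leq_addl.
  move=> t tT _; rewrite evB.
  have -> : ev (y (M + N)%N) t - ev (y n) t - (ext01 (g : _ -> R^o) t - ev (y n) t) =
    ev (y (M + N)%N) t - ext01 (g : _ -> R^o) t by ring.
  by apply: hM => //; exact: leq_addr.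
have incrE n I : incr (ext01 (g : _ -> R^o)) I =
    incr (fun t => ext01 (g : _ -> R^o) t - ev (y n) t) I + incr (ev (y n)) I.
  by rewrite /incr; ring.
have gVp : (g : _ -> R^o) \in Vp_pred p1.
  apply/asboolP; split => //; have [N hN] := dist _ ltr01.
  apply: (@le_lt_trans _ _ (1 + `|y N|)%:E); last exact: ltry.
  apply/Vp_enorm_leP => // s cs; rewrite (lpsum_eq _ _ (incrE N)).
  by apply: le_trans (lpsumD p1 _ _ _) _; rewrite lerD ?hN// ev_norm.
pose gV : Vp p1 := MkVp gVp.
have gV0 : gV \in Vp0_pred (p1 := p1).
  apply/Vp0_predP => e e0; have e20 : 0 < e / 2 by rewrite divr_gt0.
  have [N hN] := dist _ e20; have [r r0 hr] := ev_van (y N) e20.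
  exists r => // s cs hs; rewrite (lpsum_eq _ _ (incrE N)).
  apply: le_trans (lpsumD p1 _ _ _) _; rewrite [leRHS]splitr lerD//; first exact: hN.
  exact: hr.
pose gV0' : Vp0 p1 := Lsubspace gV0.
have close e : 0 < e -> exists N, forall n, (N <= n)%N -> `|val (y n) - gV0'| <= e.
  move=> /dist[N hN]; exists N => n Nn; rewrite distrC.
  by apply/Vp_norm_leP => s cs; exact: hN.
have gY : gV0' \in Y.
  suff : closure [set f : Vp0 p1 | f \in Y] gV0' by move/closure_id: Y_closed => <-.
  move=> B /nbhs_ballP[e /= e0 eB].
  have e20 : 0 < e / 2 by rewrite divr_gt0.
  have [N /(_ N (leqnn N)) hN] := close _ e20.
  exists (val (y N)); split; first exact: valP.
  apply: eB; rewrite -ball_normE /ball_ /= distrC (le_lt_trans hN)//; lra.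
by exists (Lsubspace gY) => e /close.
Qed.

End Subspace.

(** * Norming functionals and distance to the bidual *)

Section LpDuality.
Variables (R : realType) (p : R).
Hypothesis p1 : 1 < p.
Let p0 : 0 < p := lt_trans ltr01 p1.

(** The coefficients sg(z i) (|z i| / N)^(p-1) are those of equality in Holder's inequality. *)
Lemma dual_lpsum (A : eqType) (s : seq A) (z : A -> R) : 0 < lpsum p s z ->
  exists a : A -> R, \sum_(i <- s) a i * z i = lpsum p s z /\
    forall w, `|\sum_(i <- s) a i * w i| <= lpsum p s w.
Proof.
set N := lpsum p s z => N0.
have nrm (w : A -> R) : 0 < lpsum p s w ->
    \sum_(i <- s) `|(lpsum p s w)^-1 * w i| `^ p = 1.
  move=> W0; rewrite -(lpsum_powR p1) (lpsumZ p1) gtr0_norm ?invr_gt0//.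
  by rewrite mulVf ?gt_eqF// powR1.
pose u i : R := `|N^-1 * z i|.
have uE i : `|z i| = N * u i.
  by rewrite /u normrM gtr0_norm ?invr_gt0// mulrA mulfV ?mul1r// gt_eqF.
have u0 i : 0 <= u i by rewrite normr_ge0.
exists (fun i => Num.sg (z i) * u i `^ (p - 1)); split.
  transitivity (\sum_(i <- s) N * u i `^ p).
    apply: eq_bigr => i _; rewrite -(mulr_powRB1 (u0 i) p0).
    by rewrite mulrAC -normrEsg uE mulrA.
  by rewrite -mulr_sumr nrm// mulr1.
move=> w; apply: le_trans (ler_norm_sum _ _ _) _.
apply: (@le_trans _ _ (\sum_(i <- s) u i `^ (p - 1) * `|w i|)).
  apply: ler_sum => i _; rewrite !normrM (ger0_norm (powR_ge0 _ _)).
  rewrite ler_wpM2r// ler_piMl ?powR_ge0// normr_sg.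
  by case: (z i != 0) => //=; rewrite lexx.
have : 0 <= lpsum p s w := lpsum_ge0 _ _ _.
rewrite le_eqVlt => /orP[/eqP W0|W0].
  rewrite -W0 big_seq big1// => i si; have := lpsum_mem p1 w si.
  by rewrite -W0 normr_le0 => /eqP ->; rewrite normr0 mulr0.
set W := lpsum p s w in W0 *.
pose q := p / (p - 1).
have pm1 : 0 < p - 1 by rewrite subr_gt0.
have q0 : 0 < q by rewrite divr_gt0.
have pq : p^-1 + q^-1 = 1.
  by rewrite /q invf_div; field; rewrite gt_eqF.
(* Young's inequality is applied after normalising both families to l_p norm 1; (p - 1) q = p turns
   the first factor into a p-th power. *)
have young i : u i `^ (p - 1) * `|W^-1 * w i| <= `|W^-1 * w i| `^ p / p + u i `^ p / q.
  rewrite mulrC; apply: le_trans (conjugate_powR _ _ p0 q0 pq) _ => //.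
    exact: powR_ge0.
  by rewrite -powRrM /q mulrCA mulfV ?mulr1// gt_eqF.
have -> : \sum_(i <- s) u i `^ (p - 1) * `|w i| =
    W * \sum_(i <- s) u i `^ (p - 1) * `|W^-1 * w i|.
  rewrite mulr_sumr; apply: eq_bigr => i _.
  have -> : `|w i| = W * `|W^-1 * w i|; last by rewrite mulrCA.
  by rewrite normrM gtr0_norm ?invr_gt0// mulrA mulfV ?mul1r// gt_eqF.
rewrite -[leRHS]mulr1 ler_pM2l//; apply: le_trans (ler_sum _ (fun i _ => young i)) _.
by rewrite big_split/= -mulr_suml -mulr_suml (nrm w W0) (nrm z N0) mul1r mul1r pq.
Qed.

End LpDuality.

Section Norming.
Variables (R : realType) (p : R) (p1 : 1 < p) (Y : submodClosed (Vp0 p1)).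
Notation X := (lsubspace Y).

(** For each chain, l_p duality gives coefficients [a] for which the sum of a_I x(I) is a functional
    in the unit ball taking at [y] the value of the l_p sum over that chain. *)
Lemma norming (y : X) (c : R) :
  (forall phi : cdual X, `|phi| <= 1 -> phi y <= c) -> `|y| <= c.
Proof.
move=> h; apply/ev_norm_leP => s cs.
have c0 : 0 <= c by apply: (h 0); rewrite normr0.
have [/le_trans|N0] := leP (lpsum p s (incr (ev y))) 0; first exact.
have [a [aE ha]] := dual_lpsum p1 N0.
pose G (x : X) : R^o := \sum_(I <- s) a I * incr (ev x) I.
have G_lin : linear G.
  move=> b x z; rewrite /G scaler_sumr -big_split/=; apply: eq_bigr => I _.
  by rewrite /incr !evP -[_ *: _]/(_ * _); ring.
have G_le x : `|G x| <= `|x| by apply: le_trans (ha _) _; exact: ev_norm.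
have G_cont : continuous G.
  apply: (@lipschitz_bound_continuous _ _ _ _ 1) => x z; rewrite mul1r.
  apply: le_trans (G_le (x - z)); rewrite le_eqVlt; apply/orP; left; apply/eqP.
  congr `|_|; rewrite /G -sumrB; apply: eq_bigr => I _.
  by rewrite /incr !evB; ring.
have Gdual : G \in @dual_pred _ X by apply/asboolP.
rewrite -aE; apply: (h (Cdual Gdual)); apply: dual_norm_le => x x1.
by apply: le_trans (G_le x) _.
Qed.

Hypothesis Y_closed : closed [set f : Vp0 p1 | f \in Y].

(** If elements of X approximated the normalised functional uniformly on the dual ball, they would
    form a Cauchy sequence by [norming], and their limit would represent it. *)
Lemma far_from_bidual : ~ reflexive_space X ->
  exists (Phi : cdual (cdual X)) (d : R), [/\ `|Phi| <= 1, 0 < d &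
    forall y : X, exists2 phi : cdual X, `|phi| <= 1 & d < Phi phi - phi y].
Proof.
move=> /existsNP[Phi hPhi].
have M0 : 0 < `|Phi| + 1 by rewrite ltr_wpDl.
set M := `|Phi| + 1 in M0.
exists (M^-1 *: Phi); apply: contrapT => hn.
have hd (d : R) : 0 < d -> exists y : X, forall phi : cdual X, `|phi| <= 1 ->
    `|M^-1 * Phi phi - phi y| <= d.
  move=> d0; apply: contrapT => hy; apply: hn; exists d; split => //.
    by rewrite normrZ gtr0_norm ?invr_gt0// mulrC ler_pdivrMr// mul1r lerDl.
  move=> y; apply: contrapT => hphi; apply: hy; exists y => phi phi1.
  have h (psi : cdual X) : `|psi| <= 1 -> M^-1 * Phi psi - psi y <= d.
    by move=> psi1; rewrite leNgt; apply/negP => hlt; apply: hphi; exists psi.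
  rewrite ler_norml h// andbT.
  have := h (- phi); rewrite normrN linearN => /(_ phi1).
  rewrite (_ : (- phi : cdual X) y = - phi y)// mulrN; lra.
pose d n : R := n.+1%:R^-1.
have d0 n : 0 < d n by rewrite invr_gt0.
have /choice[y yP] := fun n => hd (d n) (d0 n).
have d_small (e : R) : 0 < e -> exists N, forall n, (N <= n)%N -> d n <= e.
  move=> e0; exists (Num.truncn e^-1) => n Nn.
  rewrite /d -[leRHS]invrK lef_pV2 ?posrE ?invr_gt0//.
  by apply/ltW/(lt_le_trans (truncnS_gt _)); rewrite ler_nat ltnS.
have [e e0|z zP] := subspace_complete Y_closed (y := y).
  have e20 : 0 < e / 2 by rewrite divr_gt0.
  have [N hN] := d_small _ e20; exists N => n m Nn Nm.
  apply: norming => phi phi1; rewrite linearB/=.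
  have := yP n _ phi1; have := yP m _ phi1; have := hN _ Nn; have := hN _ Nm.
  rewrite !ler_norml => h1 h2 /andP[h3 h4] /andP[h5 h6]; lra.
have hz (phi : cdual X) : `|phi| <= 1 -> M^-1 * Phi phi = phi z.
  move=> phi1; apply/eqP; rewrite -subr_eq0 -normr_eq0 eq_le normr_ge0 andbT.
  apply/ler_addgt0Pr => e e0; rewrite add0r; have e20 : 0 < e / 2 by rewrite divr_gt0.
  have [N hN] := d_small _ e20; have [N' hN'] := zP _ e20.
  have h1 := yP (N + N')%N _ phi1; have h2 := hN _ (leq_addr N' N).
  have h3 := hN' _ (leq_addl N N').
  have h4 : `|phi (y (N + N')%N) - phi z| <= e / 2.
    rewrite -linearB; apply: le_trans (cdual_le _ _) _; apply: le_trans h3.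
    by rewrite ler_piMl.
  have := ler_normD (M^-1 * Phi phi - phi (y (N + N')%N)) (phi (y (N + N')%N) - phi z).
  rewrite addrA subrK; lra.
apply: (hPhi); exists (M *: z) => phi.
have k0 : 0 < `|phi| + 1 by rewrite ltr_wpDl.
have := hz ((`|phi| + 1)^-1 *: phi).
rewrite normrZ gtr0_norm ?invr_gt0// mulrC ler_pdivrMr// mul1r lerDl ler01 => /(_ isT).
rewrite !linearZ/= mulrCA => /(mulfI (lt0r_neq0 _)); rewrite invr_gt0 => /(_ k0) <-.
by rewrite -[RHS]/(M * (M^-1 * Phi phi)) mulrA mulfV ?mul1r// gt_eqF.
Qed.

End Norming.

(** * Truncated norms and copies of l_p and c_0 *)

Section SequenceNorms.
Variables (R : realType) (p : R) (p1 : 1 < p).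
Let p0 : 0 < p := lt_trans ltr01 p1.

Lemma lp_norm_leP (a : lp p1) (c : R) : 0 <= c ->
  `|a| <= c <-> forall m, lpsum p (iota 0 m) a <= c.
Proof.
move=> c0; have fa : lp_enorm p a \is a fin_num.
  by apply: (extnorm_fin (@lp_enorm_ge0 _ _)); exact: lpP.
have e0 k : (0 <= (`|a k| `^ p)%:E)%E by rewrite lee_fin powR_ge0.
have part m : (\sum_(0 <= k < m) (`|a k| `^ p)%:E)%E =
    (\sum_(i <- iota 0 m) `|a i| `^ p)%:E.
  by rewrite -sumEFin /index_iota subn0.
have -> : `|a| <= c <-> (lp_enorm p a <= c%:E)%E.
  by rewrite -[`|a|]/(fine (lp_enorm p a)) -lee_fin fineK.
have cE : c%:E = ((c `^ p)%:E `^ p^-1)%E.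
  by rewrite poweR_EFin -powRrM mulfV ?gt_eqF// powRr1.
split=> [h m|h].
  rewrite -lee_fin; apply: le_trans h; rewrite /lpsum -poweR_EFin -part.
  apply: gt0_ler_poweR.
  - by rewrite invr_ge0 ltW.
  - by rewrite in_itv/= leey andbT part lee_fin sum_powR_ge0.
  - by rewrite in_itv/= nneseries_ge0// leey.
  - exact: nneseries_lim_ge.
rewrite cE; apply: gt0_ler_poweR.
- by rewrite invr_ge0 ltW.
- by rewrite in_itv/= nneseries_ge0// leey.
- by rewrite in_itv/= leey andbT lee_fin powR_ge0.
apply: lime_le; first by apply: is_cvg_nneseries => k _ _; exact: e0.
near=> m; rewrite part lee_fin -(lpsum_leP p1)//.
Unshelve. all: by end_near. Qed.

Lemma lp_norm_ge (a : lp p1) m : lpsum p (iota 0 m) a <= `|a|.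
Proof. by have /lp_norm_leP := lexx `|a|; apply. Qed.

Lemma lp_iota_le (a : nat -> R) n m : (n <= m)%N ->
  lpsum p (iota 0 n) a <= lpsum p (iota 0 m) a.
Proof.
move=> nm; apply: (lpsum_sub p1).
have -> : iota 0 m = iota 0 n ++ iota n (m - n) by rewrite -iotaD subnKC.
exact: prefix_subseq.
Qed.

Lemma lp_norm_approx (a : lp p1) (e : R) : 0 < e ->
  exists N, forall m, (N <= m)%N -> `|a| - e <= lpsum p (iota 0 m) a.
Proof.
move=> e0; have [ae|ae] := ltP (`|a| - e) 0.
  by exists 0%N => m _; apply: le_trans (lpsum_ge0 _ _ _); exact: ltW.
apply: contrapT => hn.
have : `|a| <= `|a| - e.
  apply/lp_norm_leP => // N; rewrite leNgt; apply/negP => h; apply: hn.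
  by exists N => m Nm; apply: le_trans (ltW h) _; exact: lp_iota_le.
lra.
Qed.

(** The p-th powers of the norms are additive over consecutive blocks of indices, so the argument is
    made on them. *)
Lemma lp_tail (a : lp p1) (e : R) : 0 < e ->
  exists N, forall n m, (N <= n)%N -> (n <= m)%N -> lpsum p (iota n (m - n)) a <= e.
Proof.
move=> e0; have ep : 0 < e `^ p by rewrite powR_gt0.
have [N hN] : exists N, `|a| `^ p - e `^ p <= \sum_(i <- iota 0 N) `|a i| `^ p.
  have [ae|ae] := ltP (`|a| `^ p - e `^ p) 0.
    by exists 0%N; rewrite big_nil ltW.
  apply: contrapT => hn; pose c := (`|a| `^ p - e `^ p) `^ p^-1.
  have cp : c `^ p = `|a| `^ p - e `^ p by rewrite -powRrM mulVf ?gt_eqF// powRr1.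
  have : `|a| <= c.
    apply/lp_norm_leP; first exact: powR_ge0.
    move=> N; rewrite lpsum_leP ?powR_ge0// cp leNgt; apply/negP => h; apply: hn.
    by exists N; exact: ltW.
  move=> /(le_powR (ltW p0) (normr_ge0 a)); rewrite cp; lra.
exists N => n m Nn nm; rewrite lpsum_leP ?(ltW e0)//.
have h1 : \sum_(i <- iota 0 m) `|a i| `^ p <= `|a| `^ p.
  by rewrite -lpsum_leP//; exact: lp_norm_ge.
have h2 : \sum_(i <- iota 0 N) `|a i| `^ p <= \sum_(i <- iota 0 n) `|a i| `^ p.
  by rewrite -!(lpsum_powR p1) le_powR ?lpsum_ge0 ?(ltW p0)// lp_iota_le.
have : iota 0 m = iota 0 n ++ iota n (m - n) by rewrite -iotaD subnKC.
move: h1 => /[swap] ->; rewrite big_cat/=; lra.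
Qed.

Lemma c0_norm_ge (a : c0 R) k : `|a k| <= `|a|.
Proof.
rewrite -[`|a|]/(fine (c0_enorm a)) -lee_fin fineK ?c0_enorm_ge//.
exact: (extnorm_fin (@c0_enorm_ge0 _)) (c0P a).
Qed.

Lemma c0_norm_approx (a : c0 R) (e : R) : 0 < e -> exists k, `|a| - e <= `|a k|.
Proof.
move=> e0; apply: contrapT => hn.
have : `|a| <= `|a| - e.
  rewrite -[X in X <= _]/(fine (c0_enorm a)) -lee_fin fineK; last first.
    exact: (extnorm_fin (@c0_enorm_ge0 _)) (c0P a).
  apply: ge_ereal_sup => _ [k _ <-]; rewrite lee_fin leNgt; apply/negP => h.
  by apply: hn; exists k; exact: ltW.
lra.
Qed.

Lemma c0_tail (a : c0 R) (e : R) : 0 < e -> exists N, forall k, (N <= k)%N -> `|a k| <= e.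
Proof.
move=> e0; case: a => a /= /asboolP /cvgrPdist_le /(_ e e0)[N _ hN].
by exists N => k /hN /=; rewrite sub0r normrN.
Qed.

End SequenceNorms.

Section Copies.
Variables (R : realType) (p : R) (p1 : 1 < p) (Y : submodClosed (Vp0 p1)).
Notation X := (lsubspace Y).
Hypothesis Y_closed : closed [set f : Vp0 p1 | f \in Y].

Lemma contains_copy_lp (u : nat -> X) (c K : R) : 0 < c ->
  (forall beta m, `|\sum_(k <- iota 0 m) beta k *: u k| <= K * lpsum p (iota 0 m) beta) ->
  (forall beta m, c * lpsum p (iota 0 m) beta <= `|\sum_(k <- iota 0 m) beta k *: u k|) ->
  contains_copy X (lp p1).
Proof.
move=> c0 up lo.
have up' beta m : `|\sum_(k <- iota 0 m) beta k *: u k| <=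
    (`|K| + 1) * lpsum p (iota 0 m) beta.
  apply: le_trans (up _ _) _; rewrite ler_wpM2r ?lpsum_ge0//.
  by rewrite (le_trans (ler_norm K))// lerDl.
have K1 : 0 < `|K| + 1 by rewrite ltr_wpDl.
apply: (@contains_copy_sequence R (lp p1) X (fun a => a : nat -> R) u c (`|K| + 1)).
- exact: subspace_complete.
- exact: c0.
- by [].
- move=> a e e0; have [N hN] := lp_tail a (divr_gt0 e0 K1).
  exists N => n m Nn nm.
  (* A block sum is a full sum with the coefficients before [n] set to 0, to which the upper
     estimate applies. *)
  have E (V : nmodType) (F : nat -> V) : \sum_(k <- iota n (m - n)) F k =
      \sum_(k <- iota 0 m) (if (n <= k)%N then F k else 0).
    rewrite -big_mkcond -big_filter; congr (\big[_/_]_(i <- _) _).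
    have -> : iota 0 m = iota 0 n ++ iota n (m - n) by rewrite -iotaD subnKC.
    rewrite filter_cat (eq_in_filter (a2 := pred0)) ?filter_pred0.
      rewrite (eq_in_filter (a2 := predT)) ?filter_predT// => i.
      by rewrite mem_iota => /andP[-> _].
    by move=> i; rewrite mem_iota add0n ltnNge => /andP[_ /negPf].
  rewrite E (eq_bigr (fun k => (if (n <= k)%N then a k else 0) *: u k)); last first.
    by move=> k _; case: ifP => // _; rewrite scale0r.
  apply: le_trans (up' _ _) _; rewrite -ler_pdivlMl// mulrC.
  apply: le_trans (hN n m Nn nm).
  rewrite /lpsum E; apply: le_powR; [by rewrite invr_ge0 ltW// (lt_trans ltr01)|exact: sum_powR_ge0|].
  by apply: ler_sum => k _; case: ifP => // _; rewrite normr0 powR0// gt_eqF// (lt_trans ltr01).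
- move=> a m; apply: le_trans (up' _ _) _; rewrite ler_wpM2l//; exact: lp_norm_ge.
- move=> a e e0; have [N hN] := lp_norm_approx a (divr_gt0 e0 c0).
  exists N => m Nm; apply: le_trans (lo _ _).
  have := hN m Nm; rewrite -(ler_pM2l c0) mulrBr.
  by rewrite [c * (e / c)]mulrC divfK ?gt_eqF.
Qed.

(** The lower estimate is asked only at a coordinate of largest modulus, because the error in
    [c0_sequence] is proportional to the maximum. *)
Lemma contains_copy_c0 (u : nat -> X) (c K : R) : 0 < c ->
  (forall (beta : nat -> R) m B, 0 <= B -> (forall k, (k < m)%N -> `|beta k| <= B) ->
    `|\sum_(k <- iota 0 m) beta k *: u k| <= K * B) ->
  (forall (beta : nat -> R) m k, (k < m)%N ->
    (forall j, (j < m)%N -> `|beta j| <= `|beta k|) ->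
    c * `|beta k| <= `|\sum_(k <- iota 0 m) beta k *: u k|) ->
  contains_copy X (c0 R).
Proof.
move=> c_gt0 up lo.
have K1 : 0 < `|K| + 1 by rewrite ltr_wpDl.
have up' (beta : nat -> R) m B : 0 <= B -> (forall k, (k < m)%N -> `|beta k| <= B) ->
    `|\sum_(k <- iota 0 m) beta k *: u k| <= (`|K| + 1) * B.
  move=> B0 hB; apply: le_trans (up _ _ _ B0 hB) _; rewrite ler_wpM2r//.
  by rewrite (le_trans (ler_norm K))// lerDl.
apply: (@contains_copy_sequence R (c0 R) X (fun a => a : nat -> R) u c (`|K| + 1)).
- exact: subspace_complete.
- exact: c_gt0.
- by [].
- move=> a e e0; have [N hN] := c0_tail a (divr_gt0 e0 K1).
  exists N => n m Nn nm.
  have -> : \sum_(k <- iota n (m - n)) (a : nat -> R) k *: u k =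
      \sum_(k <- iota 0 m) (if (n <= k)%N then (a : nat -> R) k else 0) *: u k.
    have -> : iota 0 m = iota 0 n ++ iota n (m - n) by rewrite -iotaD subnKC.
    rewrite big_cat/= [X in _ = X + _]big_seq [X in _ = X + _]big1 ?add0r.
      rewrite big_seq [RHS]big_seq; apply: eq_bigr => k.
      by rewrite mem_iota => /andP[-> _].
    by move=> k; rewrite mem_iota add0n ltnNge => /andP[_ /negPf ->]; rewrite scale0r.
  apply: le_trans (up' _ _ (e / (`|K| + 1)) _ _) _.
  - by rewrite divr_ge0 ?ltW.
  - move=> k _; case: ifP => [nk|_]; last by rewrite normr0 divr_ge0 ?ltW.
    exact/hN/(leq_trans Nn nk).
  - by rewrite mulrC divfK// gt_eqF.
- move=> a m; apply: up' => // k _; exact: c0_norm_ge.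
- move=> a e e0; have [k0 hk0] := c0_norm_approx a (divr_gt0 e0 c_gt0).
  exists k0.+1 => m k0m.
  pose i := [arg max_(i > Ordinal k0m) `|(a : nat -> R) i|]%O.
  have hi (j : 'I_m) : `|(a : nat -> R) j| <= `|(a : nat -> R) i|.
    by rewrite /i; case: arg_maxP => //= i0 _; apply.
  apply: le_trans (lo (a : nat -> R) m i (ltn_ord i) _); last first.
    by move=> j jm; exact: (hi (Ordinal jm)).
  have := le_trans hk0 (hi (Ordinal k0m)); rewrite -(ler_pM2l c_gt0) mulrBr.
  by rewrite [c * (e / c)]mulrC divfK ?gt_eqF.
Qed.

End Copies.

(** * The dichotomy *)

Lemma gap_contradiction (R : realType) (d x y : R) :
  0 < d -> x <= d / 8 -> d / 2 <= y -> y - x <= d / 4 -> False.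
Proof. lra. Qed.

Section Dichotomy.
Variables (R : realType) (p : R) (p1 : 1 < p) (Y : submodClosed (Vp0 p1)).
Notation X := (lsubspace Y).

(** Radius 2 makes room for differences of two vectors of the unit ball, to which the negation is
    applied. *)
Definition has_bumps := exists2 delta : R, 0 < delta & forall (T : seq R) (eps : R),
  0 < eps -> exists h : X, [/\ `|h| <= 2, exists2 t : R, 0 <= t <= 1 & delta <= `|ev h t| &
    forall x, x \in T -> 0 <= x <= 1 -> `|ev h x| <= eps].

Lemma bumps_lp : closed [set f : Vp0 p1 | f \in Y] -> has_bumps ->
  contains_copy X (lp p1).
Proof.
move=> Yc [delta delta0 hb].
pose H := [set g : R -> R | exists2 y : X, `|y| <= 2 & g = ev y].
have Hv h : H h -> var_le p h 2 by move=> [y y2 ->]; apply/ev_norm_leP.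
have Hz h : H h -> vanishing_var p h by move=> [y _ ->]; exact: ev_van.
have Hb (T : seq R) (eps : R) : 0 < eps -> exists h,
    [/\ H h, exists2 t : R, 0 <= t <= 1 & delta <= `|h t| &
      forall x : R, x \in T -> 0 <= x <= 1 -> `|h x| <= eps].
  by move=> /(hb T)[h [h2 ht hT]]; exists (ev h); split => //; exists h.
have [h [K [Hh up lo]]] := lp_sequence p1 Hv Hz delta0 Hb.
have /choice[u uP] : forall k, exists y : X, h k = ev y.
  by move=> k; have [y _ ->] := Hh k; exists y.
have incrE (beta : nat -> R) m I : incr (ev (\sum_(k <- iota 0 m) beta k *: u k)) I =
    \sum_(i <- iota 0 m) beta i * incr (h i) I.
  by rewrite incr_ev_sum; apply: eq_bigr => i _; rewrite uP.
apply: (@contains_copy_lp _ _ _ _ Yc u (delta / 4) K).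
- by rewrite divr_gt0.
- move=> beta m; apply/ev_norm_leP => s cs.
  by rewrite (lpsum_eq _ _ (incrE beta m)); exact: up.
- move=> beta m; have [s cs hs] := lo beta m; apply: le_trans hs _.
  by rewrite -(lpsum_eq _ _ (incrE beta m)); exact: ev_norm.
Qed.

(** [F] is the pointwise limit along a free ultrafilter. Without bumps, smallness of f n - f m on a
    finite set makes it small everywhere, so the convergence is uniform. *)
Lemma no_bumps_cvg (f : nat -> X) : (forall n, `|f n| <= 1) -> ~ has_bumps ->
  exists F : R -> R, var_le p F 1 /\ forall (e : R) N, 0 < e ->
    exists2 n, (N <= n)%N & forall x : R, 0 <= x <= 1 -> `|ev (f n) x - F x| <= e.
Proof.
move=> f1 nb.
have [U [UU U_inf]] := ultraFilterLemma (F := \oo) _.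
have UP : ProperFilter U by exact: ultra_proper.
have /choice[F FP] : forall t : R, exists l : R, forall e : R, 0 < e ->
    U [set n | `|ev (f n) t - l| <= e].
  move=> t; pose v n : R := ev (f n) t.
  have vU : U [set n | v n \in `[-1, 1]%R].
    apply: filterS (@filterT _ U _) => n _; rewrite /= in_itv /= -ler_norml.
    exact: le_trans (ev_pt _ _) (f1 n).
  have [l [_ lcl]] := @segment_compact R (-1) 1 (v @ U) _ vU.
  exists l => e e0; have [//|nV] := in_ultra_setVsetC [set n | `|v n - l| <= e] UU.
  have [x [/= h1 h2]] := lcl [set x | ~ `|x - l| <= e] (ball l e) nV (nbhsx_ballx _ _ e0).
  by exfalso; apply: h1; rewrite distrC; exact: ltW.
have uni (d : R) : 0 < d -> U [set n | forall x : R, 0 <= x <= 1 -> `|ev (f n) x - F x| <= d].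
  move=> d0; have [T [eps eps0 hT]] : exists (T : seq R), exists2 eps : R, 0 < eps &
      forall h : X, `|h| <= 2 -> (forall x, x \in T -> 0 <= x <= 1 -> `|ev h x| <= eps) ->
      forall t, 0 <= t <= 1 -> `|ev h t| < d.
    apply: contrapT => hn; apply: nb; exists d => // T eps eps0.
    apply: contrapT => hh; apply: hn; exists T, eps => // h h2 hx t t01.
    rewrite ltNge; apply/negP => dt; apply: hh; exists h; split => //.
    by exists t.
  have e20 : 0 < eps / 2 by rewrite divr_gt0.
  have UT : U [set n | forall x, x \in T -> `|ev (f n) x - F x| <= eps / 2].
    by apply: filter_forall_seq => x _; exact: FP.
  apply: filterS UT => n nT x x01; apply/ler_addgt0Pr => e e0.
  (* [m] depends on [x] and [e]: it only serves to replace [F] by an element of the sequence at [x]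
     and on [T]. *)
  have [m [mT mx]] := filter_ex (filterI (filter_forall_seq
    (A := fun x => [set n | `|ev (f n) x - F x| <= eps / 2]) _ (fun x (_ : x \in T) => FP x _ e20))
    (FP x e e0)).
  have h1 : `|ev (f n - f m) x| < d.
    apply: hT x01 => [|y yT _].
      apply: le_trans (ler_normB _ _) _.
      by rewrite [leRHS](_ : 2 = 1 + 1 :> R)//; exact: lerD (f1 n) (f1 m).
    rewrite evB; have := nT y yT; have := mT y yT => /= a b.
    have -> : ev (f n) y - ev (f m) y = (ev (f n) y - F y) - (ev (f m) y - F y) by ring.
    by apply: le_trans (ler_normB _ _) _; lra.
  have -> : ev (f n) x - F x = ev (f n - f m) x + (ev (f m) x - F x) by rewrite evB; ring.
  by apply: le_trans (ler_normD _ _) _; rewrite lerD// ltW.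
exists F; split.
  apply: (var_le_limit p1) => T d d0; have [n hn] := filter_ex (uni _ d0).
  by exists (ev (f n)); split; [apply/ev_norm_leP|move=> t _; exact: hn].
move=> e N e0; have UN : U [set n | (N <= n)%N] by apply: U_inf; exists N.
by have [n [hn Nn]] := filter_ex (filterI (uni _ e0) UN); exists n.
Qed.

Lemma uniform_limit_c0 (f : nat -> X) (F : R -> R) : closed [set f : Vp0 p1 | f \in Y] ->
  (forall n, `|f n| <= 1) -> var_le p F 1 -> ~ vanishing_var p F ->
  (forall e : R, 0 < e -> exists n, forall x : R, 0 <= x <= 1 -> `|ev (f n) x - F x| <= e) ->
  contains_copy X (c0 R).
Proof.
move=> Yc f1 Fv nF fF.
pose H := [set g : R -> R | exists y : X, g = ev y].
have H0 : H (fun=> 0) by exists 0; apply/funext => t; rewrite ev0.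
have HD (a : R) g h : H g -> H h -> H (fun x => a * g x + h x).
  by move=> [y ->] [z ->]; exists (a *: y + z); apply/funext => t; rewrite evP.
have [u' [K [c [Hu c_gt0 up lo]]]] := c0_sequence p1 (f := fun n => ev (f n)) H0 HD
  (fun n => ex_intro _ (f n) erefl) (fun n => (ev_norm_leP (f n) 1).1 (f1 n))
  (fun n => @ev_van _ _ _ _ (f n)) Fv fF nF.
have /choice[u uP] := Hu.
have incrE (beta : nat -> R) m I : incr (ev (\sum_(k <- iota 0 m) beta k *: u k)) I =
    \sum_(i <- iota 0 m) beta i * incr (u' i) I.
  by rewrite incr_ev_sum; apply: eq_bigr => i _; rewrite uP.
apply: (@contains_copy_c0 _ _ _ _ Yc u c K) => //.
- move=> beta m B B0 hB; apply/ev_norm_leP => s cs.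
  by rewrite (lpsum_eq _ _ (incrE beta m)); exact: up.
- move=> beta m k km hk; have [s cs hs] := lo beta m k km hk; apply: le_trans hs _.
  by rewrite -(lpsum_eq _ _ (incrE beta m)); exact: ev_norm.
Qed.

(** An early and a late average, each within d/8 of [F], are within d/4 of each other, whereas a
    functional of the James sequence separates them by d/2 - d/8 > d/4. *)
Lemma james_not_vanishing (f : nat -> X) (phi : nat -> cdual X) (d : R) (F : R -> R) :
  0 < d -> (forall n, `|f n| <= 1) -> (forall n, `|phi n| <= 1) ->
  (forall i n, (i <= n)%N -> d / 2 <= phi i (f n)) ->
  (forall i n, (n < i)%N -> `|phi i (f n)| <= d / 8) ->
  var_le p F 1 ->
  (forall (e : R) N, 0 < e ->
    exists2 n, (N <= n)%N & forall x : R, 0 <= x <= 1 -> `|ev (f n) x - F x| <= e) ->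
  ~ vanishing_var p F.
Proof.
move=> d0 f1 phi1 hlow hup Fv fF vF; have d80 : 0 < d / 8 by rewrite divr_gt0.
pose avg (M : nat) (nu : nat -> nat) : X := \sum_(i <- iota 0 M) M%:R^-1 *: f (nu i).
have near N : exists (M : nat) (nu : nat -> nat), [/\ (0 < M)%N, forall i, (N <= nu i)%N &
    forall s, chain s -> lpsum p s (fun I => incr (ev (avg M nu)) I - incr F I) <= d / 8].
  have [e e0|M [nu [M0 hM]]] := average_cvg p1 (f := fun n => ev (f (n + N)%N))
    (fun n => (ev_norm_leP _ 1).1 (f1 (n + N)%N)) (fun n => @ev_van _ _ _ _ (f (n + N)%N))
    Fv _ vF d80.
    have [n Nn hn] := fF e N e0; exists (n - N)%N; by rewrite subnK.
  exists M, (fun i => (nu i + N)%N); split; [exact: M0|by move=> i; exact: leq_addl|move=> s cs].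
  apply: le_trans (hM s cs); rewrite le_eqVlt; apply/orP; left; apply/eqP.
  by apply: lpsum_eq => I; rewrite /avg (incr_ev_sum _ _ (fun i => f (nu i + N)%N)).
have [M [nu [M0 _ hM]]] := near 0%N.
(* [L] exceeds all indices of the first average, so [phi L] is small on it and large on every later
   term. *)
pose L := (\max_(i < M) nu i).+1.
have [M' [nu' [M'0 nuL hM']]] := near L.
have close : `|avg M' nu' - avg M nu| <= d / 4.
  apply/ev_norm_leP => s cs.
  rewrite (lpsum_eq _ _ (psi := fun I => (incr (ev (avg M' nu')) I - incr F I) -
     (incr (ev (avg M nu)) I - incr F I))); last first.
    by move=> I; rewrite /incr !evB; ring.
  apply: le_trans (lpsumB p1 _ _ _) _; rewrite [leRHS](_ : _ = d / 8 + d / 8); last by field.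
  exact: lerD (hM' s cs) (hM s cs).
have h1 : phi L (avg M nu) <= d / 8.
  rewrite /avg linear_sum; apply: (@le_trans _ _ (\sum_(i <- iota 0 M) M%:R^-1 * (d / 8))).
    rewrite big_seq [leRHS]big_seq; apply: ler_sum => i.
    rewrite mem_iota add0n => /andP[_ iM]; rewrite linearZ/= ler_wpM2l ?invr_ge0//.
    apply: le_trans (ler_norm _) _; apply: hup; rewrite /L ltnS.
    exact: (leq_bigmax (Ordinal iM)).
  rewrite big_const_seq count_predT size_iota iter_addr_0 -[X in X <= _]mulr_natl mulrA.
  by rewrite mulfV ?mul1r// pnatr_eq0 -lt0n.
have h2 : d / 2 <= phi L (avg M' nu').
  rewrite /avg linear_sum; apply: (@le_trans _ _ (\sum_(i <- iota 0 M') M'%:R^-1 * (d / 2))).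
    rewrite big_const_seq count_predT size_iota iter_addr_0 -[X in _ <= X]mulr_natl mulrA.
    by rewrite mulfV ?mul1r// pnatr_eq0 -lt0n.
  apply: ler_sum => i _; rewrite linearZ/= ler_wpM2l ?invr_ge0//.
  exact/hlow/nuL.
have : phi L (avg M' nu' - avg M nu) <= d / 4.
  apply: le_trans (ler_norm _) _; apply: le_trans (cdual_le _ _) _.
  by apply: le_trans close; rewrite ler_piMl.
rewrite linearB/=; exact: gap_contradiction d0 h1 h2.
Qed.

End Dichotomy.

Theorem theoremH (R : realType) (p : R) (p1 : 1 < p) (Y : submodClosed (Vp0 p1)) :
  closed [set f : Vp0 p1 | f \in Y] ->
  ~ reflexive_space (lsubspace Y) ->
  contains_copy (lsubspace Y) (c0 R) \/ contains_copy (lsubspace Y) (lp p1).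

Proof.
move=> Yc nrefl.
have [/(bumps_lp Yc)|nb] := pselect (has_bumps Y); first by right.
left; have [Phi [d [Phi1 d0 hd]]] := far_from_bidual Yc nrefl.
have [f [phi [f1 phi1 hlow hup]]] := james_sequence Phi1 d0 hd.
have [F [Fv fF]] := no_bumps_cvg f1 nb.
apply: (uniform_limit_c0 Yc f1 Fv).
  exact: (james_not_vanishing d0 f1 phi1 hlow hup Fv fF).
by move=> e e0; have [n _ hn] := fF e 0%N e0; exists n.
Qed.
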